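(* Let $\Omega\subseteq\mathbb{R}^3$ be open, let $1\le p<q<\infty$ and put $\theta=p/q$. Then there is a constant $C>0$, independent of $f$, such that for every $f$ with $\|(\boldsymbol{\alpha}\cdot\mathbf{p})f\|_{p,\Omega}<\infty$ and $f\in B^{\theta/(\theta-1)}(\Omega)$, $$\|f\|_{q,\infty;\Omega}\le C\,\|(\boldsymbol{\alpha}\cdot\mathbf{p})f\|_{p,\Omega}^{\theta}\,\|f\|_{B^{\theta/(\theta-1)}(\Omega)}^{1-\theta}.$$
   Context: Functions are $\mathbb{C}^4$-valued. $\boldsymbol{\alpha}=(\alpha_1,\alpha_2,\alpha_3)$ is the triple of Dirac matrices, $\alpha_j=\begin{pmatrix}0_2&\sigma_j\\ \sigma_j&0_2\end{pmatrix}$, where $0_2$ is the $2\times2$ zero matrix and $\sigma_1=\begin{pmatrix}0&1\\1&0\end{pmatrix}$, $\sigma_2=\begin{pmatrix}0&-i\\ i&0\end{pmatrix}$, $\sigma_3=\begin{pmatrix}1&0\\0&-1\end{pmatrix}$. $\mathbf{p}=-i\nabla$, so $\boldsymbol{\alpha}\cdot\mathbf{p}=-i\sum_{j=1}^3\alpha_j\,\partial/\partial x_j$. $|\cdot|$ is the Euclidean norm on $\mathbb{C}^4$, and $\|f\|_{p,\Omega}=\left(\int_\Omega|f(\mathbf{x})|^p\,d\mathbf{x}\right)^{1/p}$. For $t>0$, and with $f$ put equal to zero outside $\Omega$ if $\Omega\ne\mathbb{R}^3$, define $$(\mathbb{P}_tf)(\mathbf{x})=\frac{1}{(4\pi t)^{3/2}}\int_{\mathbb{R}^3}f(\mathbf{y})e^{-|\mathbf{x}-\mathbf{y}|^2/4t}\,d\mathbf{y}.$$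 For real $\alpha$ set $\|f\|_{B^\alpha(\Omega)}=\sup_{t>0}\{t^{-\alpha/2}\sup_{\mathbf{x}\in\Omega}|\mathbb{P}_tf(\mathbf{x})|\}$, and let $B^\alpha(\Omega)$ be the completion of $[C_0^\infty(\Omega)]^4$ with respect to $\|\cdot\|_{B^\alpha(\Omega)}$. The weak-$L^q$ space $L^{q,\infty}(\Omega)$ is defined by $\|f\|_{q,\infty;\Omega}=\left(\sup_{u>0}\{u^q\,\lambda(|f|\ge u)\}\right)^{1/q}$, where $\lambda$ is Lebesgue measure and $\lambda(|f|\ge u)$ is the measure of the set of points of $\Omega$ at which $|f(\mathbf{x})|\ge u$.
   Formalization: For Ω≠R³, (α·p)f is taken on R³ for f extended by zero and must be a function vanishing outside Ω; with derivatives only inside Ω the claim fails (Ω a ball, f constant, p=1, q=3). Elements f of B are taken to be functions with absolutely convergent P_t f. *)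

(* Defs.v *)
From HB Require Import structures.
From mathcomp Require Import all_boot all_order all_algebra.
From mathcomp Require Import complex.
From mathcomp Require Import all_classical all_reals all_analysis.

Set Implicit Arguments.
Unset Strict Implicit.
Unset Printing Implicit Defensive.

Import Order.TTheory GRing.Theory Num.Theory.
Import numFieldNormedType.Exports.

Local Open Scope classical_set_scope.
Local Open Scope ring_scope.
Local Open Scope complex_scope.

(* The library gives R * R * R the product topology and Borel sigma-algebra;
   its norm there is the sup norm, so the Euclidean distance is explicit. *)
Notation R3 R := (R * R * R)%type.
Notation C4 R := 'cV[R[i]]_4.

Section definitions.
Context {R : realType}.
Implicit Types (Omega K : set (R3 R)) (f g : R3 R -> C4 R) (psi : R3 R -> R).

Definition lambda3 : {measure set (R3 (measurableTypeR R)) -> \bar R} :=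
  (@lebesgue_measure R \x @lebesgue_measure R \x @lebesgue_measure R)%E.

Definition basis3 (j : 'I_3) : R3 R :=
  tnth [tuple ((1, 0), 0); ((0, 1), 0); ((0, 0), 1)] j.

Definition dist2 (x y : R3 R) : R :=
  (x.1.1 - y.1.1) ^+ 2 + (x.1.2 - y.1.2) ^+ 2 + (x.2 - y.2) ^+ 2.

Definition enorm (z : C4 R) : R :=
  Num.sqrt (\sum_i ((complex.Re (z i 0)) ^+ 2 + (complex.Im (z i 0)) ^+ 2)).

Definition partial (j : 'I_3) psi : R3 R -> R := fun x => 'D_(basis3 j) psi x.

Fixpoint Ck (k : nat) psi : Prop :=
  match k with
  | 0%N => continuous psi
  | k'.+1 => [/\ continuous psi,
               forall j x, derivable psi x (basis3 j) &
               forall j, Ck k' (partial j psi)]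
  end.

Definition test_fun Omega psi : Prop :=
  [/\ forall k, Ck k psi,
      compact (closure [set x | psi x != 0]) &
      closure [set x | psi x != 0] `<=` Omega].

Definition test_fun4 Omega f : Prop :=
  forall i, test_fun Omega (fun x => complex.Re (f x i 0)) /\
            test_fun Omega (fun x => complex.Im (f x i 0)).

Definition zero_ext Omega f : R3 R -> C4 R := patch (fun _ => 0) Omega f.

(* Integrability includes (Borel) measurability of all components. *)
Definition integrable4 K f : Prop :=
  forall i, lambda3.-integrable K (fun x => (complex.Re (f x i 0))%:E) /\
            lambda3.-integrable K (fun x => (complex.Im (f x i 0))%:E).

Definition integral4 f : C4 R :=
  \col_i ((\int[lambda3]_x complex.Re (f x i 0)) +i*
           (\int[lambda3]_x complex.Im (f x i 0))).

Definition pauli (j : 'I_3) : 'M[R[i]]_2 :=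
  tnth [tuple (block_mx 0 1%:M 1%:M 0 : 'M[R[i]]_(1 + 1));
              (block_mx 0 (- 'i%C)%:M ('i%C)%:M 0 : 'M[R[i]]_(1 + 1));
              (block_mx 1%:M 0 0 (-1)%:M : 'M[R[i]]_(1 + 1))] j.

Definition dirac_mx (j : 'I_3) : 'M[R[i]]_4 :=
  (block_mx 0 (pauli j) (pauli j) 0 : 'M[R[i]]_(2 + 2)).

Definition loc_integrable4 f : Prop :=
  forall K, compact K -> integrable4 K f.

(* g = (alpha . p) f as distributions on the whole of R^3, with
   (alpha . p) f = - i \sum_j alpha_j d_j f and <d_j f, psi> = - <f, d_j psi>.
   Real-valued scalar test functions suffice, by linearity. For a function on
   Omega this is meant to be applied to zero extensions: a jump of f across the
   boundary of Omega counts. *)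
Definition dirac_distr f g : Prop :=
  [/\ loc_integrable4 f, loc_integrable4 g &
   forall psi, test_fun setT psi ->
     integral4 (fun x => (psi x)%:C *: g x) =
     - 'i%C *: \sum_(j < 3)
        dirac_mx j *m (- integral4 (fun x => (partial j psi x)%:C *: f x))].

Definition heat_kernel (t : R) (x y : R3 R) : R :=
  ((4 * pi * t) `^ (3 / 2))^-1 * expR (- dist2 x y / (4 * t)).

Definition heat (t : R) f (x : R3 R) : C4 R :=
  integral4 (fun y => (heat_kernel t x y)%:C *: f y).

Local Open Scope ereal_scope.

Definition lp_norm Omega (p : R) f : \bar R :=
  (\int[lambda3]_(x in Omega) ((enorm (f x)) `^ p)%:E) `^ (p^-1).

Definition weak_norm Omega (q : R) f : \bar R :=
  (ereal_sup [set (u `^ q)%:E * lambda3 (Omega `&` [set x | (u <= enorm (f x))%R])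
             | u in [set u | (0 < u)%R]]) `^ (q^-1).

Definition besov_norm Omega (a : R) f : \bar R :=
  ereal_sup
    [set (t `^ (- a / 2))%:E *
         ereal_sup [set (enorm (heat t (zero_ext Omega f) x))%:E | x in Omega]
    | t in [set t | (0 < t)%R]].

(* A function f represents an element of the completion of the test functions
   when P_t f is given by a convergent integral, and f has finite norm and is a
   limit of test functions in that norm. These limits may be taken to be of
   finite norm: for a < -3 a test function of non-zero mean has infinite norm. *)
Definition besov_space Omega (a : R) f : Prop :=
  [/\ forall t x, (0 < t)%R -> Omega x ->
        integrable4 setT (fun y => (heat_kernel t x y)%:C *: zero_ext Omega f y),
      besov_norm Omega a f < +oo &
      forall e : R, (0 < e)%R -> exists2 phi, test_fun4 Omega phi &
        besov_norm Omega a (fun y => f y - phi y)%R < e%:E].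

End definitions.

(* Main.v *)
Require Import Defs.
From HB Require Import structures.
From mathcomp Require Import all_boot all_order all_algebra.
From mathcomp Require Import complex.
From mathcomp Require Import all_classical all_reals all_analysis.
From mathcomp Require Import measurable_realfun ring lra.
Set Implicit Arguments.
Unset Strict Implicit.
Unset Printing Implicit Defensive.
Import Order.TTheory GRing.Theory Num.Theory.
Import numFieldNormedType.Exports.
Local Open Scope classical_set_scope.
Local Open Scope ring_scope.

(* Since (alpha.p)^2 = -Laplacian, the equation (alpha.p) f = g gives, for each real component
   phi of f, the weak equation Lap phi = - div b with |b| bounded by a multiple of |g|. Integrating
   the heat flow in time, P_t phi - phi is, almost everywhere, bounded by the integral over
   s in (0, sqrt (2 t)] of Gaussian means of |g|, a potential of weak type (p, p) with constant
   of order sqrt t. On the set where |f| >= u some component satisfies |phi| >= u/3; choosing t so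
   that the Besov bound forces |P_t f| <= u/6, that set lies, up to a null set, in a level set of
   the potential, and its measure is at most a constant times (sqrt t / u)^p ||g||_p^p. *)

Section product_sigma_finite.
Context d1 d2 (T1 : measurableType d1) (T2 : measurableType d2) (R : realType).
Variable m1 : {sigma_finite_measure set T1 -> \bar R}.
Variable m2 : {sigma_finite_measure set T2 -> \bar R}.

Lemma sigma_finite_product : sigma_finite setT (m1 \x m2)%E.
Proof.
have /sigma_finiteP[F [TF ndF Foo]] := sigma_finiteT m1.
have /sigma_finiteP[G [TG ndG Goo]] := sigma_finiteT m2.
exists (fun n => F n `*` G n).
  rewrite -setXTT TF TG predeqE => -[x y]; split=> [|[n _ [/= Fx Gy]]]; last first.
    by split; exists n.
  move=> [/= [n _ Fnx] [k _ Gky]]; exists (maxn n k) => //; split.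
  - by move: x Fnx; exact/subsetPset/ndF/leq_maxl.
  - by move: y Gky; exact/subsetPset/ndG/leq_maxr.
move=> k; have [mF Fk] := Foo k; have [mG Gk] := Goo k.
split; first exact: measurableX.
by rewrite product_measure1E// lte_mul_pinfty// ge0_fin_numE.
Qed.

Definition product_sfm : {sigma_finite_measure set (T1 * T2)%type -> \bar R} :=
  HB.pack (m1 \x m2)%E (Measure_isSigmaFinite.Build _ _ _ (m1 \x m2)%E sigma_finite_product).

End product_sigma_finite.

(* Convertible to [lambda3], which is only declared as a measure; Fubini needs sigma-finiteness. *)
Definition L3 (R : realType) : {sigma_finite_measure set (R3 (measurableTypeR R)) -> \bar R} :=
  product_sfm (product_sfm (@lebesgue_measure R) (@lebesgue_measure R)) (@lebesgue_measure R).
(** * The heat kernel *)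

Section heat.
Context {R : realType}.
Local Notation mu := (@lebesgue_measure R).
Local Notation T3 := (R3 (measurableTypeR R)).
Implicit Types (a b c s t u L : R) (x y z : R3 R).

Definition nrm2 x : R := x.1.1 ^+ 2 + x.1.2 ^+ 2 + x.2 ^+ 2.

Definition heatH s x y : R :=
  ((Num.sqrt (2 * pi) * s) ^+ 3)^-1 * expR (- dist2 x y / (2 * s ^+ 2)).

Lemma dist2_ge0 x y : 0 <= dist2 x y.
Proof. by rewrite /dist2 !addr_ge0// sqr_ge0. Qed.

Lemma dist2C x y : dist2 x y = dist2 y x.
Proof. by rewrite /dist2; ring. Qed.

Lemma nrm2_ge0 x : 0 <= nrm2 x.
Proof. by rewrite /nrm2 !addr_ge0// sqr_ge0. Qed.

Lemma heatHC s x y : heatH s x y = heatH s y x.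
Proof. by rewrite /heatH dist2C. Qed.

Lemma heatH_const_gt0 s : 0 < s -> 0 < ((Num.sqrt (2 * pi) * s) ^+ 3)^-1.
Proof.
by move=> s0; rewrite invr_gt0 exprn_gt0// mulr_gt0// sqrtr_gt0 mulr_gt0// pi_gt0.
Qed.

Lemma heatH_ge0 s x y : 0 <= s -> 0 <= heatH s x y.
Proof.
by move=> s0; rewrite mulr_ge0 ?expR_ge0// invr_ge0 exprn_ge0// mulr_ge0// sqrtr_ge0.
Qed.

Lemma heat_kernelE s x y : 0 < s -> heat_kernel (s ^+ 2 / 2) x y = heatH s x y.
Proof.
move=> s0; rewrite /heat_kernel /heatH; congr (_^-1 * expR (_ / _)).
  have A0 : 0 <= 2 * pi * s ^+ 2 :> R by rewrite mulr_ge0 ?sqr_ge0// mulr_ge0 ?pi_ge0.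
  have -> : Num.sqrt (2 * pi) * s = (2 * pi * s ^+ 2) `^ (1 / 2).
    rewrite div1r powR12_sqrt// (sqrtrM (s ^+ 2)) ?mulr_ge0 ?pi_ge0// sqrtr_sqr.
    by rewrite ger0_norm// ltW.
  rewrite -[RHS]powR_mulrn ?powR_ge0// -powRrM.
  by congr (_ `^ _); field.
by field.
Qed.

Lemma normal_peakE s : 0 < s -> normal_peak s = (Num.sqrt (2 * pi) * s)^-1.
Proof.
move=> s0; rewrite /normal_peak; congr (_^-1).
rewrite (_ : _ *+ 2 = (2 * pi) * s ^+ 2); last by rewrite -mulr_natl; ring.
by rewrite (sqrtrM (s ^+ 2)) ?mulr_ge0 ?pi_ge0// sqrtr_sqr ger0_norm// ltW.
Qed.

Lemma heatH_prod s x y : 0 < s -> heatH s x y =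
  normal_pdf x.1.1 s y.1.1 * normal_pdf x.1.2 s y.1.2 * normal_pdf x.2 s y.2.
Proof.
move=> s0; rewrite !normal_pdfE ?gt_eqF// /heatH !normal_peakE// /normal_fun.
rewrite !mulrA.
set c := (Num.sqrt _ * _).
rewrite [X in _ = X](_ : _ = c^-1 ^+ 3 * (expR (- (y.1.1 - x.1.1) ^+ 2 / (s ^+ 2 *+ 2)) *
 expR (- (y.1.2 - x.1.2) ^+ 2 / (s ^+ 2 *+ 2)) * expR (- (y.2 - x.2) ^+ 2 / (s ^+ 2 *+ 2)))); last by ring.
rewrite -!expRD exprVn; congr (_ * expR _).
rewrite /dist2 -mulr_natl; field.
by rewrite gt_eqF.
Qed.

(* With [u = dist2 x y / s^2], the left side is [8 (1 + u) exp (- 3 u / 8)] times [heatH (2 * s) x y]. *)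
Lemma heatH_moment s x y : 0 < s ->
  (1 + dist2 x y / s ^+ 2) * heatH s x y <= 24 * heatH (2 * s) x y.
Proof.
move=> s0; rewrite /heatH.
set u := dist2 x y / s ^+ 2.
have u0 : 0 <= u by rewrite divr_ge0 ?dist2_ge0 ?sqr_ge0.
have -> : - dist2 x y / (2 * s ^+ 2) = - (u / 8) + - (3 * u / 8).
  by rewrite /u; field; rewrite gt_eqF.
have -> : - dist2 x y / (2 * (2 * s) ^+ 2) = - (u / 8).
  by rewrite /u; field; rewrite gt_eqF.
have cp := heatH_const_gt0 s0.
have -> : ((Num.sqrt (2 * pi) * (2 * s)) ^+ 3)^-1 = 8^-1 * ((Num.sqrt (2 * pi) * s) ^+ 3)^-1.
  rewrite -invfM; congr (_^-1); ring.
set c := _^-1 in cp *.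
rewrite expRD.
have E := expR_gt0 (- (u/8)).
set e := expR (- (u / 8)) in E *.
have : (1 + u) * expR (- (3 * u / 8)) <= 3.
  rewrite expRN ler_pdivrMr ?expR_gt0//.
  have := expR_ge1Dx (3 * u / 8) => h.
  lra.
set f := expR _ => h.
have -> : (1 + u) * (c * (e * f)) = c * e * ((1 + u) * f) by ring.
have -> : 24 * (8^-1 * c * e) = c * e * 3 by field.
by apply: ler_wpM2l => //; rewrite mulr_ge0 ?ltW.
Qed.

Lemma dist2_lb x y : nrm2 y / 2 - nrm2 x <= dist2 x y.
Proof.
rewrite /nrm2 /dist2.
have h (a b : R) : b ^+ 2 / 2 - a ^+ 2 <= (a - b) ^+ 2.
  have := sqr_ge0 (2 * a - b); nra.
have := h x.1.1 y.1.1; have := h x.1.2 y.1.2; have := h x.2 y.2; lra.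
Qed.

Lemma heatH_gauss a s b L x y : 0 < a -> a <= s -> s <= b -> nrm2 x <= L ->
  heatH s x y <= ((Num.sqrt (2 * pi) * a) ^+ 3)^-1 * expR (L / (2 * a ^+ 2)) *
                 expR (- (4 * b ^+ 2)^-1 * nrm2 y).
Proof.
move=> a0 as_ sb xL.
have s0 : 0 < s by exact: lt_le_trans as_.
have b0 : 0 < b by exact: lt_le_trans sb.
rewrite -mulrA -expRD; apply: ler_pM.
- exact/ltW/heatH_const_gt0.
- exact: expR_ge0.
- have c0 : 0 < Num.sqrt (2 * pi) :> R by rewrite sqrtr_gt0 mulr_gt0// pi_gt0.
  rewrite lef_pV2 ?posrE ?exprn_gt0 ?mulr_gt0//.
  by rewrite lerXn2r ?nnegrE ?mulr_ge0 ?ler_pM2l// ltW.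
- rewrite ler_expR.
  have h1 := dist2_lb x y.
  have h2 : - dist2 x y / (2 * s ^+ 2) <= (L - nrm2 y / 2) / (2 * s ^+ 2).
    by rewrite ler_pM2r ?invr_gt0 ?mulr_gt0 ?exprn_gt0//; lra.
  apply: (le_trans h2); rewrite mulrBl; apply: lerD.
    apply: ler_wpM2l; first exact: le_trans (nrm2_ge0 x) xL.
    rewrite lef_pV2 ?posrE ?mulr_gt0 ?exprn_gt0// ler_pM2l//.
    by rewrite lerXn2r// nnegrE ltW.
  have -> : nrm2 y / 2 / (2 * s ^+ 2) = (4 * s ^+ 2)^-1 * nrm2 y by field; rewrite gt_eqF.
  rewrite mulNr lerN2; apply: ler_wpM2r; first exact: nrm2_ge0.
  rewrite lef_pV2 ?posrE ?mulr_gt0 ?exprn_gt0// ler_pM2l//.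
  by rewrite lerXn2r// nnegrE ltW.
Qed.

(* Away from the diagonal the kernels are dominated uniformly as [s] tends to [0]. *)
Lemma heatH_far s x y : 0 < s -> s <= 1 -> 1 <= dist2 x y ->
  heatH s x y <= 32 * ((Num.sqrt (2 * pi)) ^+ 3)^-1 * expR (- dist2 x y / 4).
Proof.
move=> s0 s1 d1; rewrite /heatH.
set q := dist2 x y in d1 *.
have c0 : 0 < ((Num.sqrt (2 * pi)) ^+ 3)^-1 :> R.
  by rewrite invr_gt0 exprn_gt0// sqrtr_gt0 mulr_gt0// pi_gt0.
set c := _^-1 in c0 *.
rewrite exprMn invfM -/c.
have v0 : 0 < (s ^+ 2)^-1 by rewrite invr_gt0 exprn_gt0.
set v := (s ^+ 2)^-1.
have v1 : 1 <= v by rewrite invf_ge1 ?exprn_gt0// exprn_ile1// ltW.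
have -> : - q / (2 * s ^+ 2) = - (q * v / 4) + - (q * v / 4).
  by rewrite /v; field; rewrite gt_eqF.
rewrite expRD.
have h1 : expR (- (q * v / 4)) <= expR (- q / 4) by rewrite ler_expR; nra.
have h2 : (s ^+ 3)^-1 * expR (- (q * v / 4)) <= 32.
  apply: (@le_trans _ _ (v ^+ 2 * expR (- (v / 4)))).
    apply: ler_pM; rewrite ?expR_ge0// ?invr_ge0 ?exprn_ge0 ?(ltW s0)//.
      rewrite -exprVn /v -exprVn -exprM.
      by apply: ler_weXn2l => //; rewrite invf_ge1.
    by rewrite ler_expR; nra.
  rewrite expRN ler_pdivrMr ?expR_gt0//.
  have w0 : 0 <= v / 4 by rewrite divr_ge0// ltW.
  have := @expR_ge1Dxn R (v / 4) 1 w0; rewrite (_ : 2`! = 2)%N// => h; nra.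
set e := expR _ in h1 h2 *; set f := expR _ in h1 *.
have -> : c / s ^+ 3 * (e * e) = c * ((s ^+ 3)^-1 * e * e) by ring.
have -> : 32 * c * f = c * (32 * f) by ring.
apply: ler_wpM2l; first exact: ltW.
apply: ler_pM => //; last by rewrite expR_ge0.
by rewrite mulr_ge0 ?expR_ge0// invr_ge0 exprn_ge0// ltW.
Qed.

Lemma measurable_invr : measurable_fun [set: R] (@GRing.inv R).
Proof.
rewrite (_ : GRing.inv = fun x : R => x * `|x| `^ (- 2%:R)); last first.
  apply/funext => x; rewrite powR_invn//; have [->|x0] := eqVneq x 0.
    by rewrite invr0 mul0r.
  by rewrite real_normK ?num_real//; field.
apply: measurable_funM => //.
exact: (measurableT_comp (measurable_powR _) (@normr_measurable R setT)).
Qed.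

Lemma measurable_coord1 : measurable_fun setT (fun x : T3 => x.1.1).
Proof. exact: measurableT_comp measurable_fst measurable_fst. Qed.

Lemma measurable_coord2 : measurable_fun setT (fun x : T3 => x.1.2).
Proof. exact: measurableT_comp measurable_snd measurable_fst. Qed.

Lemma measurable_coord3 : measurable_fun setT (fun x : T3 => x.2).
Proof. exact: measurable_snd. Qed.

Lemma measurable_dist2 d (T : measurableType d) (X Y : T -> T3) :
  measurable_fun setT X -> measurable_fun setT Y ->
  measurable_fun setT (fun w => dist2 (X w) (Y w)).
Proof.
move=> mX mY; rewrite /dist2; apply: measurable_funD; first apply: measurable_funD.
- apply: measurable_funX; apply: measurable_funB; exact: measurableT_comp measurable_coord1 _.
- apply: measurable_funX; apply: measurable_funB; exact: measurableT_comp measurable_coord2 _.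
- apply: measurable_funX; apply: measurable_funB; exact: measurableT_comp measurable_coord3 _.
Qed.

Lemma measurable_heatH d (T : measurableType d) (S : T -> R) (X Y : T -> T3) :
  measurable_fun setT S -> measurable_fun setT X -> measurable_fun setT Y ->
  measurable_fun setT (fun w => heatH (S w) (X w) (Y w)).
Proof.
move=> mS mX mY; rewrite /heatH.
apply: measurable_funM.
  apply: (measurableT_comp measurable_invr).
  by apply: measurable_funX; exact: measurable_funM.
apply: measurableT_comp => //; apply: measurable_funM.
  by apply: measurableT_comp => //; exact: measurable_dist2.
apply: (measurableT_comp measurable_invr).
by apply: measurable_funM => //; exact: measurable_funX.
Qed.

Lemma measurable_heatHr s x : measurable_fun setT (heatH s x : T3 -> R).
Proof. exact: measurable_heatH. Qed.

Lemma integral_prod3 (f g h : R -> R) :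
  measurable_fun setT f -> measurable_fun setT g -> measurable_fun setT h ->
  (forall t, 0 <= f t) -> (forall t, 0 <= g t) -> (forall t, 0 <= h t) ->
  (\int[L3 R]_y (f y.1.1 * g y.1.2 * h y.2)%:E =
  \int[mu]_t (f t)%:E * \int[mu]_t (g t)%:E * \int[mu]_t (h t)%:E)%E.
Proof.
move=> mf mg mh f0 g0 h0.
have m1 : measurable_fun setT (fun z : measurableTypeR R * measurableTypeR R => f z.1 * g z.2).
  apply: measurable_funM; first exact: measurableT_comp mf measurable_fst.
  exact: measurableT_comp mg measurable_snd.
rewrite fubini_tonelli1/=; first last.
- by move=> y; rewrite lee_fin !mulr_ge0.
- apply/measurable_EFinP; apply: measurable_funM => /=.
    exact: measurableT_comp m1 measurable_fst.
  exact: measurableT_comp mh measurable_snd.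
rewrite /fubini_F /=.
under eq_integral => z _.
  under eq_integral do rewrite EFinM.
  rewrite ge0_integralZl//; [over|exact/measurable_EFinP|by move=> *; rewrite lee_fin|].
  by rewrite lee_fin mulr_ge0.
rewrite ge0_integralZr//; last 3 first.
- exact/measurable_EFinP.
- by move=> z _; rewrite lee_fin mulr_ge0.
- by apply: integral_ge0 => t _; rewrite lee_fin.
congr (_ * _)%E.
rewrite fubini_tonelli1/=; first last.
- by move=> y; rewrite lee_fin !mulr_ge0.
- exact/measurable_EFinP.
rewrite /fubini_F /=.
under eq_integral => z _.
  under eq_integral do rewrite EFinM.
  rewrite ge0_integralZl//; [over|exact/measurable_EFinP|by move=> *; rewrite lee_fin|by rewrite lee_fin].
rewrite ge0_integralZr//.
- exact/measurable_EFinP.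
- by move=> z _; rewrite lee_fin.
- by apply: integral_ge0 => t _; rewrite lee_fin.
Qed.

Lemma integral_heatH s x : 0 < s -> (\int[L3 R]_y (heatH s x y)%:E = 1)%E.
Proof.
move=> s0; under eq_integral do rewrite heatH_prod//.
rewrite (integral_prod3 (measurable_normal_pdf _ _) (measurable_normal_pdf _ _) (measurable_normal_pdf _ _)).
- by rewrite !integral_normal_pdf !mule1.
- by move=> t; exact: normal_pdf_ge0.
- by move=> t; exact: normal_pdf_ge0.
- by move=> t; exact: normal_pdf_ge0.
Qed.

End heat.

Section real_derivatives.
Context {R : realType}.
Implicit Types (f g : R -> R) (x df dg c : R).

Lemma is_derive_mul f g x df dg : is_derive x 1 f df -> is_derive x 1 g dg ->
  is_derive x 1 (fun y => f y * g y) (df * g x + f x * dg).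
Proof.
move=> hf hg; have := is_deriveM hf hg => h; apply: (is_derive_eq h).
by rewrite /GRing.scale/= addrC; congr (_ + _); rewrite mulrC.
Qed.

Lemma is_derive_add f g x df dg : is_derive x 1 f df -> is_derive x 1 g dg ->
  is_derive x 1 (fun y => f y + g y) (df + dg).
Proof. by move=> hf hg; exact: is_deriveD. Qed.

Lemma is_derive_mulc f x df c : is_derive x 1 f df ->
  is_derive x 1 (fun y => c * f y) (c * df).
Proof. by move=> hf; exact: is_deriveZ. Qed.

Lemma is_derive_inv f x df : f x != 0 -> is_derive x 1 f df ->
  is_derive x 1 (fun y => (f y)^-1) (- df / f x ^+ 2).
Proof.
move=> f0 hf; have dfx : derivable f x 1 by case: hf.
have -> : - df / f x ^+ 2 = 'D_1 (fun y => (f y)^-1) x.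
  by rewrite deriveV// derive_val /GRing.scale/= mulNr mulrC mulNr.
by apply/derivableP; exact: derivableV.
Qed.

Lemma is_derive_exp f x df : is_derive x 1 f df ->
  is_derive x 1 (fun y => expR (f y)) (df * expR (f x)).
Proof.
move=> hf; have := is_derive1_comp (is_derive_expR (f x)) hf.
by rewrite mulrC.
Qed.

Lemma is_derive_pow f x df (n : nat) : is_derive x 1 f df ->
  is_derive x 1 (fun y => f y ^+ n) (n%:R * f x ^+ n.-1 * df).
Proof.
move=> hf; have := is_deriveX n hf.
by rewrite (_ : f ^+ n = fun y => f y ^+ n)// exprfctE.
Qed.

Lemma derivable_continuous_at f x : derivable f x 1 -> {for x, continuous f}.
Proof. by move=> /derivable1_diffP/differentiable_continuous. Qed.

Lemma FTC_derivable f g a b : a < b ->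
  (forall x, a <= x <= b -> is_derive x 1 f (g x)) ->
  (forall x, a <= x <= b -> derivable g x 1) ->
  (\int[lebesgue_measure]_(x in `[a, b]) (g x)%:E = (f b - f a)%:E)%E.
Proof.
move=> ab hf hg; rewrite (@continuous_FTC2 _ g f)//.
- apply: derivable_within_continuous => x; rewrite in_itv/=; exact: hg.
- split.
  + by move=> x /[!in_itv]/= /andP[ax xb]; have [] := hf x; rewrite ?(ltW ax) ?(ltW xb).
  + apply: cvg_at_right_filter; apply: derivable_continuous_at.
    by have [] := hf a; rewrite ?lexx ?ltW.
  + apply: cvg_at_left_filter; apply: derivable_continuous_at.
    by have [] := hf b; rewrite ?lexx ?ltW.
- move=> x /[!in_itv]/= /andP[ax xb]; rewrite derive1E.
  by have h := hf x; rewrite (@derive_val _ _ _ _ _ _ _ (h _))// ?(ltW ax) ?(ltW xb).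
Qed.

End real_derivatives.

Section heat_time.
Context {R : realType}.
Implicit Types (s t : R) (x y : R3 R).

Definition lapH s x y : R := (dist2 x y / s ^+ 3 - 3 / s) * heatH s x y.

Lemma heatHE s x y : s != 0 -> heatH s x y =
  (Num.sqrt (2 * pi) ^+ 3)^-1 * s^-1 ^+ 3 * expR (- (dist2 x y / 2) * s^-1 ^+ 2).
Proof.
move=> s0; rewrite /heatH exprMn invfM -[(s ^+ 3)^-1]exprVn; congr (_ * expR _).
by field.
Qed.

Lemma is_derive_id1 s : is_derive s 1 (fun s : R => s) 1.
Proof. exact: is_derive_id. Qed.

Lemma is_derive_invx s : s != 0 -> is_derive s 1 (fun s : R => s^-1) (- s^-1 ^+ 2).
Proof.
move=> s0; have := is_derive_inv (f := fun s => s) s0 (is_derive_id1 s).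
by rewrite mulN1r exprVn.
Qed.

(* The time variable is [s] with [t = s^2 / 2], so that [d/ds] produces [s] times the Laplacian. *)
Lemma is_derive_heatH s x y : 0 < s ->
  is_derive s 1 (fun s => heatH s x y) (lapH s x y).
Proof.
move=> s0; have sn0 : s != 0 by rewrite gt_eqF.
have -> : lapH s x y = (Num.sqrt (2 * pi) ^+ 3)^-1 * (3%:R * s^-1 ^+ 2 * (- s^-1 ^+ 2)) *
     expR (- (dist2 x y / 2) * s^-1 ^+ 2) +
  (Num.sqrt (2 * pi) ^+ 3)^-1 * s^-1 ^+ 3 * ((- (dist2 x y / 2) * (2%:R * s^-1 ^+ 1 * (- s^-1 ^+ 2))) *
     expR (- (dist2 x y / 2) * s^-1 ^+ 2)).
  rewrite /lapH heatHE//; move: (expR _) (Num.sqrt (2 * pi) ^+ 3) => E K.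
  by rewrite -[(s ^+ 3)^-1]exprVn; move: (s^-1) (K^-1) => i k; field.
have di := is_derive_invx sn0.
have := is_derive_mul (is_derive_mulc (Num.sqrt (2 * pi) ^+ 3)^-1 (is_derive_pow 3 di))
  (is_derive_exp (is_derive_mulc (- (dist2 x y / 2)) (is_derive_pow 2 di))).
apply: near_eq_is_derive.
near=> z; rewrite heatHE// gt_eqF//; near: z.
exact: lt_nbhsr.
Unshelve. all: by end_near. Qed.

Lemma derivable_lapH s x y : 0 < s -> derivable (fun s => lapH s x y) s 1.
Proof.
move=> s0; have sn0 : s != 0 by rewrite gt_eqF.
have di := is_derive_invx sn0.
have h1 := is_derive_add (is_derive_mulc (dist2 x y) (is_derive_pow 3 di))
  (is_derive_mulc (- 3) di).
have := is_derive_mul h1 (is_derive_heatH x y s0).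
rewrite (_ : (fun z => _) = (fun s => lapH s x y)); last first.
  by apply/funext => z; rewrite /lapH exprVn mulNr.
by case.
Qed.

Lemma integral_lapH (a b : R) x y : 0 < a -> a < b ->
  (\int[lebesgue_measure]_(s in `[a, b]) (lapH s x y)%:E =
   (heatH b x y - heatH a x y)%:E)%E.
Proof.
move=> a0 ab.
have h1 s : a <= s <= b -> is_derive s 1 (fun s => heatH s x y) (lapH s x y).
  by move=> /andP[as_ _]; apply: is_derive_heatH; exact: lt_le_trans as_.
have h2 s : a <= s <= b -> derivable (fun s => lapH s x y) s 1.
  by move=> /andP[as_ _]; apply: derivable_lapH; exact: lt_le_trans as_.
exact: (FTC_derivable ab h1 h2).
Qed.

Lemma lapH_le s x y : 0 < s -> `|lapH s x y| <= 72 / s * heatH (2 * s) x y.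
Proof.
move=> s0; rewrite /lapH normrM (ger0_norm (heatH_ge0 _ _ (ltW s0))).
have h := heatH_moment x y s0; have H0 := heatH_ge0 x y (ltW s0).
set u := dist2 x y / s ^+ 2 in h.
have u0 : 0 <= u by rewrite divr_ge0 ?dist2_ge0 ?sqr_ge0.
have -> : dist2 x y / s ^+ 3 - 3 / s = s^-1 * (u - 3).
  by rewrite /u; field; rewrite gt_eqF.
have si : 0 < s^-1 by rewrite invr_gt0.
rewrite normrM (gtr0_norm si) -mulrA.
have -> : 72 / s * heatH (2 * s) x y = s^-1 * (72 * heatH (2 * s) x y) by ring.
apply: ler_wpM2l; first exact: ltW.
have : `|u - 3| <= 3 * (1 + u) by rewrite ler_norml; apply/andP; split; lra.
move=> hu; apply: (le_trans (ler_wpM2r H0 hu)); lra.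
Qed.

End heat_time.

Section product_integrability.
Local Open Scope ereal_scope.
Context d1 d2 (T1 : measurableType d1) (T2 : measurableType d2) (R : realType).
Variable m1 : {sigma_finite_measure set T1 -> \bar R}.
Variable m2 : {sigma_finite_measure set T2 -> \bar R}.

Lemma integrable_prod_bound (A : set T1) (G : T2 -> R) (f : T1 * T2 -> R) :
  measurable A -> m1 A < +oo -> measurable_fun setT f ->
  m2.-integrable setT (fun y => (G y)%:E) ->
  (forall x y, (`|f (x, y)| <= \1_A x * G y)%R) ->
  (m1 \x m2)%E.-integrable setT (fun p => (f p)%:E).
Proof.
move=> mA Afin mf iG fG.
have G0 y x : A x -> (0 <= G y)%R.
  by move=> Ax; have := fG x y; rewrite indicE mem_set// mul1r; apply: le_trans.
apply/integrable12ltyP; first exact/measurable_EFinP.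
have [I0 Ioo] : 0 <= \int[m2]_y `|(G y)%:E| /\ \int[m2]_y `|(G y)%:E| < +oo.
  by split; [exact: integral_ge0|case/integrableP : iG].
apply: (@le_lt_trans _ _ (\int[m1]_x ((\1_A x)%:E * \int[m2]_y `|(G y)%:E|))).
  apply: ge0_le_integral => //.
  - by move=> x _; exact: integral_ge0.
  - apply: (measurable_fun_fubini_tonelli_F (fun p => `|(f p)%:E|)) => //.
    by apply: measurableT_comp => //; exact/measurable_EFinP.
  - apply: emeasurable_funM => //; apply/measurable_EFinP; exact: measurable_indic.
  - move=> x _; rewrite -ge0_integralZl//; last first.
      by apply: measurableT_comp => //; case/integrableP : iG.
    apply: ge0_le_integral => //.
    + apply: measurableT_comp => //; apply/measurable_EFinP.
      exact: measurableT_comp mf (pair1_measurable _).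
    + apply: emeasurable_funM => //; apply: measurableT_comp => //.
      by case/integrableP : iG.
    + move=> y _; rewrite abse_EFin lee_fin (le_trans (fG x y))//.
      by rewrite ler_wpM2l// ler_norm.
rewrite ge0_integralZr//; last by apply/measurable_EFinP; exact: measurable_indic.
rewrite integral_indic// setIT.
by rewrite lte_mul_pinfty// ge0_fin_numE.
Qed.

End product_integrability.

Section gauss_integrable.
Context {R : realType}.
Local Notation T3 := (R3 (measurableTypeR R)).
Implicit Types (f g : T3 -> R) (x y : T3) (c C : R).

Definition gauss_integrable f := forall c, 0 < c ->
  (L3 R).-integrable setT (fun y => (f y * expR (- c * nrm2 y))%:E).

Lemma measurable_nrm2 : measurable_fun setT (nrm2 : T3 -> R).
Proof.
rewrite /nrm2; apply: measurable_funD; first apply: measurable_funD;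
  apply: measurable_funX.
- exact: measurable_coord1.
- exact: measurable_coord2.
- exact: measurable_coord3.
Qed.

Lemma measurable_gauss c : measurable_fun setT (fun y : T3 => expR (c * nrm2 y)).
Proof.
by apply: measurableT_comp => //; apply: measurable_funM => //; exact: measurable_nrm2.
Qed.

Lemma gauss_integrable_measurable f : gauss_integrable f -> measurable_fun setT f.
Proof.
move=> /(_ 1 ltr01)/integrableP[/measurable_EFinP mf _].
rewrite (_ : f = fun y => (f y * expR (- 1 * nrm2 y)) * expR (1 * nrm2 y)).
  by apply: measurable_funM => //; exact: measurable_gauss.
by apply/funext => y; rewrite -mulrA -expRD mulNr addrC subrr expR0 mulr1.
Qed.

Lemma gauss_integrable_dom f (k : T3 -> R) c C : gauss_integrable f ->
  measurable_fun setT k -> 0 < c -> (forall y, `|k y| <= C * expR (- c * nrm2 y)) ->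
  (L3 R).-integrable setT (fun y => (f y * k y)%:E).
Proof.
move=> fi mk c0 kC; have mf := gauss_integrable_measurable fi.
apply: (@le_integrable _ _ _ _ _ measurableT _ (fun y => (C%:E * (f y * expR (- c * nrm2 y))%:E)%E)) => //.
- by apply/measurable_EFinP; exact: measurable_funM.
- move=> y _; rewrite lee_fin !normrM.
  have C0 : 0 <= C by have := le_trans (normr_ge0 _) (kC y); rewrite pmulr_lge0// expR_gt0.
  rewrite (ger0_norm C0) (ger0_norm (expR_ge0 _)) mulrCA.
  exact: ler_wpM2l.
- apply: integrableZl => //; exact: fi.
Qed.

Lemma gauss_integrable_le f g : gauss_integrable f -> measurable_fun setT g ->
  (forall y, `|g y| <= `|f y|) -> gauss_integrable g.
Proof.
move=> fi mg gf c c0; apply: le_integrable (fi c c0) => //.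
- by apply/measurable_EFinP; apply: measurable_funM => //; exact: measurable_gauss.
- by move=> y _; rewrite lee_fin !normrM ler_wpM2r.
Qed.

Lemma gauss_integrable_norm f : gauss_integrable f -> gauss_integrable (fun y => `|f y|).
Proof.
move=> fi; apply: gauss_integrable_le (fi) _ _; last by move=> y; rewrite normr_id.
by apply: measurableT_comp => //; exact: gauss_integrable_measurable.
Qed.

Lemma gauss_integrableZ f c : gauss_integrable f -> gauss_integrable (fun y => c * f y).
Proof.
move=> fi a a0.
rewrite (_ : (fun _ => _) = fun y => (c%:E * (f y * expR (- a * nrm2 y))%:E)%E).
  by apply: integrableZl => //; exact: fi.
by apply/funext => y; rewrite -EFinM mulrA.
Qed.

Lemma gauss_integrableD f g : gauss_integrable f -> gauss_integrable g ->
  gauss_integrable (fun y => f y + g y).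
Proof.
move=> fi gi a a0.
rewrite (_ : (fun _ => _) = fun y => ((f y * expR (- a * nrm2 y))%:E +
   (g y * expR (- a * nrm2 y))%:E)%E).
  by apply: integrableD => //; [exact: fi|exact: gi].
by apply/funext => y; rewrite -EFinD mulrDl.
Qed.

End gauss_integrable.

Section core.
Context {R : realType}.
Local Notation mu := (@lebesgue_measure R).
Local Notation T3 := (R3 (measurableTypeR R)).
Implicit Types (e s t : R) (x y : T3).

Definition flux (b1 b2 b3 : T3 -> R) s x y : R :=
  (b1 y * (x.1.1 - y.1.1) + b2 y * (x.1.2 - y.1.2) + b3 y * (x.2 - y.2)) / s *
  heatH s x y.

(* The weak form of [Lap phi = - div b], tested against the heat kernel. *)
Definition heat_weak (phi b1 b2 b3 : T3 -> R) := forall x s, 0 < s ->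
  (\int[L3 R]_y (phi y * lapH s x y)%:E = \int[L3 R]_y (flux b1 b2 b3 s x y)%:E)%E.

Lemma flux_le (b1 b2 b3 W : T3 -> R) s x y : 0 < s ->
  24 * (`|b1 y| + `|b2 y| + `|b3 y|) <= W y ->
  `|flux b1 b2 b3 s x y| <= W y * heatH (2 * s) x y.
Proof.
move=> s0 hW; have H0 := heatH_ge0 x y (ltW s0).
have hm := heatH_moment x y s0.
set u := dist2 x y / s ^+ 2 in hm.
have u0 : 0 <= u by rewrite divr_ge0 ?dist2_ge0 ?sqr_ge0.
have si : 0 < s^-1 by rewrite invr_gt0.
have hz (z : R) : z ^+ 2 <= dist2 x y -> `|z * s^-1| <= 1 + u.
  move=> zd; have : `|z * s^-1| ^+ 2 <= u.
    by rewrite real_normK ?num_real// exprMn exprVn ler_wpM2r// invr_ge0 sqr_ge0.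
  by move: (normr_ge0 (z * s^-1)) => n0; nra.
have h1 : `|(x.1.1 - y.1.1) * s^-1| <= 1 + u by apply: hz; rewrite /dist2 -addrA lerDl addr_ge0 ?sqr_ge0.
have h2 : `|(x.1.2 - y.1.2) * s^-1| <= 1 + u by apply: hz; rewrite /dist2 addrAC lerDr addr_ge0 ?sqr_ge0.
have h3 : `|(x.2 - y.2) * s^-1| <= 1 + u by apply: hz; rewrite /dist2 lerDr addr_ge0 ?sqr_ge0.
have hb : `|(b1 y * (x.1.1 - y.1.1) + b2 y * (x.1.2 - y.1.2) + b3 y * (x.2 - y.2)) / s|
    <= (`|b1 y| + `|b2 y| + `|b3 y|) * (1 + u).
  rewrite !mulrDl -!mulrA.
  apply: (le_trans (ler_normD _ _)); apply: lerD; first apply: (le_trans (ler_normD _ _));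
    [apply: lerD|]; by rewrite normrM ler_wpM2l.
rewrite /flux normrM (ger0_norm H0).
apply: (le_trans (ler_wpM2r H0 hb)); rewrite -mulrA.
have B0 : 0 <= `|b1 y| + `|b2 y| + `|b3 y| by rewrite !addr_ge0.
apply: (le_trans (ler_wpM2l B0 hm)).
have H20 : 0 <= heatH (2 * s) x y by rewrite heatH_ge0// mulr_ge0// ltW.
by rewrite mulrA [_ * 24]mulrC ler_wpM2r.
Qed.

Lemma measurable_lapH d (T : measurableType d) (S : T -> R) (X Y : T -> T3) :
  measurable_fun setT S -> measurable_fun setT X -> measurable_fun setT Y ->
  measurable_fun setT (fun w => lapH (S w) (X w) (Y w)).
Proof.
move=> mS mX mY; rewrite /lapH; apply: measurable_funM; last exact: measurable_heatH.
apply: measurable_funB; apply: measurable_funM => //.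
- exact: measurable_dist2.
- by apply: (measurableT_comp measurable_invr); exact: measurable_funX.
- exact: (measurableT_comp measurable_invr).
Qed.

Lemma measurable_flux d (T : measurableType d) (S : T -> R) (X Y : T -> T3) (b1 b2 b3 : T3 -> R) :
  measurable_fun setT b1 -> measurable_fun setT b2 -> measurable_fun setT b3 ->
  measurable_fun setT S -> measurable_fun setT X -> measurable_fun setT Y ->
  measurable_fun setT (fun w => flux b1 b2 b3 (S w) (X w) (Y w)).
Proof.
move=> mb1 mb2 mb3 mS mX mY; rewrite /flux.
apply: measurable_funM; last exact: measurable_heatH.
apply: measurable_funM; last exact: (measurableT_comp measurable_invr).
apply: measurable_funD; first apply: measurable_funD; apply: measurable_funM.
- exact: measurableT_comp mb1 mY.
- apply: measurable_funB; exact: measurableT_comp measurable_coord1 _.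
- exact: measurableT_comp mb2 mY.
- apply: measurable_funB; exact: measurableT_comp measurable_coord2 _.
- exact: measurableT_comp mb3 mY.
- apply: measurable_funB; exact: measurableT_comp measurable_coord3 _.
Qed.

Lemma heatH_gauss_local (e t : R) x : 0 < e -> exists c C : R, [/\ 0 < c, 0 <= C &
  forall s y, e <= s <= t -> heatH s x y <= C * expR (- c * nrm2 y)].
Proof.
move=> e0; have [et|te] := leP e t; last first.
  exists 1, 1; split=> // s y /andP[/le_trans es /es]; lra.
have t0 := lt_le_trans e0 et.
exists (4 * t ^+ 2)^-1, (((Num.sqrt (2 * pi) * e) ^+ 3)^-1 * expR (nrm2 x / (2 * e ^+ 2))).
split=> [||s y /andP[es st]].
- by rewrite invr_gt0 mulr_gt0// exprn_gt0.
- by rewrite mulr_ge0 ?expR_ge0// ltW// heatH_const_gt0.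
- exact: heatH_gauss.
Qed.

Section core_hyps.
Variables (phi b1 b2 b3 W : T3 -> R).
Hypothesis iphi : gauss_integrable phi.
Hypotheses (mb1 : measurable_fun setT b1) (mb2 : measurable_fun setT b2)
  (mb3 : measurable_fun setT b3).
Hypothesis iW : gauss_integrable W.
Hypothesis W0 : forall y, 0 <= W y.
Hypothesis bW : forall y, 24 * (`|b1 y| + `|b2 y| + `|b3 y|) <= W y.
Hypothesis weak : heat_weak phi b1 b2 b3.

Let mphi := gauss_integrable_measurable iphi.
Let mW := gauss_integrable_measurable iW.
Local Notation flux := (flux b1 b2 b3).

Lemma integrable_heat (f : T3 -> R) s x : gauss_integrable f -> 0 < s ->
  (L3 R).-integrable setT (fun y => (f y * heatH s x y)%:E).
Proof.
move=> fi s0; have [c [C [c0 C0 h]]] := heatH_gauss_local s x s0.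
apply: (@gauss_integrable_dom _ _ _ c C) => // [|y].
  exact: measurable_heatHr.
by rewrite ger0_norm ?heatH_ge0 ?(ltW s0)// h// lexx.
Qed.

Lemma heat_diff e t x : 0 < e -> e < t ->
  (\int[L3 R]_y (phi y * heatH t x y)%:E - \int[L3 R]_y (phi y * heatH e x y)%:E =
   \int[mu \x L3 R]_p (\1_(`[e, t]) p.1 * flux p.1 x p.2)%:E)%E.
Proof.
move=> e0 et; have t0 := lt_trans e0 et.
have [c [C [c0 C0 hC]]] : exists c C : R, [/\ 0 < c, 0 <= C &
    forall s y, e <= s <= t -> heatH (2 * s) x y <= C * expR (- c * nrm2 y)].
  have [c [C [c0 C0 h]]] := @heatH_gauss_local (2 * e) (2 * t) x (mulr_gt0 (ltr0Sn _ 1) e0).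
  by exists c, C; split=> // s y /andP[es st]; apply: h; rewrite !ler_pM2l// es.
have mI : measurable_fun setT (fun p : measurableTypeR R * T3 => \1_(`[e, t]) p.1 : R).
  have mA : measurable_fun setT (\1_(`[e, t]) : measurableTypeR R -> R) by exact: measurable_indic.
  exact: measurableT_comp mA measurable_fst.
have muI : (mu `[e, t]%classic < +oo)%E.
  by rewrite lebesgue_measure_itv/= lte_fin et -EFinB ltry.
have iF1 : (mu \x L3 R)%E.-integrable setT (fun p => (\1_(`[e, t]) p.1 * (phi p.2 * lapH p.1 x p.2))%:E).
  apply: (@integrable_prod_bound _ _ _ _ _ mu (L3 R) `[e, t]%classic
     (fun y => 72 / e * C * (`|phi y| * expR (- c * nrm2 y)))) => //.
  - apply: measurable_funM => //; apply: measurable_funM.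
      exact: measurableT_comp mphi measurable_snd.
    exact: measurable_lapH.
  - under eq_fun do rewrite EFinM.
    by apply: integrableZl => //; exact: gauss_integrable_norm.
  - move=> s y /=; rewrite normrM (ger0_norm (_ : 0 <= \1_(_) s))//.
    rewrite indicE; case: (boolP (s \in _)) => [|_]; last by rewrite !mul0r.
    rewrite inE/= in_itv/= => /andP[es st]; rewrite !mul1r normrM.
    have s0 := lt_le_trans e0 es.
    have h := lapH_le x y s0; have hc := hC s y; rewrite es st in hc.
    rewrite [leRHS]mulrCA; apply: ler_wpM2l => //.
    apply: (le_trans h); rewrite -[leRHS]mulrA; apply: ler_pM => //.
    + by rewrite divr_ge0// ltW.
    + by rewrite heatH_ge0// mulr_ge0// ltW.
    + by rewrite ler_wpM2l// lef_pV2.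
    + exact: hc.
have iF2 : (mu \x L3 R)%E.-integrable setT (fun p => (\1_(`[e, t]) p.1 * flux p.1 x p.2)%:E).
  apply: (@integrable_prod_bound _ _ _ _ _ mu (L3 R) `[e, t]%classic
     (fun y => C * (W y * expR (- c * nrm2 y)))) => //.
  - apply: measurable_funM => //.
    exact: measurable_flux.
  - under eq_fun do rewrite EFinM.
    by apply: integrableZl => //; exact: iW.
  - move=> s y /=; rewrite normrM (ger0_norm (_ : 0 <= \1_(_) s))//.
    rewrite indicE; case: (boolP (s \in _)) => [|_]; last by rewrite !mul0r.
    rewrite inE/= in_itv/= => /andP[es st]; rewrite !mul1r.
    have s0 := lt_le_trans e0 es.
    have h := flux_le x s0 (bW y); have hc := hC s y; rewrite es st in hc.
    apply: (le_trans h); rewrite [leRHS]mulrCA; apply: ler_wpM2l; first exact: W0.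
    exact: hc.
rewrite -(integral12_prod_meas1 iF2) /fubini_F/=.
transitivity (\int[mu]_s \int[L3 R]_y (\1_(`[e, t]) s * (phi y * lapH s x y))%:E)%E; last first.
  apply: eq_integral => s _; rewrite indicE; case: (boolP (s \in _)) => [|_]; last first.
    by under eq_integral do rewrite mul0r; under [RHS]eq_integral do rewrite mul0r.
  rewrite inE/= in_itv/= => /andP[es st]; have s0 := lt_le_trans e0 es.
  under eq_integral do rewrite mul1r; under [RHS]eq_integral do rewrite mul1r.
  exact: weak.
rewrite (Fubini iF1)/=.
rewrite -integralB//; [|exact: integrable_heat..].
apply: eq_integral => y _; rewrite -EFinB -mulrBr.
have -> : (fun s : measurableTypeR R => (\1_(`[e, t]) s * (phi y * lapH s x y))%:E) =
    ((fun s : measurableTypeR R => ((phi y)%:E * (lapH s x y)%:E)%E) \_ `[e, t]).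
  apply/funext => s; rewrite patchE indicE; case: ifP => _; first by rewrite mul1r.
  by rewrite mul0r.
rewrite -integral_mkcond integralZl//.
  by rewrite integral_lapH.
have cH : {within `[e, t], continuous (fun s => lapH s x y)}.
  apply: derivable_within_continuous => s; rewrite in_itv/= => /andP[es _].
  by apply: derivable_lapH; exact: lt_le_trans es.
exact: continuous_compact_integrable (@segment_compact _ _ _) cH.
Qed.

End core_hyps.

End core.

(** * The heat potential and its weak-type bound *)

Section heat_potential.
Context {R : realType}.
Local Notation mu := (@lebesgue_measure R).
Local Notation T3 := (R3 (measurableTypeR R)).
Local Notation P := (product_sfm (@lebesgue_measure R) (L3 R)).
Implicit Types (f g : T3 -> R) (x y : T3) (t : R).

Definition heat_pot_ker (t : R) f x (p : measurableTypeR R * T3) : R :=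
  \1_(`]0, t]) p.1 * (f p.2 * heatH (2 * p.1) x p.2).

Definition heat_pot (t : R) f x : \bar R := (\int[mu \x L3 R]_p (heat_pot_ker t f x p)%:E)%E.

Lemma heat_pot_ker_ge0 t f x p : (forall y, 0 <= f y) -> 0 <= heat_pot_ker t f x p.
Proof.
move=> f0; rewrite /heat_pot_ker indicE; case: (boolP (p.1 \in _)) => [|_]; last by rewrite mul0r.
rewrite inE/= in_itv/= => /andP[s0 _].
by rewrite mul1r mulr_ge0// heatH_ge0// mulr_ge0// ltW.
Qed.

Lemma measurable_indic1 (A : set R) : measurable (A : set (measurableTypeR R)) ->
  measurable_fun setT (fun p : measurableTypeR R * T3 => \1_A p.1 : R).
Proof.
move=> mA.
have mI : measurable_fun setT (\1_A : measurableTypeR R -> R) by exact: measurable_indic.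
exact: measurableT_comp mI measurable_fst.
Qed.

Lemma measurable_heat_pot_ker t f : measurable_fun setT f ->
  measurable_fun setT (fun z : T3 * (measurableTypeR R * T3) => heat_pot_ker t f z.1 z.2).
Proof.
move=> mf.
have mI : measurable_fun setT (fun z : T3 * (measurableTypeR R * T3) => \1_(`]0, t]) z.2.1 : R).
  have h : measurable_fun setT (fun p : measurableTypeR R * T3 => \1_(`]0, t]) p.1 : R).
    by apply: measurable_indic1; exact: measurable_itv.
  exact: measurableT_comp h measurable_snd.
have m21 : measurable_fun setT (fun z : T3 * (measurableTypeR R * T3) => z.2.1).
  exact: measurableT_comp measurable_fst measurable_snd.
have m22 : measurable_fun setT (fun z : T3 * (measurableTypeR R * T3) => z.2.2).
  exact: measurableT_comp measurable_snd measurable_snd.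
rewrite /heat_pot_ker; apply: measurable_funM => //; apply: measurable_funM.
  exact: measurableT_comp mf m22.
by apply: measurable_heatH => //; exact: measurable_funM.
Qed.

Lemma measurable_heat_pot_kerx t f x : measurable_fun setT f ->
  measurable_fun setT (heat_pot_ker t f x).
Proof.
move=> /(measurable_heat_pot_ker t) h.
exact: measurableT_comp h (pair1_measurable _).
Qed.

Lemma measurable_heat_pot t f : measurable_fun setT f -> (forall y, 0 <= f y) ->
  measurable_fun setT (heat_pot t f).
Proof.
move=> mf f0; apply: (measurable_fun_fubini_tonelli_F (m2 := P) (fun z => (heat_pot_ker t f z.1 z.2)%:E)).
- by apply/measurable_EFinP; exact: measurable_heat_pot_ker.
- by move=> z; rewrite lee_fin heat_pot_ker_ge0.
Qed.

Lemma heat_pot_ge0 t f x : (forall y, 0 <= f y) -> (0 <= heat_pot t f x)%E.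
Proof. by move=> f0; apply: integral_ge0 => p _; rewrite lee_fin heat_pot_ker_ge0. Qed.

Lemma integral_indic_itv0 t : 0 <= t -> (\int[mu]_s (\1_(`]0, t]) s)%:E = t%:E)%E.
Proof.
move=> t0; rewrite integral_indic//= setIT lebesgue_measure_itv/= lte_fin.
by move: t0; rewrite le_eqVlt => /orP[/eqP <-|->]; rewrite ?ltxx// oppr0 adde0.
Qed.

Lemma heat_pot_cst t x (c : R) : 0 <= t -> 0 <= c -> heat_pot t (cst c) x = (c * t)%:E.
Proof.
move=> t0 c0; rewrite /heat_pot fubini_tonelli1; last 2 first.
- by apply/measurable_EFinP; exact: measurable_heat_pot_kerx.
- by move=> p; rewrite lee_fin heat_pot_ker_ge0.
rewrite EFinM -(integral_indic_itv0 t0) -ge0_integralZl//; last first.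
  by apply/measurable_EFinP; exact: measurable_indic.
apply: eq_integral => s _; rewrite /fubini_F /heat_pot_ker /= indicE.
case: (boolP (s \in _)) => [|_]; last first.
  by under eq_integral do rewrite mul0r; rewrite integral0 mule0.
rewrite inE/= in_itv/= => /andP[s0 _]; have s20 : 0 < 2 * s by rewrite mulr_gt0.
under eq_integral do rewrite mul1r EFinM.
rewrite ge0_integralZl ?lee_fin//.
- by rewrite integral_heatH.
- by apply/measurable_EFinP; exact: measurable_heatHr.
- by move=> y _; rewrite lee_fin heatH_ge0// ltW.
Qed.

Lemma integral_heat_pot t f : 0 <= t -> measurable_fun setT f -> (forall y, 0 <= f y) ->
  (\int[L3 R]_x heat_pot t f x = t%:E * \int[L3 R]_y (f y)%:E)%E.
Proof.
move=> t0 mf f0; rewrite /heat_pot.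
have If0 : (0 <= \int[L3 R]_y (f y)%:E)%E by apply: integral_ge0 => y _; rewrite lee_fin.
rewrite (fubini_tonelli (m1 := L3 R) (m2 := P) (fun z => (heat_pot_ker t f z.1 z.2)%:E)); last 2 first.
- by apply/measurable_EFinP; exact: measurable_heat_pot_ker.
- by move=> z; rewrite lee_fin heat_pot_ker_ge0.
transitivity (\int[mu \x L3 R]_p (\1_(`]0, t]) p.1 * f p.2)%:E)%E.
  apply: eq_integral => -[s y] _; rewrite /heat_pot_ker /= indicE.
  case: (boolP (s \in _)) => [|_]; last first.
    by under eq_integral do rewrite mul0r; rewrite integral0 mul0r.
  rewrite inE/= in_itv/= => /andP[s0 _]; have s20 : 0 < 2 * s by rewrite mulr_gt0.
  under eq_integral do rewrite mul1r EFinM.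
  rewrite ge0_integralZl ?lee_fin//.
  - by under eq_integral do rewrite heatHC; rewrite integral_heatH// mule1 mul1r.
  - by apply/measurable_EFinP; exact: measurable_heatH.
  - by move=> x _; rewrite lee_fin heatH_ge0// ltW.
rewrite fubini_tonelli1; last 2 first.
- apply/measurable_EFinP; apply: measurable_funM; first exact: measurable_indic1 (measurable_itv _).
  exact: measurableT_comp mf measurable_snd.
- by move=> p; rewrite lee_fin mulr_ge0.
rewrite /fubini_F/=.
under eq_integral => s _.
  under eq_integral do rewrite EFinM.
  rewrite ge0_integralZl//; [over|exact/measurable_EFinP|by move=> y _; rewrite lee_fin].
rewrite ge0_integralZr//; first by rewrite integral_indic_itv0.
by apply/measurable_EFinP; exact: measurable_indic.
Qed.

Lemma heat_pot_le t f g x (c d : R) : 0 <= t -> 0 <= c -> 0 <= d ->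
  measurable_fun setT f -> measurable_fun setT g ->
  (forall y, 0 <= f y) -> (forall y, 0 <= g y) ->
  (forall y, f y <= c + d * g y) ->
  (heat_pot t f x <= (c * t)%:E + d%:E * heat_pot t g x)%E.
Proof.
move=> t0 c0 d0 mf mg f0 g0 fg.
rewrite -(heat_pot_cst x t0 c0) /heat_pot -ge0_integralZl//; last 2 first.
- by apply/measurable_EFinP; exact: measurable_heat_pot_kerx.
- by move=> p _; rewrite lee_fin heat_pot_ker_ge0.
rewrite -ge0_integralD//; last 4 first.
- by move=> p _; rewrite lee_fin heat_pot_ker_ge0.
- by apply/measurable_EFinP; exact: measurable_heat_pot_kerx.
- by move=> p _; rewrite -EFinM lee_fin mulr_ge0// heat_pot_ker_ge0.
- apply: emeasurable_funM => //.
  by apply/measurable_EFinP; exact: measurable_heat_pot_kerx.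
apply: ge0_le_integral => //.
- by move=> p _; rewrite lee_fin heat_pot_ker_ge0.
- by apply/measurable_EFinP; exact: measurable_heat_pot_kerx.
- apply: emeasurable_funD; last apply: emeasurable_funM => //;
    by apply/measurable_EFinP; exact: measurable_heat_pot_kerx.
- move=> p _; rewrite -EFinM -EFinD lee_fin /heat_pot_ker indicE.
  case: (boolP (p.1 \in _)) => [|_]; last by rewrite !mul0r mulr0 addr0.
  rewrite inE/= in_itv/= => /andP[s0 _]; rewrite !mul1r.
  rewrite [d * _]mulrA -mulrDl; apply: ler_wpM2r; last exact: fg.
  by rewrite heatH_ge0// mulr_ge0// ltW.
Qed.

(* Splitting [W <= d + d^(1-p) W^p] at the height [d = v/(2t)] replaces Jensen's inequality. *)
Lemma heat_pot_weak_type t (W : T3 -> R) (p v : R) : 0 < t -> 0 < v -> 1 <= p ->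
  measurable_fun setT W -> (forall y, 0 <= W y) ->
  (L3 R [set x | v%:E <= heat_pot t W x] <=
   ((2 * t / v) `^ p)%:E * \int[L3 R]_y ((W y) `^ p)%:E)%E.
Proof.
move=> t0 v0 p1 mW W0.
have p0 : 0 < p by exact: lt_le_trans p1.
set g := fun y => W y `^ p.
have mg : measurable_fun setT g by exact: measurableT_comp (measurable_powR _) mW.
have g0 y : 0 <= g y by exact: powR_ge0.
pose d : R := v / (2 * t).
have d0 : 0 < d by rewrite divr_gt0// mulr_gt0.
pose k := d `^ (1 - p).
have k0 : 0 < k by exact: powR_gt0.
have split y : W y <= d + k * g y.
  have [Wd|dW] := leP (W y) d.
    by rewrite (le_trans Wd)// lerDl mulr_ge0// ltW.
  have Wy0 : 0 < W y by exact: lt_trans dW.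
  rewrite (@le_trans _ _ (k * g y))//; last by rewrite lerDr ltW.
  rewrite /k /g (_ : 1 - p = - (p - 1)); last by ring.
  rewrite powRN mulrC ler_pdivlMr ?powR_gt0//.
  rewrite (_ : W y `^ p = W y * W y `^ (p - 1)).
    by rewrite ler_pM2l// ge0_ler_powR ?nnegrE ?subr_ge0// ltW.
  rewrite -[in X in X * _](powRr1 (ltW Wy0)) -powRD; last by rewrite (gt_eqF Wy0) implybT.
  by congr (_ `^ _); ring.
have sub : [set x | (v%:E <= heat_pot t W x)%E] `<=`
    [set x | ((v / (2 * k))%:E <= heat_pot t g x)%E].
  move=> x /= vx.
  have := le_trans vx (heat_pot_le x (ltW t0) (ltW d0) (ltW k0) mW mg W0 g0 split).
  have -> : d * t = v / 2 by rewrite /d; field; rewrite gt_eqF.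
  have := heat_pot_ge0 t x g0; case: (heat_pot t g x) => [r|_ _|//]; last by rewrite leey.
  move=> r0; rewrite -EFinM -EFinD !lee_fin => h.
  rewrite ler_pdivrMr ?mulr_gt0//; lra.
have mpot := measurable_heat_pot t mg g0.
have mset (f : T3 -> \bar R) (c : \bar R) : measurable_fun setT f -> measurable [set x | (c <= f x)%E].
  by move=> mf; rewrite -[X in measurable X]setTI; exact: emeasurable_fun_c_infty.
have mA := mset _ v%:E (measurable_heat_pot t mW W0).
have mB := mset _ (v / (2 * k))%:E mpot.
apply: (le_trans (le_measure (L3 R) (mem_set mA) (mem_set mB) sub)).
have vk0 : 0 < v / (2 * k) by rewrite divr_gt0// mulr_gt0.
have := @le_integral_comp_abse _ _ _ (L3 R) setT measurableT (heat_pot t g) _ id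
  (@measurable_id _ _ _) (fun r r0 => r0) (fun _ _ _ _ ab => ab) mpot vk0.
under [X in (_ <= X)%E -> _]eq_integral do rewrite /= gee0_abs ?heat_pot_ge0//.
rewrite integral_heat_pot ?(ltW t0)// setTI.
rewrite (_ : [set x | _] = [set x | ((v / (2 * k))%:E <= heat_pot t g x)%E]); last first.
  by apply/seteqP; split=> x /=; rewrite gee0_abs ?heat_pot_ge0.
move=> h.
have -> : (2 * t / v) `^ p = (v / (2 * k))^-1 * t.
  have -> : (2 * t / v) `^ p = (2 * t / v) * (2 * t / v) `^ (p - 1).
    rewrite -[X in _ = X * _]powRr1; last by rewrite divr_ge0 ?mulr_ge0 ?ltW.
    have tv0 : 0 < 2 * t / v by rewrite divr_gt0// mulr_gt0.
    rewrite -powRD; last by rewrite (gt_eqF tv0) implybT.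
    by congr (_ `^ _); ring.
  have -> : (2 * t / v) `^ (p - 1) = k.
    rewrite /k /d -[v / (2 * t)]invrK invf_div.
    have : 0 <= 2 * t / v by rewrite divr_ge0 ?mulr_ge0// ltW.
    move: (2 * t / v) => r r0; rewrite -(powR_inv1 r0) -powRrM.
    by congr (_ `^ _); ring.
  by field; rewrite !gt_eqF.
rewrite [((v / (2 * k))^-1 * t)%:E]EFinM -muleA.
by rewrite lee_pdivlMl.
Qed.

End heat_potential.

(** * Representation of a function by its heat flow *)

Section box_average.
Context {R : realType}.
Local Notation mu := (@lebesgue_measure R).
Local Notation T3 := (R3 (measurableTypeR R)).
Implicit Types (f : T3 -> R) (x y : T3) (s t : R).

Section bounded_set.
Variables (Q : set T3) (L : R).
Hypotheses (mQ : measurable Q) (Qfin : (L3 R Q < +oo)%E) (QL : forall x, Q x -> nrm2 x <= L).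

Definition box_mass s y : \bar R := (\int[L3 R]_x (\1_Q x * heatH s x y)%:E)%E.

Let mker s : measurable_fun setT (fun z : T3 * T3 => \1_Q z.1 * heatH s z.1 z.2).
Proof.
apply: measurable_funM; last exact: measurable_heatH.
have mI : measurable_fun setT (\1_Q : T3 -> R) by exact: measurable_indic.
exact: measurableT_comp mI measurable_fst.
Qed.

Let mkerx s y : measurable_fun setT (fun x => \1_Q x * heatH s x y).
Proof. exact: measurableT_comp (mker s) (pair2_measurable y). Qed.

Let ker_ge0 s x y : 0 < s -> 0 <= \1_Q x * heatH s x y.
Proof. by move=> s0; rewrite mulr_ge0// heatH_ge0// ltW. Qed.

Lemma box_mass_ge0 s y : 0 < s -> (0 <= box_mass s y)%E.
Proof. by move=> s0; apply: integral_ge0 => x _; rewrite lee_fin ker_ge0. Qed.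

Lemma measurable_box_mass s : 0 < s -> measurable_fun setT (box_mass s).
Proof.
move=> s0; apply: (measurable_fun_fubini_tonelli_G (m1 := L3 R)
    (fun z : T3 * T3 => (\1_Q z.1 * heatH s z.1 z.2)%:E)).
- by apply/measurable_EFinP; exact: mker.
- by move=> z; rewrite lee_fin ker_ge0.
Qed.

Lemma integral_heatHl s y : 0 < s -> (\int[L3 R]_x (heatH s x y)%:E = 1)%E.
Proof. by move=> s0; under eq_integral do rewrite heatHC; exact: integral_heatH. Qed.

Lemma measurable_heatHl s y : measurable_fun setT (fun x : T3 => heatH s x y).
Proof. exact: measurable_heatH. Qed.

Lemma box_mass_le1 s y : 0 < s -> (box_mass s y <= 1)%E.
Proof.
move=> s0; rewrite -(integral_heatHl y s0); apply: ge0_le_integral => //.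
- by move=> x _; rewrite lee_fin ker_ge0.
- by apply/measurable_EFinP; exact: mkerx.
- by apply/measurable_EFinP; exact: measurable_heatHl.
- move=> x _; rewrite lee_fin; apply: ler_piMl; first by rewrite heatH_ge0// ltW.
  by rewrite indicE lern1 leq_b1.
Qed.

Lemma box_mass_gauss : exists C : R, 0 <= C /\ forall s y, 0 < s -> s <= 1 ->
  (box_mass s y <= (C * expR (- 8^-1 * nrm2 y))%:E)%E.
Proof.
pose K : R := 32 * ((Num.sqrt (2 * pi)) ^+ 3)^-1 * expR (L / 4).
have K0 : 0 <= K by rewrite !mulr_ge0 ?expR_ge0// invr_ge0 exprn_ge0// sqrtr_ge0.
have V0 : 0 <= fine (L3 R Q) by rewrite fine_ge0.
exists (K * fine (L3 R Q) + expR ((4 * L + 4) / 8)).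
split=> [|s y s0 s1]; first by rewrite addr_ge0 ?mulr_ge0// expR_ge0.
rewrite mulrDl; have [yL|Ly] := leP (nrm2 y) (4 * L + 4).
  apply: (le_trans (box_mass_le1 y s0)); rewrite lee_fin.
  rewrite (@le_trans _ _ (expR ((4 * L + 4) / 8) * expR (- 8^-1 * nrm2 y)))//; last first.
    by rewrite lerDr !mulr_ge0// expR_ge0.
  by rewrite -expRD -[leLHS]expR0 ler_expR; lra.
apply: (@le_trans _ _ (K * fine (L3 R Q) * expR (- 8^-1 * nrm2 y))%:E); last first.
  by rewrite lee_fin lerDl mulr_ge0// expR_ge0.
apply: (@le_trans _ _ (\int[L3 R]_x ((K * expR (- 8^-1 * nrm2 y))%:E * (\1_Q x)%:E)%E)%E).
  apply: ge0_le_integral => //.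
  - by move=> x _; rewrite lee_fin ker_ge0.
  - by apply/measurable_EFinP; exact: mkerx.
  - by apply: emeasurable_funM => //; apply/measurable_EFinP; exact: measurable_indic.
  - move=> x _; rewrite -EFinM lee_fin indicE; case: (boolP (x \in Q)) => [|_]; last first.
      by rewrite mul0r mulr0.
    rewrite inE mul1r mulr1 => /QL xL; have := dist2_lb x y => dlb.
    have d1 : 1 <= dist2 x y by have := nrm2_ge0 x; lra.
    apply: (le_trans (heatH_far s0 s1 d1)); rewrite /K -[leRHS]mulrA -expRD.
    apply: ler_wpM2l; first by rewrite mulr_ge0// invr_ge0 exprn_ge0// sqrtr_ge0.
    by rewrite ler_expR; lra.
rewrite ge0_integralZl//=; last 2 first.
- by apply/measurable_EFinP; exact: measurable_indic.
- by rewrite lee_fin mulr_ge0// expR_ge0.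
rewrite integral_indic// setIT -[X in (_ * X <= _)%E]fineK ?ge0_fin_numE//.
by rewrite -EFinM lee_fin mulrAC.
Qed.

Lemma box_mass_fubini f s : gauss_integrable f -> 0 < s ->
  (L3 R \x L3 R)%E.-integrable setT (fun z : T3 * T3 => (\1_Q z.1 * (f z.2 * heatH s z.1 z.2))%:E) /\
  (\int[L3 R]_x \int[L3 R]_y (\1_Q x * (f y * heatH s x y))%:E =
   \int[L3 R]_y ((f y)%:E * box_mass s y))%E.
Proof.
move=> fi s0; have mf := gauss_integrable_measurable fi.
have iF : (L3 R \x L3 R)%E.-integrable setT (fun z : T3 * T3 => (\1_Q z.1 * (f z.2 * heatH s z.1 z.2))%:E).
  pose C := ((Num.sqrt (2 * pi) * s) ^+ 3)^-1 * expR (L / (2 * s ^+ 2)).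
  apply: (@integrable_prod_bound _ _ _ _ _ (L3 R) (L3 R) Q
    (fun y => C * (`|f y| * expR (- (4 * s ^+ 2)^-1 * nrm2 y)))) => //.
  - apply: measurable_funM.
      have mI : measurable_fun setT (\1_Q : T3 -> R) by exact: measurable_indic.
      exact: measurableT_comp mI measurable_fst.
    apply: measurable_funM; last exact: measurable_heatH.
    exact: measurableT_comp mf measurable_snd.
  - under eq_fun do rewrite EFinM.
    apply: integrableZl => //; apply: gauss_integrable_norm => //.
    by rewrite invr_gt0 mulr_gt0// exprn_gt0.
  - move=> x y /=; rewrite normrM (ger0_norm (_ : 0 <= \1_Q x))//.
    rewrite indicE; case: (boolP (x \in Q)) => [|_]; last by rewrite !mul0r.
    rewrite inE !mul1r => /QL xL; rewrite normrM (ger0_norm (heatH_ge0 _ _ (ltW s0))).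
    rewrite [leRHS]mulrCA; apply: ler_wpM2l => //.
    exact: heatH_gauss s0 (lexx s) (lexx s) xL.
split=> //; rewrite (Fubini iF)/=; apply: eq_integral => y _.
rewrite /box_mass.
under eq_integral do rewrite mulrCA EFinM.
rewrite integralZl//; apply/integrableP; split; first by apply/measurable_EFinP; exact: mkerx.
under eq_integral do rewrite /= ger0_norm ?ker_ge0//.
by apply: (le_lt_trans (box_mass_le1 y s0)); rewrite ltry.
Qed.

(* The kernel concentrates: [1_Q] is constant near [y], and the rest is controlled by the second moment. *)
Lemma box_mass_near (d : R) y s : 0 < d -> 0 < s ->
  (forall x, dist2 x y < d -> (x \in Q) = (y \in Q)) ->
  (box_mass s y <= (\1_Q y + 24 * s ^+ 2 / d)%:E)%E /\
  ((\1_Q y - 24 * s ^+ 2 / d)%:E <= box_mass s y)%E.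
Proof.
move=> d0 s0 hd; have s20 : 0 < 2 * s by rewrite mulr_gt0.
have k0 : 0 <= 24 * s ^+ 2 / d by rewrite divr_ge0 ?(ltW d0)// mulr_ge0// sqr_ge0.
have H0 x : 0 <= heatH s x y by rewrite heatH_ge0// ltW.
have H20 x : 0 <= heatH (2 * s) x y by rewrite heatH_ge0// ltW.
have far x : d <= dist2 x y -> heatH s x y <= 24 * s ^+ 2 / d * heatH (2 * s) x y.
  move=> dx; have h := heatH_moment x y s0.
  have v0 : 0 < s ^+ 2 / d by rewrite divr_gt0// exprn_gt0.
  have : 1 <= s ^+ 2 / d * (1 + dist2 x y / s ^+ 2).
    have -> : s ^+ 2 / d * (1 + dist2 x y / s ^+ 2) = s ^+ 2 / d + dist2 x y / d.
      by field; rewrite !gt_eqF.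
    have : 1 <= dist2 x y / d by rewrite ler_pdivlMr ?mul1r.
    lra.
  move=> /(ler_wpM2r (H0 x)); rewrite mul1r => /le_trans; apply.
  have -> : 24 * s ^+ 2 / d * heatH (2 * s) x y = s ^+ 2 / d * (24 * heatH (2 * s) x y) by ring.
  by rewrite -[leLHS]mulrA; apply: ler_wpM2l => //; exact: ltW.
have pt x : `|\1_Q x - \1_Q y| * heatH s x y <= 24 * s ^+ 2 / d * heatH (2 * s) x y :> R.
  have [xd|dx] := ltP (dist2 x y) d.
    by rewrite !indicE hd// subrr normr0 mul0r mulr_ge0.
  apply: (le_trans _ (far _ dx)); apply: ler_piMl => //.
  by rewrite !indicE; case: (x \in Q); case: (y \in Q);
    rewrite /= ?subrr ?subr0 ?sub0r ?normrN ?normr0 ?normr1.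
have mH t : measurable_fun setT (fun x : T3 => (heatH t x y)%:E).
  by apply/measurable_EFinP; exact: measurable_heatHl.
have cst_int (c : R) t : 0 <= c -> 0 < t -> (\int[L3 R]_x (c * heatH t x y)%:E = c%:E)%E.
  move=> c0 t0; under eq_integral do rewrite EFinM.
  by rewrite ge0_integralZl ?lee_fin// ?integral_heatHl ?mule1// => x _; rewrite lee_fin heatH_ge0// ltW.
have add_int (g1 g2 : T3 -> R) : measurable_fun setT g1 -> measurable_fun setT g2 ->
   (forall x, 0 <= g1 x) -> (forall x, 0 <= g2 x) ->
   (\int[L3 R]_x (g1 x)%:E + \int[L3 R]_x (g2 x)%:E = \int[L3 R]_x (g1 x + g2 x)%:E)%E.
  move=> m1 m2 g10 g20; rewrite -ge0_integralD//.
  - by move=> x _; rewrite lee_fin.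
  - exact/measurable_EFinP.
  - by move=> x _; rewrite lee_fin.
  - exact/measurable_EFinP.
have mZ (c : R) t : measurable_fun setT (fun x : T3 => c * heatH t x y).
  by apply: measurable_funM => //; exact: measurable_heatHl.
split.
  rewrite EFinD -(cst_int (\1_Q y) s)// -(cst_int _ (2 * s) k0 s20) add_int//; last 2 first.
  - by move=> x; rewrite mulr_ge0.
  - by move=> x; rewrite mulr_ge0.
  apply: ge0_le_integral => //.
  - by move=> x _; rewrite lee_fin ker_ge0.
  - by apply/measurable_EFinP; exact: mkerx.
  - by apply/measurable_EFinP; exact: measurable_funD.
  - move=> x _; rewrite lee_fin; have := pt x.
    have := ler_norm (\1_Q x - \1_Q y : R); have := H0 x; nra.
rewrite EFinB leeBlDr//.
rewrite -[X in (X <= _)%E](cst_int (\1_Q y) s)// -(cst_int _ (2 * s) k0 s20) /box_mass add_int//; last 2 first.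
- by move=> x; rewrite ker_ge0.
- by move=> x; rewrite mulr_ge0.
apply: ge0_le_integral => //.
- by move=> x _; rewrite lee_fin mulr_ge0.
- exact/measurable_EFinP.
- by apply/measurable_EFinP; exact: measurable_funD.
- move=> x _; rewrite lee_fin; have := pt x.
  have := ler_norm (\1_Q y - \1_Q x : R); rewrite -normrN opprB; have := H0 x; nra.
Qed.

Lemma box_mass_cvg y (d : R) : 0 < d ->
  (forall x, dist2 x y < d -> (x \in Q) = (y \in Q)) ->
  (box_mass n.+1%:R^-1 y @[n --> \oo] --> (\1_Q y)%:E)%E.
Proof.
move=> d0 hd.
pose k (n : nat) : R := 24 / d * harmonic n.
have kn : k n @[n --> \oo] --> (0 : R).
  rewrite -(mulr0 (24 / d)); apply: cvgMr; exact: cvg_harmonic.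
have kE (n : nat) : 24 * (n.+1%:R^-1) ^+ 2 / d <= k n :> R.
  rewrite /k /harmonic/= mulrAC; apply: ler_wpM2l; first by rewrite divr_ge0// ltW.
  by rewrite expr2; apply: ler_piMl => //; rewrite invf_le1// ler1n.
apply: (@squeeze_cvge _ _ _ _ (fun n => (\1_Q y - k n)%:E) _ (fun n => (\1_Q y + k n)%:E)).
- near=> n; have n0 : 0 < n.+1%:R^-1 :> R by rewrite invr_gt0.
  have [h1 h2] := box_mass_near d0 n0 hd.
  apply/andP; split.
  + by apply: le_trans h2; rewrite lee_fin lerD2l lerN2.
  + by apply: (le_trans h1); rewrite lee_fin lerD2l.
- apply: cvg_EFin; first by near=> n.
  by rewrite -[X in _ --> X](subr0 (\1_Q y : R)); apply: cvgB => //; exact: cvg_cst.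
- apply: cvg_EFin; first by near=> n.
  by rewrite -[X in _ --> X](addr0 (\1_Q y : R)); apply: cvgD => //; exact: cvg_cst.
Unshelve. all: by end_near. Qed.

Lemma integral_box_mass_cvg f : gauss_integrable f ->
  {ae L3 R, forall y, exists2 d : R, 0 < d &
    forall x, dist2 x y < d -> (x \in Q) = (y \in Q)} ->
  ((\int[L3 R]_y ((f y)%:E * box_mass n.+1%:R^-1 y))%E @[n --> \oo] -->
   (\int[L3 R]_y (f y * \1_Q y)%:E)%E).
Proof.
move=> fi aeQ; have mf := gauss_integrable_measurable fi.
have [C [C0 hC]] := box_mass_gauss.
have s0 n : 0 < n.+1%:R^-1 :> R by rewrite invr_gt0.
have s1 n : n.+1%:R^-1 <= 1 :> R by rewrite invf_le1// ler1n.
have [] // := @dominated_convergence _ _ _ (L3 R) setT measurableT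
  (fun n y => (f y)%:E * box_mass n.+1%:R^-1 y)%E
  (fun y => (f y * \1_Q y)%:E)
  (fun y => (C%:E * (`|f y| * expR (- 8^-1 * nrm2 y))%:E)%E).
- move=> n; apply: emeasurable_funM; first exact/measurable_EFinP.
  exact: measurable_box_mass.
- by apply/measurable_EFinP; apply: measurable_funM => //; exact: measurable_indic.
- apply: filterS aeQ => y [d d0 hd] _; rewrite EFinM.
  by apply: cvgeZl => //; exact: box_mass_cvg hd.
- by apply: integrableZl => //; apply: gauss_integrable_norm => //; rewrite invr_gt0.
- apply: aeW => y n _; rewrite abseM (gee0_abs (box_mass_ge0 _ (s0 n))).
  rewrite abse_EFin -EFinM mulrCA EFinM.
  by apply: lee_wpmul2l => //; exact: hC.
Qed.

End bounded_set.

Definition box (a b : T3) : set T3 :=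
  (`]a.1.1, b.1.1] `*` `]a.1.2, b.1.2]) `*` `]a.2, b.2].

Lemma in_box a b x : (x \in box a b) =
  [&& a.1.1 < x.1.1 <= b.1.1, a.1.2 < x.1.2 <= b.1.2 & a.2 < x.2 <= b.2].
Proof.
apply/idP/idP; first by rewrite inE => -[[/= h1 h2] h3]; rewrite !in_itv/= in h1 h2 h3; rewrite h1 h2.
by move=> /and3P[h1 h2 h3]; rewrite inE; split; [split|]; rewrite /= in_itv.
Qed.

Lemma measurable_box a b : measurable (box a b).
Proof. by apply: measurableX => //; apply: measurableX. Qed.

Lemma lambda3_rect (A B C : set (measurableTypeR R)) :
  measurable A -> measurable B -> measurable C ->
  (L3 R ((A `*` B) `*` C) = mu A * mu B * mu C)%E.
Proof.
move=> mA mB mC.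
have L2E : (mu \x mu)%E (A `*` B) = (mu A * mu B)%E by exact: product_measure1E.
rewrite /L3/= product_measure1E//; last exact: measurableX.
by congr (_ * _)%E.
Qed.

Lemma box_fin a b : (L3 R (box a b) < +oo)%E.
Proof.
have h (c d : R) : mu `]c, d]%classic \is a fin_num.
  by rewrite ge0_fin_numE// lebesgue_measure_itv/=; case: ifP => _; rewrite ?ltry// -EFinB ltry.
rewrite lambda3_rect ?measurable_itv// -ge0_fin_numE ?mule_ge0//.
by rewrite !fin_numM ?h.
Qed.

Lemma box_nrm2 a b x : box a b x -> nrm2 x <= nrm2 a + nrm2 b.
Proof.
have h (s t u : R) : s < t <= u -> t ^+ 2 <= s ^+ 2 + u ^+ 2.
  by move=> /andP[st tu]; have [t0|t0] := leP 0 t; nra.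
move=> [[/= h1 h2] h3]; rewrite /nrm2.
have := h _ _ _ h1; have := h _ _ _ h2; have := h _ _ _ h3; lra.
Qed.

Lemma itv_locally_cst (a b t : R) : t != a -> t != b -> exists2 d : R, 0 < d &
  forall s, (s - t) ^+ 2 < d -> (a < s <= b) = (a < t <= b).
Proof.
move=> ta tb.
exists (Num.min ((t - a) ^+ 2) ((t - b) ^+ 2)).
  by rewrite lt_min !exprn_even_gt0//= !subr_eq0 ta tb.
move=> s; rewrite lt_min => /andP[sa sb].
congr (_ && _).
  by apply/idP/idP => h; rewrite ltNge; apply/negP => h'; nra.
move: tb; rewrite neq_lt => /orP[tb|bt].
  by rewrite (ltW tb) leNgt; apply/negP => h; nra.
by rewrite [RHS]leNgt bt/=; apply/negP => h; nra.
Qed.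

Lemma negligible_coord (c : R) : [/\ (L3 R).-negligible [set y : T3 | y.1.1 = c],
  (L3 R).-negligible [set y : T3 | y.1.2 = c] & (L3 R).-negligible [set y : T3 | y.2 = c]].
Proof.
have mc : measurable ([set c] : set (measurableTypeR R)) by exact: measurable_set1.
split.
- exists (([set c] `*` setT) `*` setT); split.
  + by apply: measurableX => //; exact: measurableX.
  + by rewrite lambda3_rect// lebesgue_measure_set1 !mul0e.
  + by move=> y /= ->.
- exists ((setT `*` [set c]) `*` setT); split.
  + by apply: measurableX => //; exact: measurableX.
  + by rewrite lambda3_rect// lebesgue_measure_set1 mule0 mul0e.
  + by move=> y /= ->.
- exists (setT `*` [set c]); split.
  + by apply: measurableX.
  + by rewrite -[X in X `*` _]setXTT lambda3_rect// lebesgue_measure_set1 mule0.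
  + by move=> y /= ->.
Qed.

Lemma box_locally_cst a b : {ae L3 R, forall y, exists2 d : R, 0 < d &
  forall x, dist2 x y < d -> (x \in box a b) = (y \in box a b)}.
Proof.
have ne (c : R) : {ae L3 R, forall y : T3, [/\ y.1.1 != c, y.1.2 != c & y.2 != c]}.
  have [n1 n2 n3] := negligible_coord c.
  apply: negligibleS (negligibleU n1 (negligibleU n2 n3)) => y /= /not_and3P.
  by case=> /negP; rewrite negbK => /eqP; [left|right; left|right; right].
near=> y.
have [a1 _ _] : [/\ y.1.1 != a.1.1, y.1.2 != a.1.1 & y.2 != a.1.1] by near: y; exact: ne.
have [b1 _ _] : [/\ y.1.1 != b.1.1, y.1.2 != b.1.1 & y.2 != b.1.1] by near: y; exact: ne.
have [_ a2 _] : [/\ y.1.1 != a.1.2, y.1.2 != a.1.2 & y.2 != a.1.2] by near: y; exact: ne.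
have [_ b2 _] : [/\ y.1.1 != b.1.2, y.1.2 != b.1.2 & y.2 != b.1.2] by near: y; exact: ne.
have [_ _ a3] : [/\ y.1.1 != a.2, y.1.2 != a.2 & y.2 != a.2] by near: y; exact: ne.
have [_ _ b3] : [/\ y.1.1 != b.2, y.1.2 != b.2 & y.2 != b.2] by near: y; exact: ne.
have [d1 d10 h1] := itv_locally_cst a1 b1.
have [d2 d20 h2] := itv_locally_cst a2 b2.
have [d3 d30 h3] := itv_locally_cst a3 b3.
exists (Num.min d1 (Num.min d2 d3)) => [|x]; first by rewrite !lt_min d10 d20 d30.
rewrite !lt_min => /and3P[l1 l2 l3].
rewrite /dist2 in l1 l2 l3.
have := sqr_ge0 (x.1.1 - y.1.1); have := sqr_ge0 (x.1.2 - y.1.2); have := sqr_ge0 (x.2 - y.2).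
move=> q3 q2 q1.
have e1 : (x.1.1 - y.1.1) ^+ 2 < d1.
  by apply: le_lt_trans l1; rewrite -addrA lerDl addr_ge0.
have e2 : (x.1.2 - y.1.2) ^+ 2 < d2.
  by apply: le_lt_trans l2; rewrite addrAC lerDr addr_ge0.
have e3 : (x.2 - y.2) ^+ 2 < d3.
  by apply: le_lt_trans l3; rewrite lerDr addr_ge0.
by rewrite !in_box (h1 _ e1) (h2 _ e2) (h3 _ e3).
Unshelve. all: by end_near. Qed.

End box_average.

Section box_uniqueness.
Context {R : realType}.
Local Notation mu := (@lebesgue_measure R).
Local Notation T3 := (R3 (measurableTypeR R)).

Definition boxes : set (set T3) := [set A | exists a b, A = box a b].

Lemma box_cover (a b : T3) (k : 'I_3) : exists F : nat -> set T3, (forall n, boxes (F n)) /\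
  \bigcup_n F n = [set x : T3 | if k == 0 then a.1.1 < x.1.1 <= b.1.1 else
     if k == 1 then a.1.2 < x.1.2 <= b.1.2 else a.2 < x.2 <= b.2].
Proof.
pose m (n : nat) : R := - n%:R.
pose F0 n := box ((a.1.1, m n), m n) ((b.1.1, n%:R), n%:R).
pose F1 n := box ((m n, a.1.2), m n) ((n%:R, b.1.2), n%:R).
pose F2 n := box ((m n, m n), a.2) ((n%:R, n%:R), b.2).
have big (s t : R) : exists n : nat, [/\ m n < s <= n%:R & m n < t <= n%:R].
  exists (Num.bound (`|s| + `|t|)).
  have := archi_boundP (addr_ge0 (normr_ge0 s) (normr_ge0 t)).
  rewrite /m; set N := _%:R => h.
  have := ler_norm s; have := ler_norm (- s); have := ler_norm t; have := ler_norm (- t).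
  rewrite !normrN => h1 h2 h3 h4; have := normr_ge0 s; have := normr_ge0 t => h5 h6.
  by split; apply/andP; split; lra.
exists (fun n => if k == 0 then F0 n else if k == 1 then F1 n else F2 n); split.
  by move=> n; case: ifP => _; [|case: ifP => _]; do 2 eexists; reflexivity.
apply/seteqP; split=> x /=.
  move=> [n _]; case: ifP => _; [|case: ifP => _]; rewrite -inE in_box/= => /and3P[] //.
case: ifP => _; [|case: ifP => _] => h.
- have [n [h1 h2]] := big x.1.2 x.2; by exists n.
- have [n [h1 h2]] := big x.1.1 x.2; by exists n.
- have [n [h1 h2]] := big x.1.1 x.1.2; by exists n.
Qed.

Lemma boxesI : setI_closed boxes.
Proof.
move=> _ _ [a [b ->]] [c [d ->]].
exists ((Num.max a.1.1 c.1.1, Num.max a.1.2 c.1.2), Num.max a.2 c.2),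
       ((Num.min b.1.1 d.1.1, Num.min b.1.2 d.1.2), Num.min b.2 d.2).
suff h x : (x \in box a b `&` box c d) = (x \in box ((Num.max a.1.1 c.1.1, Num.max a.1.2 c.1.2), Num.max a.2 c.2)
       ((Num.min b.1.1 d.1.1, Num.min b.1.2 d.1.2), Num.min b.2 d.2)).
  by apply/seteqP; split=> x /mem_set; [rewrite h|rewrite -h] => /set_mem.
rewrite in_setI !in_box /= !gt_max !le_min.
apply/idP/idP.
  move=> /andP[/and3P[/andP[-> ->] /andP[-> ->] /andP[-> ->]]].
  by move=> /and3P[/andP[-> ->] /andP[-> ->] /andP[-> ->]].
move=> /and3P[/andP[/andP[-> ->] /andP[-> ->]] /andP[/andP[-> ->] /andP[-> ->]]].
by move=> /andP[/andP[-> ->] /andP[-> ->]].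
Qed.

Lemma measurable_boxes : @measurable _ T3 = <<s boxes >>.
Proof.
apply/seteqP; split; last first.
  apply: smallest_sub; first exact: sigma_algebra_measurable.
  by move=> _ [a [b ->]]; exact: measurable_box.
pose TS := g_sigma_algebraType boxes.
have mcoord (k : 'I_3) (p : TS -> measurableTypeR R) :
    p = (fun x : T3 => if k == 0 then x.1.1 else if k == 1 then x.1.2 else x.2) ->
    measurable_fun setT p.
  move=> pE; apply: (@measurability _ _ _ _ _ _ (R.-ocitv.-measurable)) => //.
  move=> _ [_ [[c d] _ <-] <-]; rewrite setTI.
  have [F [hF FE]] := box_cover ((c, c), c) ((d, d), d) k.
  rewrite (_ : p @^-1` _ = \bigcup_n F n); last first.
    rewrite FE; apply/seteqP; split=> x; rewrite /= pE in_itv/=;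
      by case: ifP => // _; case: ifP.
  apply: bigcup_measurable => n _; exact: sub_sigma_algebra.
have m1 : measurable_fun setT ((fun x => x.1.1) : TS -> measurableTypeR R) by exact: (mcoord 0).
have m2 : measurable_fun setT ((fun x => x.1.2) : TS -> measurableTypeR R) by exact: (mcoord 1).
have m3 : measurable_fun setT ((fun x => x.2) : TS -> measurableTypeR R) by exact: (mcoord 2).
have mid : measurable_fun setT ((fun x => ((x.1.1, x.1.2), x.2)) : TS -> T3).
  by apply: measurable_fun_pair => //; exact: measurable_fun_pair.
move=> A mA.
have := mid measurableT A mA; rewrite setTI.
by rewrite (_ : _ @^-1` A = A)//; apply/seteqP; split=> -[[]].
Qed.

Section density.
Context d (T : measurableType d) (m : {measure set T -> \bar R}) (f : T -> \bar R).
Hypotheses (mf : measurable_fun setT f) (f0 : forall x, (0 <= f x)%E).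
Definition density (A : set T) : \bar R := (\int[m]_(x in A) f x)%E.
Let density0 : density set0 = 0%E. Proof. exact: integral_set0. Qed.

Let density_ge0 A : (0 <= density A)%E. Proof. exact: integral_ge0. Qed.

Definition density_measure : {measure set T -> \bar R} :=
  HB.pack density (isMeasure.Build _ _ _ density density0 density_ge0
    (@semi_sigma_additive_nng_induced _ _ _ m f mf f0)).

End density.

Lemma box_exhaust : exists F : nat -> set T3, (forall n, boxes (F n)) /\ \bigcup_n F n = setT.
Proof.
pose F n : set T3 := box ((- n%:R, - n%:R), - n%:R) ((n%:R, n%:R), n%:R).
exists F; split; first by move=> n; do 2 eexists; reflexivity.
apply/seteqP; split=> // x _.
exists (Num.bound (`|x.1.1| + `|x.1.2| + `|x.2|)) => //.
have := archi_boundP (addr_ge0 (addr_ge0 (normr_ge0 x.1.1) (normr_ge0 x.1.2)) (normr_ge0 x.2)).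
set n := Num.bound _ => h; apply: set_mem; rewrite /F in_box/=.
have hh (s : R) : `|s| < n%:R -> - n%:R < s <= n%:R.
  by rewrite ltr_norml => /andP[-> /ltW ->].
by rewrite !hh//; apply: le_lt_trans h; rewrite ?lerDr ?addr_ge0// -?addrA ?lerDl ?addr_ge0//
  addrCA lerDl addr_ge0.
Qed.

Lemma ae_eq0_boxes (u : T3 -> \bar R) : measurable_fun setT u ->
  (forall a b, (L3 R).-integrable (box a b) u) ->
  (forall a b, (\int[L3 R]_(x in box a b) u x = 0)%E) ->
  {ae L3 R, forall x, u x = 0%E}.
Proof.
move=> mU iu u0.
have [F [FB FT]] := box_exhaust.
have mF n : measurable (F n) by have [a [b ->]] := FB n; exact: measurable_box.
have mp : measurable_fun setT u^\+%E by exact: measurable_funepos.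
have mn : measurable_fun setT u^\-%E by exact: measurable_funeneg.
have fin a b : (\int[L3 R]_(x in box a b) u^\+%E x < +oo)%E.
  have := integrable_funepos (measurable_box a b) (iu a b).
  move=> /integrableP[_]; apply: le_lt_trans; apply: ge0_le_integral => //.
  - exact: measurable_box.
  - exact: measurable_funTS.
  - by apply: measurableT_comp => //; exact: measurable_funTS.
  - by move=> x _; exact: lee_abs.
have eqm A : measurable A ->
    (\int[L3 R]_(x in A) u^\+%E x = \int[L3 R]_(x in A) u^\-%E x)%E.
  move=> mA.
  apply: (@measure_unique _ _ _ boxes F measurable_boxes boxesI FB FT
    (density_measure (L3 R) mp (fun x => funepos_ge0 _ x))
    (density_measure (L3 R) mn (fun x => funeneg_ge0 _ x))) => //.
  - move=> _ [a [b ->]]; rewrite /= /density.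
    have sub0 (y z : \bar R) : y \is a fin_num -> (y - z = 0)%E -> y = z.
      by case: y z => [y| |] [z| |]//= _ [] /eqP; rewrite subr_eq0 => /eqP ->.
    apply: sub0; first by rewrite ge0_fin_numE ?integral_ge0//; exact: fin.
    exact: etrans (esym (integralE (L3 R) (box a b) u)) (u0 a b).
  - by move=> k; have [a [b ->]] := FB k; exact: fin.
have ae n : {ae L3 R, forall x, F n x -> u x = 0%E}.
  have [a [b Fn]] := FB n.
  have iF : (L3 R).-integrable (F n) u by rewrite Fn.
  have := @integral_ae_eq _ _ _ (L3 R) (F n) (mF n) (cst 0%E) u iF.
  move=> /(_ (measurable_cst _)); apply: (fun P => P) => h.
  have /h : forall E, E `<=` F n -> measurable E ->
      (\int[L3 R]_(x in E) u x = \int[L3 R]_(x in E) cst 0 x)%E.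
    move=> E EF mE; rewrite integral0 integralE eqm//.
    apply: subee; rewrite -eqm// ge0_fin_numE; last exact: integral_ge0.
    apply: le_lt_trans (fin a b); rewrite -Fn.
    apply: ge0_subset_integral => //.
    exact: measurable_funTS.
  by apply: filterS => x /= h1 /h1.
have := ae_foralln ae; apply: filterS => x hx.
have : (\bigcup_n F n) x by rewrite FT.
by move=> [n _ Fx]; exact: hx Fx.
Qed.

End box_uniqueness.

Lemma measurable_integral_param d1 d2 (T1 : measurableType d1) (T2 : measurableType d2)
    (R : realType) (m2 : {sigma_finite_measure set T2 -> \bar R}) (f : T1 * T2 -> \bar R) :
  measurable_fun setT f -> measurable_fun setT (fun x => \int[m2]_y f (x, y))%E.
Proof.
move=> mf.
rewrite (_ : (fun x => _) = (fun x => \int[m2]_y f^\+ (x, y) - \int[m2]_y f^\- (x, y))%E).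
  apply: emeasurable_funB.
    by apply: (measurable_fun_fubini_tonelli_F (m2 := m2) f^\+%E) => //; exact: measurable_funepos.
  by apply: (measurable_fun_fubini_tonelli_F (m2 := m2) f^\-%E) => //; exact: measurable_funeneg.
apply/funext => x; rewrite [LHS]integralE.
under eq_integral do rewrite funepos_comp/=.
by under [X in (_ - X = _)%E]eq_integral do rewrite funeneg_comp/=.
Qed.

Lemma integral_indicM d2 (T1 : Type) (T2 : measurableType d2) (R : realType)
    (m : {measure set T2 -> \bar R}) (A : set T1) (x : T1) (f : T2 -> R) :
  (\int[m]_q (\1_A x * f q)%:E = (\1_A x)%:E * \int[m]_q (f q)%:E)%E.
Proof.
rewrite indicE; case: (x \in A) => /=.
  by rewrite mul1e; apply: eq_integral => q _; rewrite mul1r.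
by rewrite mul0e; apply: integral0_eq => q _; rewrite mul0r.
Qed.

Lemma integral_product_sfm d1 d2 (T1 : measurableType d1) (T2 : measurableType d2)
    (R : realType) (m1 : {sigma_finite_measure set T1 -> \bar R})
    (m2 : {sigma_finite_measure set T2 -> \bar R}) (f : T1 * T2 -> \bar R) :
  (\int[product_sfm m1 m2]_q f q = \int[m1 \x m2]_q f q)%E.
Proof. by []. Qed.

Lemma muleB_fin (R : realType) (c : R) (A B : \bar R) : B \is a fin_num ->
  (c%:E * (A - B) = c%:E * A - c%:E * B)%E.
Proof. by move=> fB; rewrite muleBr// fin_num_adde_defl// fin_numN. Qed.

Lemma cvg_eq_sub0 (R : realType) (u v : nat -> \bar R) (l m : \bar R) :
  (\forall n \near \oo, u n = v n) -> u n @[n --> \oo] --> l -> v n @[n --> \oo] --> m ->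
  m \is a fin_num -> (m - l = 0)%E.
Proof.
move=> uv ul vm fm.
have vl : v n @[n --> \oo] --> l by apply: cvg_trans ul; exact: near_eq_cvg.
have El := cvg_lim (@ereal_hausdorff R) vl.
have Em := cvg_lim (@ereal_hausdorff R) vm.
by rewrite -El Em subee.
Qed.

Lemma sube_eq0_fin (R : realType) (A B : \bar R) : A \is a fin_num -> (A - B = 0)%E -> A = B.
Proof. by case: A B => [y| |] [z| |]//= _ [] /eqP; rewrite subr_eq0 => /eqP ->. Qed.

Lemma restrict_indic (R : realType) (T : Type) (D : set T) (f : T -> \bar R) :
  f \_ D = (fun x => (\1_D x)%:E * f x)%E.
Proof.
by apply/funext => x; rewrite patchE indicE; case: (x \in D); rewrite ?mul1e ?mul0e.
Qed.

Lemma integral_box_heat_pot (R : realType) (W : R3 (measurableTypeR R) -> R) (p t : R) a b :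
  measurable_fun setT W -> (forall y, 0 <= W y) -> 1 <= p -> 0 < t ->
  (\int[L3 R]_y (W y `^ p)%:E < +oo)%E ->
  (\int[L3 R]_x ((\1_(box a b) x)%:E * heat_pot t W x) < +oo)%E.
Proof.
move=> mW W0 p1 t0 Wp.
set Q := box a b; have mQ : measurable Q := measurable_box a b.
set g := fun y => W y `^ p.
have mg : measurable_fun setT g by exact: measurableT_comp (measurable_powR _) mW.
have g0 y : 0 <= g y by exact: powR_ge0.
have Wg y : W y <= 1 + 1 * g y.
  rewrite mul1r; have [W1|W1] := leP (W y) 1.
    by rewrite (le_trans W1)// lerDl.
  rewrite (@le_trans _ _ (g y))//; last by rewrite lerDr.
  by rewrite -[leLHS](powRr1 (W0 y)) /g ler_powR// ltW.
have mpg := measurable_heat_pot t mg g0.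
have mI : measurable_fun setT (fun x : R3 (measurableTypeR R) => (\1_Q x : R)%:E).
  by apply/measurable_EFinP; exact: measurable_indic.
apply: (@le_lt_trans _ _ (\int[L3 R]_x (t%:E * (\1_Q x)%:E + heat_pot t g x))%E).
  apply: ge0_le_integral; first exact: measurableT.
  - by move=> x _; rewrite mule_ge0 ?lee_fin// heat_pot_ge0.
  - by apply: emeasurable_funM => //; exact: measurable_heat_pot.
  - by apply: emeasurable_funD => //; exact: emeasurable_funM.
  - move=> x _; have := heat_pot_le x (ltW t0) ler01 ler01 mW mg W0 g0 Wg.
    rewrite mul1r mul1e => h; rewrite indicE; case: (x \in Q).
      by rewrite mul1e mule1.
    by rewrite mul0e mule0 add0e heat_pot_ge0.
rewrite ge0_integralD//; last 3 first.
- by move=> x _; rewrite -EFinM lee_fin mulr_ge0// ltW.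
- exact: emeasurable_funM.
- by move=> x _; exact: heat_pot_ge0.
rewrite integral_heat_pot ?(ltW t0)// ge0_integralZl ?lee_fin ?(ltW t0)//.
rewrite integral_indic// setIT lte_add_pinfty//.
  by rewrite lte_mul_pinfty ?lee_fin ?(ltW t0)// box_fin.
by rewrite lte_mul_pinfty ?lee_fin ?(ltW t0).
Qed.

Section representation.
Context {R : realType}.
Local Notation mu := (@lebesgue_measure R).
Local Notation T3 := (R3 (measurableTypeR R)).
Local Notation P := (product_sfm (@lebesgue_measure R) (L3 R)).
Variables (phi b1 b2 b3 W : T3 -> R) (p t : R).
Hypothesis iphi : gauss_integrable phi.
Hypotheses (mb1 : measurable_fun setT b1) (mb2 : measurable_fun setT b2)
  (mb3 : measurable_fun setT b3).
Hypothesis iW : gauss_integrable W.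
Hypothesis W0 : forall y, 0 <= W y.
Hypothesis bW : forall y, 24 * (`|b1 y| + `|b2 y| + `|b3 y|) <= W y.
Hypothesis weak : heat_weak phi b1 b2 b3.
Hypotheses (p1 : 1 <= p) (t0 : 0 < t).
Hypothesis Wp : (\int[L3 R]_y (W y `^ p)%:E < +oo)%E.

Let mphi : measurable_fun setT phi. Proof. exact: gauss_integrable_measurable iphi. Qed.

Let mW : measurable_fun setT W. Proof. exact: gauss_integrable_measurable iW. Qed.
Local Notation flux := (flux b1 b2 b3).
Let heatE (s : R) (x : T3) : \bar R := (\int[L3 R]_y (phi y * heatH s x y)%:E)%E.
Let N (x : T3) : \bar R := (\int[mu \x L3 R]_p (\1_(`]0, t]) p.1 * flux p.1 x p.2)%:E)%E.

Let mflux (A : set R) : measurable (A : set (measurableTypeR R)) ->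
  measurable_fun setT (fun z : T3 * (measurableTypeR R * T3) =>
    \1_A z.2.1 * flux z.2.1 z.1 z.2.2).
Proof.
move=> mA.
have m21 : measurable_fun setT (fun z : T3 * (measurableTypeR R * T3) => z.2.1).
  exact: measurableT_comp measurable_fst measurable_snd.
have m22 : measurable_fun setT (fun z : T3 * (measurableTypeR R * T3) => z.2.2).
  exact: measurableT_comp measurable_snd measurable_snd.
apply: measurable_funM.
  exact: measurableT_comp (measurable_indic1 mA) measurable_snd.
exact: measurable_flux.
Qed.

Let mN : measurable_fun setT N.
Proof.
apply: (@measurable_integral_param _ _ _ _ _ P
  (fun z : T3 * (measurableTypeR R * T3) => (\1_(`]0, t]) z.2.1 * flux z.2.1 z.1 z.2.2)%:E)).
apply/measurable_EFinP; apply: mflux; exact: measurable_itv.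
Qed.

Let mheatE s : measurable_fun setT (heatE s).
Proof.
apply: (@measurable_integral_param _ _ _ _ _ (L3 R) (fun z : T3 * T3 => (phi z.2 * heatH s z.1 z.2)%:E)).
apply/measurable_EFinP; apply: measurable_funM; last exact: measurable_heatH.
exact: measurableT_comp mphi measurable_snd.
Qed.

Let flux_pot x (q : measurableTypeR R * T3) (A : set R) : A `<=` `]0, t]%classic ->
  `|\1_A q.1 * flux q.1 x q.2| <= heat_pot_ker t W x q.
Proof.
move=> At; rewrite indicE; case: (boolP (q.1 \in A)) => [|_]; last first.
  by rewrite mul0r normr0 heat_pot_ker_ge0.
rewrite inE => Aq; have := At _ Aq; rewrite /= in_itv/= => /andP[q0 qt].
rewrite mul1r /heat_pot_ker indicE mem_set ?mul1r//; last by rewrite /= in_itv/= q0.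
exact: flux_le.
Qed.

Let dom_integrable a b : (L3 R \x P)%E.-integrable setT
  (fun z => (\1_(box a b) z.1 * heat_pot_ker t W z.1 z.2)%:E).
Proof.
have mI : measurable_fun setT (\1_(box a b) : T3 -> R).
  by apply: measurable_indic; exact: measurable_box.
have mD : measurable_fun setT (fun z : T3 * (measurableTypeR R * T3) =>
    \1_(box a b) z.1 * heat_pot_ker t W z.1 z.2).
  apply: measurable_funM; last exact: measurable_heat_pot_ker.
  exact: measurableT_comp mI measurable_fst.
apply/integrable12ltyP; first exact/measurable_EFinP.
have E x : (\int[P]_q `|(\1_(box a b) x * heat_pot_ker t W x q)%:E| =
    (\1_(box a b) x)%:E * heat_pot t W x)%E.
  rewrite indicE; case: (x \in _); last first.
    by under eq_integral do rewrite mul0r abse0; rewrite integral0 mul0e.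
  rewrite mul1e; apply: eq_integral => q _.
  by rewrite mul1r abse_EFin ger0_norm// heat_pot_ker_ge0.
under eq_integral => x _ do rewrite /= E.
exact: (integral_box_heat_pot _ _ mW W0 p1 t0 Wp).
Qed.

Let box_flux_integrable a b (A : set R) : measurable (A : set (measurableTypeR R)) ->
  A `<=` `]0, t]%classic -> (L3 R \x P)%E.-integrable setT
  (fun z : T3 * (measurableTypeR R * T3) =>
   (\1_(box a b) z.1 * (\1_A z.2.1 * flux z.2.1 z.1 z.2.2))%:E).
Proof.
move=> mA At; apply: le_integrable (dom_integrable a b) => //.
  apply/measurable_EFinP; apply: measurable_funM; last exact: mflux.
  have mI : measurable_fun setT (\1_(box a b) : T3 -> R).
    by apply: measurable_indic; exact: measurable_box.
  exact: measurableT_comp mI measurable_fst.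
move=> -[x q] _; rewrite /= lee_fin normrM [leRHS]normrM; apply: ler_wpM2l => //.
apply: (le_trans (flux_pot x q At)); exact: ler_norm.
Qed.

Let box_flux_integral a b (A : set R) : measurable (A : set (measurableTypeR R)) ->
  A `<=` `]0, t]%classic ->
  (\int[(L3 R \x P)%E]_z (\1_(box a b) z.1 * (\1_A z.2.1 * flux z.2.1 z.1 z.2.2))%:E =
   \int[L3 R]_x ((\1_(box a b) x)%:E * \int[mu \x L3 R]_q (\1_A q.1 * flux q.1 x q.2)%:E))%E.
Proof.
move=> mA At; have iF := box_flux_integrable a b mA At.
rewrite -(integral12_prod_meas1 iF) /fubini_F.
apply: eq_integral => x _; apply: etrans (integral_product_sfm mu (L3 R) _) _.
exact: integral_indicM.
Qed.

Let box_heatE a b s : 0 < s ->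
  (L3 R).-integrable setT (fun x => (\1_(box a b) x)%:E * heatE s x)%E /\
  (\int[L3 R]_x ((\1_(box a b) x)%:E * heatE s x) =
   \int[L3 R]_y ((phi y)%:E * box_mass (box a b) s y))%E.
Proof.
move=> s0.
have [iF FE] := box_mass_fubini (measurable_box a b) (box_fin a b) (@box_nrm2 R a b) iphi s0.
have E x : (\int[L3 R]_y (\1_(box a b) x * (phi y * heatH s x y))%:E =
    (\1_(box a b) x)%:E * heatE s x)%E by exact: integral_indicM.
split; last by rewrite -FE; apply: eq_integral => x _; rewrite E.
have := integrable_fubini_F iF; apply: eq_integrable => // x _.
by rewrite /fubini_F/= E.
Qed.

Let box_flux_cvg a b :
  (\int[(L3 R \x P)%E]_z (\1_(box a b) z.1 * (\1_(`[n.+1%:R^-1, t]) z.2.1 * flux z.2.1 z.1 z.2.2))%:E)%E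
    @[n --> \oo] -->
  (\int[(L3 R \x P)%E]_z (\1_(box a b) z.1 * (\1_(`]0, t]) z.2.1 * flux z.2.1 z.1 z.2.2))%:E)%E.
Proof.
have sub (n : nat) : `[n.+1%:R^-1, t]%classic `<=` `]0, t]%classic.
  move=> s; rewrite /= !in_itv/= => /andP[ns ->]; rewrite andbT.
  by apply: lt_le_trans ns; rewrite invr_gt0.
have [] // := @dominated_convergence _ _ _ (L3 R \x P)%E setT measurableT
  (fun n z => (\1_(box a b) z.1 * (\1_(`[n.+1%:R^-1, t]) z.2.1 * flux z.2.1 z.1 z.2.2))%:E)
  (fun z => (\1_(box a b) z.1 * (\1_(`]0, t]) z.2.1 * flux z.2.1 z.1 z.2.2))%:E)
  (fun z => (\1_(box a b) z.1 * heat_pot_ker t W z.1 z.2)%:E).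
- move=> n; apply: measurable_int; apply: box_flux_integrable => //; exact: measurable_itv.
- apply: measurable_int; apply: box_flux_integrable => //; exact: measurable_itv.
- apply: aeW => -[x [s y]] _ /=.
  apply: cvg_near_cst.
  have [s0|s0] := ltP 0 s; near=> n; congr (_%:E); congr (_ * (_ * _));
    rewrite !indicE !mem_setE !in_itv/=.
    rewrite s0 (_ : _ <= s)//; apply: ltW; near: n.
    exact: near_infty_natSinv_lt (PosNum s0).
  rewrite [0 < s]ltNge s0 (_ : _ <= s = false)//; apply/negbTE; rewrite -ltNge.
  by apply: (le_lt_trans s0); rewrite invr_gt0.
- apply: aeW => -[x q] n _; rewrite /= lee_fin normrM ger0_norm// ler_wpM2l//.
  exact: flux_pot.
Unshelve. all: by end_near. Qed.

Let heatE_fin s x : 0 < s -> heatE s x \is a fin_num.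
Proof. by move=> s0; apply: integrable_fin_num => //; exact: integrable_heat. Qed.

Let phi_box a b : (L3 R).-integrable setT (fun x => (phi x * \1_(box a b) x)%:E).
Proof.
apply: (gauss_integrable_dom (c := 1) (C := expR (nrm2 a + nrm2 b))) => // [|x].
  by apply: measurable_indic; exact: measurable_box.
rewrite -expRD indicE; case: (boolP (x \in _)) => [/set_mem/box_nrm2 h|_].
  by rewrite normr1 -[leLHS]expR0 ler_expR; lra.
by rewrite normr0 expR_ge0.
Qed.

Let box_balance a b :
  (\int[L3 R]_x ((\1_(box a b) x)%:E * heatE t x) -
   \int[L3 R]_x (phi x * \1_(box a b) x)%:E -
   \int[L3 R]_x ((\1_(box a b) x)%:E * N x) = 0)%E.
Proof.
have m0t : measurable (`]0, t]%classic : set (measurableTypeR R)) by exact: measurable_itv.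
have [iH HE] := box_heatE a b t0.
have e0 (n : nat) : 0 < n.+1%:R^-1 :> R by rewrite invr_gt0.
have fH : (\int[L3 R]_x ((\1_(box a b) x)%:E * heatE t x))%E \is a fin_num.
  exact: integrable_fin_num.
have fphi : (\int[L3 R]_x (phi x * \1_(box a b) x)%:E)%E \is a fin_num.
  by apply: integrable_fin_num => //; exact: phi_box.
have lim1 : (\int[L3 R]_x ((\1_(box a b) x)%:E * heatE t x) -
    \int[L3 R]_y ((phi y)%:E * box_mass (box a b) n.+1%:R^-1 y))%E @[n --> \oo] -->
    (\int[L3 R]_x ((\1_(box a b) x)%:E * heatE t x) -
     \int[L3 R]_y (phi y * \1_(box a b) y)%:E)%E.
  apply: cvgeB; [by rewrite fin_num_adde_defr|exact: cvg_cst|].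
  apply: (integral_box_mass_cvg (measurable_box a b) (box_fin a b) (@box_nrm2 R a b) iphi).
  exact: box_locally_cst.
have lim2 := @box_flux_cvg a b.
rewrite (box_flux_integral a b m0t (@subset_refl _ _)) in lim2.
have eqn : \forall n \near \oo,
    (\int[(L3 R \x P)%E]_z (\1_(box a b) z.1 * (\1_(`[n.+1%:R^-1, t]) z.2.1 * flux z.2.1 z.1 z.2.2))%:E =
    \int[L3 R]_x ((\1_(box a b) x)%:E * heatE t x) -
    \int[L3 R]_y ((phi y)%:E * box_mass (box a b) n.+1%:R^-1 y))%E.
  near=> n; have nt : n.+1%:R^-1 < t by near: n; exact: near_infty_natSinv_lt (PosNum t0).
  rewrite box_flux_integral; last 2 first.
  - exact: measurable_itv.
  - move=> s; rewrite /= !in_itv/= => /andP[ns ->]; rewrite andbT.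
    exact: lt_le_trans ns.
  have [iHn HnE] := box_heatE a b (e0 n).
  rewrite -HnE; apply: (etrans _ (integralB measurableT iH iHn)).
  apply: eq_integral => x _.
  have hd := heat_diff iphi mb1 mb2 mb3 iW W0 bW weak x (e0 n) nt.
  apply: (etrans (congr1 (fun z => (\1_(box a b) x)%:E * z)%E (esym hd))).
  exact: muleB_fin (heatE_fin _ (e0 n)).
by apply: (cvg_eq_sub0 eqn lim2 lim1); rewrite fin_numB fH fphi.
Unshelve. all: by end_near. Qed.

Lemma heat_representation :
  {ae L3 R, forall x, (`| \int[L3 R]_y (phi y * heatH t x y)%:E - (phi x)%:E | <= heat_pot t W x)%E}.
Proof.
have m0t : measurable (`]0, t]%classic : set (measurableTypeR R)) by exact: measurable_itv.
pose u x := (heatE t x - (phi x)%:E - N x)%E.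
have mphiE : measurable_fun setT (EFin \o phi) by exact/measurable_EFinP.
have iphibox a b : (L3 R).-integrable (box a b) (EFin \o phi).
  apply/(integrable_mkcond _ (measurable_box a b)); rewrite restrict_indic.
  by under eq_fun do rewrite /= -EFinM mulrC; exact: phi_box.
have ibox a b : [/\ (L3 R).-integrable (box a b) (heatE t),
    (L3 R).-integrable (box a b) (EFin \o phi) & (L3 R).-integrable (box a b) N].
  have mQ := measurable_box a b.
  split=> //.
    by apply/(integrable_mkcond _ mQ); rewrite restrict_indic; have [] := box_heatE a b t0.
  apply/(integrable_mkcond _ mQ); rewrite restrict_indic.
  have := integrable_fubini_F (box_flux_integrable a b m0t (@subset_refl _ _)).
  apply: eq_integrable => // x _; apply: etrans (integral_product_sfm mu (L3 R) _) _.
  exact: integral_indicM.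
have u0 : {ae L3 R, forall x, u x = 0%E}.
  apply: ae_eq0_boxes => [|a b|a b].
  - by apply: emeasurable_funB => //; apply: emeasurable_funB.
  - have [i1 i2 i3] := ibox a b; apply: integrableB => //; first exact: measurable_box.
    by apply: integrableB => //; exact: measurable_box.
  - have [i1 i2 i3] := ibox a b; have mQ := measurable_box a b.
    have i12 := integrableB mQ i1 i2.
    apply: (etrans (integralB mQ i12 i3)).
    apply: (etrans (congr1 (fun z => z - _)%E (integralB mQ i1 i2))).
    rewrite !(integral_mkcond (box a b)) !restrict_indic.
    by under [X in (_ - X - _)%E]eq_integral do rewrite /= -EFinM mulrC; exact: box_balance.
apply: filterS u0 => x ux.
have -> : (heatE t x - (phi x)%:E = N x)%E.
  by apply: sube_eq0_fin ux; rewrite fin_numB heatE_fin.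
rewrite /N /heat_pot.
apply: (le_trans (le_abse_integral _ _ _)) => //.
  apply/measurable_EFinP.
  have := mflux m0t => h; exact: measurableT_comp h (pair1_measurable x).
apply: ge0_le_integral => //.
- apply/measurable_EFinP; apply: measurableT_comp => //.
  have := mflux m0t => h; exact: measurableT_comp h (pair1_measurable x).
- by apply/measurable_EFinP; exact: measurable_heat_pot_kerx.
- by move=> q _; rewrite lee_fin; exact: flux_pot.
Qed.

End representation.

(** * Cutoffs and tensor test functions *)

Section smooth_functions.
Context {R : realType}.
Implicit Types (f g : R -> R) (x : R) (k n : nat).

Fixpoint smooth_upto k f : Prop :=
  if k is k'.+1 then (forall x, derivable f x 1) /\ smooth_upto k' (derive1 f)
  else continuous f.

Definition smooth f := forall k, smooth_upto k f.

Lemma derive1_is_derive f (f' : R -> R) : (forall x, is_derive x 1 f (f' x)) -> derive1 f = f'.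
Proof. by move=> h; apply/funext => x; rewrite derive1E; have := h x => hx; rewrite derive_val. Qed.

Lemma smooth_uptoS k f (f' : R -> R) : (forall x, is_derive x 1 f (f' x)) ->
  smooth_upto k f' -> smooth_upto k.+1 f.
Proof. by move=> h sf; split; [move=> x; case: (h x)|rewrite (derive1_is_derive h)]. Qed.

Lemma smooth_uptoD1 k f x : smooth_upto k.+1 f -> is_derive x 1 f (derive1 f x).
Proof. by move=> [/(_ x) h _]; rewrite derive1E; exact/derivableP. Qed.

Lemma smooth_uptoW k f : smooth_upto k.+1 f -> smooth_upto k f.
Proof.
elim: k f => [|k IH] f [df sf]; first by move=> x; exact: derivable_continuous_at.
by split=> //; exact: IH.
Qed.

Lemma smooth_upto_cst k (c : R) : smooth_upto k (cst c).
Proof.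
elim: k c => [|k IH] c; first by move=> x; exact: cst_continuous.
by apply: (@smooth_uptoS _ _ (cst 0)).
Qed.

Lemma smooth_upto_id k : smooth_upto k (fun x => x).
Proof.
case: k => [|k]; first by move=> x; exact: cvg_id.
exact: (@smooth_uptoS _ _ (cst 1) _ (smooth_upto_cst k 1)).
Qed.

Lemma smooth_upto_add k f g : smooth_upto k f -> smooth_upto k g ->
  smooth_upto k (fun x => f x + g x).
Proof.
elim: k f g => [|k IH] f g sf sg; first by move=> x; apply: cvgD; [exact: sf|exact: sg].
apply: (@smooth_uptoS k (fun x => f x + g x) (fun x => derive1 f x + derive1 g x)).
  by move=> x; apply: is_derive_add; exact: (@smooth_uptoD1 k).
by apply: IH; [case: sf|case: sg].
Qed.

Lemma smooth_upto_mul k f g : smooth_upto k f -> smooth_upto k g ->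
  smooth_upto k (fun x => f x * g x).
Proof.
elim: k f g => [|k IH] f g sf sg; first by move=> x; apply: cvgM; [exact: sf|exact: sg].
apply: (@smooth_uptoS k (fun x => f x * g x) (fun x => derive1 f x * g x + f x * derive1 g x)).
  by move=> x; apply: is_derive_mul; exact: (@smooth_uptoD1 k).
by apply: smooth_upto_add; apply: IH; try exact: smooth_uptoW; [case: sf|case: sg].
Qed.

Lemma smooth_upto_comp k f g : smooth_upto k f -> smooth_upto k g ->
  smooth_upto k (fun x => f (g x)).
Proof.
elim: k f g => [|k IH] f g sf sg.
  by move=> x; apply: (@continuous_comp _ _ _ g f); [exact: sg|exact: sf].
apply: (@smooth_uptoS k (fun x => f (g x)) (fun x => derive1 g x * derive1 f (g x))).
  move=> x; have hf := @smooth_uptoD1 k f (g x) sf; have hg := @smooth_uptoD1 k g x sg.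
  by have := is_derive1_comp hf hg; rewrite mulrC.
apply: smooth_upto_mul; first by case: sg.
by apply: IH; [case: sf|exact: smooth_uptoW].
Qed.

Lemma smooth_upto_expR k : smooth_upto k expR.
Proof.
elim: k => [|k IH]; first exact: continuous_expR.
exact: (@smooth_uptoS _ _ expR).
Qed.

Lemma smooth_mul f g : smooth f -> smooth g -> smooth (fun x => f x * g x).
Proof. by move=> sf sg k; exact: smooth_upto_mul. Qed.

Lemma smooth_comp f g : smooth f -> smooth g -> smooth (fun x => f (g x)).
Proof. by move=> sf sg k; exact: smooth_upto_comp. Qed.

Lemma smooth_affine (a b : R) : smooth (fun x => a * x + b).
Proof.
move=> k; apply: smooth_upto_add; last exact: smooth_upto_cst.
by apply: smooth_upto_mul; [exact: smooth_upto_cst|exact: smooth_upto_id].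
Qed.

Lemma smooth_derive1 f : smooth f -> smooth (derive1 f).
Proof. by move=> sf k; case: (sf k.+1). Qed.

Lemma smooth_is_derive f x : smooth f -> is_derive x 1 f (derive1 f x).
Proof. by move=> /(_ 1%N); exact: smooth_uptoD1. Qed.

Lemma smooth_continuous f : smooth f -> continuous f.
Proof. by move=> /(_ 0%N). Qed.

Definition exp_inv n x : R := if 0 < x then x^-1 ^+ n * expR (- x^-1) else 0.

Lemma exp_inv_bound n x : 0 < x -> exp_inv n x <= ((n.+2)`!)%:R * x ^+ 2.
Proof.
move=> x0; rewrite /exp_inv x0 expRN ler_pdivrMr ?expR_gt0//.
have u0 : 0 < x^-1 by rewrite invr_gt0.
have := @expR_ge1Dxn R x^-1 n.+1 (ltW u0).
set F := _`!%:R; set E := expR _ => h.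
have F0 : 0 < F :> R by rewrite ltr0n fact_gt0.
have : x^-1 ^+ n.+2 <= F * E.
  rewrite -ler_pdivrMl// mulrC; apply: le_trans h; rewrite lerDr//.
rewrite -mulrA mulrCA => h2.
have -> : x^-1 ^+ n = x ^+ 2 * x^-1 ^+ n.+2.
  by rewrite !exprS mulrA mulrA; field; rewrite gt_eqF.
by rewrite ler_wpM2l// sqr_ge0.
Qed.

Lemma exp_inv_ge0 n x : 0 <= exp_inv n x.
Proof. by rewrite /exp_inv; case: ifP => // x0; rewrite mulr_ge0 ?expR_ge0// exprn_ge0// invr_ge0 ltW. Qed.

Lemma is_derive_exp_inv n x : is_derive x 1 (exp_inv n)
  (- n%:R * exp_inv n.+1 x + exp_inv n.+2 x).
Proof.
have [x0|x0|x0] := ltgtP 0 x.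
- have xn0 : x != 0 by rewrite gt_eqF.
  have di := is_derive_invx xn0.
  have dN : is_derive x 1 (fun y : R => - y^-1) (x^-1 ^+ 2).
    have := is_derive_mulc (-1) di; rewrite mulN1r opprK.
    by congr (is_derive _ _ _ _); apply/funext => y; rewrite mulN1r.
  have := is_derive_mul (is_derive_pow n di) (is_derive_exp dN).
  rewrite {2 3}/exp_inv x0.
  have -> : n%:R * x^-1 ^+ n.-1 * - x^-1 ^+ 2 * expR (- x^-1) +
     x^-1 ^+ n * (x^-1 ^+ 2 * expR (- x^-1)) =
     - n%:R * (x^-1 ^+ n.+1 * expR (- x^-1)) + x^-1 ^+ n.+2 * expR (- x^-1).
    case: n => [|n]; first by rewrite !mul0r oppr0 !mul0r; ring.
    by rewrite succnK !exprS; move: (x^-1) (expR _) (n.+1%:R) => i E N; ring.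
  apply: near_eq_is_derive; near=> y; rewrite /exp_inv ifT//.
  by near: y; exact: lt_nbhsr.
- rewrite /exp_inv !(ltNge 0 x) (ltW x0) /= mulr0 addr0.
  apply: (@near_eq_is_derive _ _ _ (cst 0)).
  near=> y; rewrite /exp_inv ifF//; apply/negbTE; rewrite -leNgt ltW//.
  by near: y; exact: lt_nbhsl.
- rewrite -x0 /exp_inv ltxx mulr0 addr0 -/(exp_inv n).
  have cv : (fun h : R => h^-1 *: (exp_inv n (h *: 1 + 0) - exp_inv n 0)) @ 0^' --> (0 : R).
    pose C : R := ((n.+2)`!)%:R.
    have C0 : 0 < C by rewrite ltr0n fact_gt0.
    apply/cvgr0Pnorm_le => e e0; near=> h.
    have h0 : h != 0 by near: h; exact: nbhs_dnbhs_neq.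
    rewrite addr0 {2}/exp_inv ltxx subr0 /GRing.scale/= mulr1.
    rewrite normrM (ger0_norm (exp_inv_ge0 _ _)) normfV.
    have [hp|hn] := ltP 0 h; last first.
      by rewrite /exp_inv ltNge hn/= mulr0 ltW.
    rewrite (gtr0_norm hp) mulrC ler_pdivrMr//.
    apply: (le_trans (exp_inv_bound n hp)).
    rewrite expr2 mulrA ler_wpM2r ?(ltW hp)//.
    rewrite -/C -ler_pdivlMl// mulrC.
    have : `|h| < e / C.
      near: h; apply: dnbhs0_lt; exact: divr_gt0.
    by rewrite (gtr0_norm hp) => /ltW.
  have df : derivable (exp_inv n) 0 1 by apply/cvg_ex; exists 0.
  have E : 'D_1 (exp_inv n) 0 = 0 :> R by exact/cvg_lim.
  by have := derivableP df; rewrite E.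
Unshelve. all: by end_near. Qed.

Lemma smooth_exp_inv n : smooth (exp_inv n).
Proof.
move=> k; elim: k n => [|k IH] n.
  by move=> x; apply: derivable_continuous_at; case: (is_derive_exp_inv n x).
apply: (@smooth_uptoS _ _ (fun x => - n%:R * exp_inv n.+1 x + exp_inv n.+2 x)).
  exact: is_derive_exp_inv.
apply: smooth_upto_add; last exact: IH.
by apply: smooth_upto_mul; [exact: smooth_upto_cst|exact: IH].
Qed.

Definition bump x : R := expR 2 * (exp_inv 0 (- 1 * x + 1) * exp_inv 0 (1 * x + 1)).

Lemma bump0 : bump 0 = 1.
Proof.
rewrite /bump !mulr0 add0r /exp_inv ltr01 !expr0 !mul1r invr1 -!expRD.
by rewrite (_ : 2 + _ = 0) ?expR0//; ring.
Qed.

Lemma bump_out x : 1 <= `|x| -> bump x = 0.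
Proof.
rewrite ler_normr => /orP[x1|x1]; rewrite /bump /exp_inv.
  by rewrite [X in if X then _ else _]ltNge (_ : - 1 * x + 1 <= 0) ?mul0r ?mulr0//; lra.
by rewrite [X in _ * (_ * (if X then _ else _))]ltNge (_ : 1 * x + 1 <= 0) ?mulr0//; lra.
Qed.

Lemma smooth_bump : smooth bump.
Proof.
apply: smooth_mul; first by move=> k; exact: smooth_upto_cst.
by apply: smooth_mul; apply: smooth_comp; [exact: smooth_exp_inv|exact: smooth_affine|
  exact: smooth_exp_inv|exact: smooth_affine].
Qed.

Lemma derive1_out f (r : R) : (forall x, r < `|x| -> f x = 0) ->
  forall x, r < `|x| -> derive1 f x = 0.
Proof.
move=> h x rx; rewrite derive1E (@near_eq_derive _ _ _ f (cst 0)) ?derive_cst//.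
near=> y; apply: h; near: y.
have : {for x, continuous (@Num.norm _ R)} by exact: norm_continuous.
move=> /(_ [set z | r < z]) /=; apply.
exact: lt_nbhsr.
Unshelve. all: by end_near. Qed.

Lemma continuous_out_bounded f (r : R) : continuous f -> (forall x, r < `|x| -> f x = 0) ->
  exists2 M : R, 0 <= M & forall x, `|f x| <= M.
Proof.
move=> cf h.
have cN : {within `[- `|r|, `|r|], continuous (fun x => `|f x|)}.
  apply: continuous_subspaceT => x; apply: (@continuous_comp _ _ _ f (@Num.norm _ R)); first exact: cf.
  exact: norm_continuous.
have rr : - `|r| <= `|r| by rewrite (@le_trans _ _ 0)// oppr_le0.
have [c _ hc] := EVT_max rr cN.
exists `|f c| => // x; have [xr|rx] := leP `|x| `|r|.
  by apply: hc; rewrite in_itv/= -ler_norml.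
by rewrite h ?normr0//; apply: le_lt_trans rx; exact: ler_norm.
Qed.

End smooth_functions.

Section cutoff.
Context {R : realType}.
Implicit Types (y : R) (n : nat).

Definition compact_supp (f : R -> R) := exists r : R, forall x, r < `|x| -> f x = 0.

Section one_dimension.
Variables (c s : R).
Hypothesis s0 : 0 < s.

Definition gauss1 y : R := expR (- (c - y) ^+ 2 / (2 * s ^+ 2)).
Definition gauss1' y : R := (c - y) / s ^+ 2 * gauss1 y.
Definition gauss1'' y : R := ((c - y) ^+ 2 / s ^+ 4 - 1 / s ^+ 2) * gauss1 y.

Let sn0 : s != 0. Proof. by rewrite gt_eqF. Qed.

Lemma smooth_gauss1 : smooth gauss1.
Proof.
have -> : gauss1 = fun y => expR ((- (2 * s ^+ 2)^-1) * ((-1 * y + c) * (-1 * y + c)) + 0).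
  apply/funext => y; rewrite /gauss1; congr expR; by field.
apply: (@smooth_comp _ expR (fun y => (- (2 * s ^+ 2)^-1) * ((-1 * y + c) * (-1 * y + c)) + 0)).
  by move=> k; exact: smooth_upto_expR.
apply: (@smooth_comp _ (fun z => (- (2 * s ^+ 2)^-1) * z + 0)); first exact: smooth_affine.
by apply: smooth_mul; exact: smooth_affine.
Qed.

Let is_derive_lin y : is_derive y 1 (fun y => c - y) (- 1).
Proof.
have h := is_derive_add (is_derive_cst c y 1) (is_derive_mulc (- 1) (is_derive_id1 y)).
rewrite add0r mulr1 in h.
by rewrite (_ : (fun y => c - y) = (fun y => cst c y + -1 * y))//; apply/funext => z; rewrite mulN1r.
Qed.

Lemma is_derive_gauss1 y : is_derive y 1 gauss1 (gauss1' y).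
Proof.
have := is_derive_exp (is_derive_mulc (- (2 * s ^+ 2)^-1) (is_derive_pow 2 (is_derive_lin y))).
have -> : (fun z => expR (- (2 * s ^+ 2)^-1 * (c - z) ^+ 2)) = gauss1.
  by apply/funext => z; rewrite /gauss1; congr expR; field.
have -> : - (2 * s ^+ 2)^-1 * (2%:R * (c - y) ^+ 2.-1 * -1) *
    expR (- (2 * s ^+ 2)^-1 * (c - y) ^+ 2) = gauss1' y.
  rewrite /gauss1' /gauss1 (_ : - (2 * s ^+ 2)^-1 * (c - y) ^+ 2 = - (c - y) ^+ 2 / (2 * s ^+ 2)).
    by move: (expR _) => E; rewrite /=; field.
  by field.
by [].
Qed.

Lemma is_derive_gauss1' y : is_derive y 1 gauss1' (gauss1'' y).
Proof.
have := is_derive_mul (is_derive_mulc (s ^+ 2)^-1 (is_derive_lin y)) (is_derive_gauss1 y).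
have -> : (fun z => (s ^+ 2)^-1 * (c - z) * gauss1 z) = gauss1'.
  by apply/funext => z; rewrite /gauss1' [_^-1 * _]mulrC.
have -> : (s ^+ 2)^-1 * -1 * gauss1 y + (s ^+ 2)^-1 * (c - y) * gauss1' y = gauss1'' y.
  by rewrite /gauss1' /gauss1''; move: (gauss1 y) => E; field.
by [].
Qed.

Lemma gauss1_bound : exists C : R, 0 <= C /\ forall y,
  [/\ `|gauss1 y| <= C * expR (- (8 * s ^+ 2)^-1 * y ^+ 2),
      `|gauss1' y| <= C * expR (- (8 * s ^+ 2)^-1 * y ^+ 2) &
      `|gauss1'' y| <= C * expR (- (8 * s ^+ 2)^-1 * y ^+ 2)].
Proof.
pose B : R := 4 * (1 + s^-1 + (s ^+ 2)^-1).
pose C := B * expR (c ^+ 2 / (4 * s ^+ 2)).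
have si : 0 < s^-1 by rewrite invr_gt0.
have s2i : 0 < (s ^+ 2)^-1 by rewrite invr_gt0 exprn_gt0.
exists C; split; first by rewrite mulr_ge0 ?expR_ge0// mulr_ge0// !addr_ge0// ltW.
move=> y; pose u := (c - y) ^+ 2 / s ^+ 2.
have u0 : 0 <= u by rewrite mulr_ge0 ?sqr_ge0// ltW.
have gE : gauss1 y = expR (- (u / 2)) by rewrite /gauss1 /u; congr expR; field.
have g0 : 0 <= gauss1 y by rewrite expR_ge0.
have key : (1 + u) * gauss1 y <= 4 * (expR (c ^+ 2 / (4 * s ^+ 2)) * expR (- (8 * s ^+ 2)^-1 * y ^+ 2)).
  have h1 : (1 + u) * expR (- (u / 2)) <= 4 * expR (- (u / 4)).
    rewrite (_ : - (u / 2) = - (u / 4) + - (u / 4)); last by field.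
    rewrite expRD mulrA; apply: ler_wpM2r; first exact: expR_ge0.
    rewrite expRN ler_pdivrMr ?expR_gt0//; have := expR_ge1Dx (u / 4); lra.
  rewrite gE; apply: (le_trans h1); rewrite -expRD ler_pM2l// ler_expR.
  have -> : - (u / 4) = (4 * s ^+ 2)^-1 * - (c - y) ^+ 2 by rewrite /u; field.
  have -> : c ^+ 2 / (4 * s ^+ 2) + - (8 * s ^+ 2)^-1 * y ^+ 2 =
     (4 * s ^+ 2)^-1 * (c ^+ 2 - y ^+ 2 / 2) by field.
  apply: ler_wpM2l; first by rewrite invr_ge0 mulr_ge0// sqr_ge0.
  have := sqr_ge0 (2 * c - y); nra.
set E := expR _ in key; set F := expR _ in key *.
have EF0 : 0 <= E * F by rewrite mulr_ge0 ?expR_ge0.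
have fin (k : R) : 0 <= k -> k <= 1 + s^-1 + (s ^+ 2)^-1 ->
    k * ((1 + u) * gauss1 y) <= C * F.
  move=> k0 kB; apply: (le_trans (ler_wpM2l k0 key)).
  have -> : C * F = (1 + s^-1 + (s ^+ 2)^-1) * (4 * (E * F)) by rewrite /C /B -/E; ring.
  by apply: ler_wpM2r => //; rewrite mulr_ge0.
split.
- rewrite (ger0_norm g0); apply: le_trans (fin 1 ler01 _); last by rewrite -addrA lerDl addr_ge0 ?ltW.
  by rewrite mul1r ler_peMl// lerDl.
- apply: le_trans (fin s^-1 (ltW si) _); last by rewrite addrAC lerDr addr_ge0 ?ltW.
  rewrite /gauss1' normrM (ger0_norm g0) mulrA; apply: ler_wpM2r => //.
  have -> : (c - y) / s ^+ 2 = s^-1 * ((c - y) / s) by field.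
  rewrite normrM (gtr0_norm si); apply: ler_wpM2l; first exact: ltW.
  have : `|(c - y) / s| ^+ 2 = u by rewrite real_normK ?num_real// exprMn exprVn.
  have := normr_ge0 ((c - y) / s); move: (`| _ |) => w w0 <-; nra.
- apply: le_trans (fin (s ^+ 2)^-1 (ltW s2i) _); last by rewrite lerDr addr_ge0 ?ltW.
  rewrite /gauss1'' normrM (ger0_norm g0) mulrA; apply: ler_wpM2r => //.
  have -> : (c - y) ^+ 2 / s ^+ 4 - 1 / s ^+ 2 = (s ^+ 2)^-1 * (u - 1) by rewrite /u; field.
  rewrite normrM (gtr0_norm s2i); apply: ler_wpM2l; first exact: ltW.
  by rewrite ler_norml; apply/andP; split; lra.
Qed.

Definition cut n y : R := bump (n.+1%:R^-1 * y + 0) * gauss1 y.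

Let bump' : R -> R := derive1 bump.
Let bump'' : R -> R := derive1 bump'.

Lemma smooth_cut n : smooth (cut n).
Proof.
apply: smooth_mul; last exact: smooth_gauss1.
by apply: smooth_comp; [exact: smooth_bump|exact: smooth_affine].
Qed.

Lemma cut_supp n : compact_supp (cut n).
Proof.
exists n.+1%:R => x nx; rewrite /cut bump_out ?mul0r// addr0 normrM gtr0_norm ?invr_gt0//.
by rewrite mulrC ler_pdivlMr// mul1r ltW.
Qed.

Let is_derive_scale (f : R -> R) (i : R) y : smooth f ->
  is_derive y 1 (fun y => f (i * y + 0)) (i * derive1 f (i * y + 0)).
Proof.
move=> sf.
have h2 : is_derive y 1 (fun y => i * y + 0) i.
  have := is_derive_add (is_derive_mulc i (is_derive_id1 y)) (is_derive_cst 0 y 1).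
  by rewrite addr0 mulr1.
by have := @is_derive1_comp R f (fun z => i * z + 0) y _ _ (smooth_is_derive (i * y + 0) sf) h2; rewrite mulrC.
Qed.

Lemma derive1_cut n : derive1 (cut n) = fun y =>
  n.+1%:R^-1 * bump' (n.+1%:R^-1 * y + 0) * gauss1 y + bump (n.+1%:R^-1 * y + 0) * gauss1' y.
Proof.
apply: derive1_is_derive => y; apply: is_derive_mul; last exact: is_derive_gauss1.
exact: is_derive_scale smooth_bump.
Qed.

Lemma derive1_cut2 n : derive1 (derive1 (cut n)) = fun y =>
  (n.+1%:R^-1 * (n.+1%:R^-1 * bump'' (n.+1%:R^-1 * y + 0)) * gauss1 y +
  n.+1%:R^-1 * bump' (n.+1%:R^-1 * y + 0) * gauss1' y) +
  (n.+1%:R^-1 * bump' (n.+1%:R^-1 * y + 0) * gauss1' y + bump (n.+1%:R^-1 * y + 0) * gauss1'' y).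
Proof.
rewrite derive1_cut; apply: derive1_is_derive => y.
have sb' : smooth bump' := smooth_derive1 smooth_bump.
apply: is_derive_add; apply: is_derive_mul.
- apply: is_derive_mulc; exact: is_derive_scale.
- exact: is_derive_gauss1.
- exact: is_derive_scale smooth_bump.
- exact: is_derive_gauss1'.
Qed.

Let bump_bounded : exists M : R, 0 <= M /\ forall y,
  [/\ `|bump y| <= M, `|bump' y| <= M & `|bump'' y| <= M].
Proof.
have out0 x : 1 < `|x| -> bump x = 0 :> R by move=> /ltW; exact: bump_out.
have sb' : smooth bump' := smooth_derive1 smooth_bump.
have sb'' : smooth bump'' := smooth_derive1 sb'.
have [M0 M00 h0] := continuous_out_bounded (smooth_continuous smooth_bump) out0.
have [M1 M10 h1] := continuous_out_bounded (smooth_continuous sb') (derive1_out out0).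
have [M2 M20 h2] := continuous_out_bounded (smooth_continuous sb'') (derive1_out (derive1_out out0)).
exists (M0 + M1 + M2); split; first by rewrite !addr_ge0.
move=> y; split.
- by apply: (le_trans (h0 y)); rewrite -addrA lerDl addr_ge0.
- by apply: (le_trans (h1 y)); rewrite addrAC lerDr addr_ge0.
- by apply: (le_trans (h2 y)); rewrite lerDr addr_ge0.
Qed.

Lemma cut_bound : exists C : R, 0 <= C /\ forall n y,
  [/\ `|cut n y| <= C * expR (- (8 * s ^+ 2)^-1 * y ^+ 2),
      `|derive1 (cut n) y| <= C * expR (- (8 * s ^+ 2)^-1 * y ^+ 2) &
      `|derive1 (derive1 (cut n)) y| <= C * expR (- (8 * s ^+ 2)^-1 * y ^+ 2)].
Proof.
have [C [C0 hC]] := gauss1_bound; have [M [M0 hM]] := bump_bounded.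
exists (4 * (M * C)); split; first by rewrite !mulr_ge0.
move=> n y; have [g0 g1 g2] := hC y.
pose i : R := n.+1%:R^-1; have i0 : 0 <= i by rewrite invr_ge0.
have i1 : i <= 1 by rewrite invf_le1// ler1n.
have [b0 b1 b2] := hM (i * y + 0).
set E := expR _ in g0 g1 g2 *.
have E0 : 0 <= C * E by rewrite mulr_ge0 ?expR_ge0.
have -> : 4 * (M * C) * E = 4 * (M * (C * E)) by ring.
set K := C * E in g0 g1 g2 E0 *.
have MK0 : 0 <= M * K by rewrite mulr_ge0.
have m0 (p q : R) : `|p| <= M -> `|q| <= K -> `|p * q| <= M * K.
  by move=> hp hq; rewrite normrM; apply: ler_pM.
have m1 (p q : R) : `|p| <= M -> `|q| <= K -> `|i * p * q| <= M * K.
  move=> hp hq; apply: m0 => //; rewrite normrM (ger0_norm i0).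
  by rewrite (le_trans _ hp)// ler_piMl.
have m2 (p q : R) : `|p| <= M -> `|q| <= K -> `|i * (i * p) * q| <= M * K.
  move=> hp hq; apply: m1 => //; rewrite normrM (ger0_norm i0).
  by rewrite (le_trans _ hp)// ler_piMl.
split.
- by apply: (le_trans (m0 _ _ b0 g0)); lra.
- rewrite derive1_cut; apply: (le_trans (ler_normD _ _)).
  by have := m1 _ _ b1 g0; have := m0 _ _ b0 g1; rewrite -/i; lra.
- rewrite derive1_cut2; apply: (le_trans (ler_normD _ _)).
  apply: (le_trans (lerD (ler_normD _ _) (ler_normD _ _))).
  by have := m2 _ _ b2 g0; have := m1 _ _ b1 g1; have := m0 _ _ b0 g2; rewrite -/i; lra.
Qed.

Let derive1_cutE y : (fun n => derive1 (cut n) y) = fun n =>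
  n.+1%:R^-1 * bump' (n.+1%:R^-1 * y + 0) * gauss1 y + bump (n.+1%:R^-1 * y + 0) * gauss1' y.
Proof. by apply/funext => n; rewrite derive1_cut. Qed.

Let derive1_cut2E y : (fun n => derive1 (derive1 (cut n)) y) = fun n =>
  (n.+1%:R^-1 * (n.+1%:R^-1 * bump'' (n.+1%:R^-1 * y + 0)) * gauss1 y +
  n.+1%:R^-1 * bump' (n.+1%:R^-1 * y + 0) * gauss1' y) +
  (n.+1%:R^-1 * bump' (n.+1%:R^-1 * y + 0) * gauss1' y + bump (n.+1%:R^-1 * y + 0) * gauss1'' y).
Proof. by apply/funext => n; rewrite derive1_cut2. Qed.

Lemma cut_cvg y : [/\ cut n y @[n --> \oo] --> gauss1 y,
  derive1 (cut n) y @[n --> \oo] --> gauss1' y &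
  derive1 (derive1 (cut n)) y @[n --> \oo] --> gauss1'' y].
Proof.
have ci : n.+1%:R^-1 @[n --> \oo] --> (0 : R) by exact: cvg_harmonic.
have ciy : (n.+1%:R^-1 * y + 0) @[n --> \oo] --> (0 : R).
  by rewrite -[X in _ --> X](addr0 0); apply: cvgD; [rewrite -(mul0r y); exact: cvgMl|exact: cvg_cst].
have comp (f : R -> R) : continuous f -> f (n.+1%:R^-1 * y + 0) @[n --> \oo] --> f 0.
  by move=> cf; apply: continuous_cvg => //; exact: cf.
have sb' : smooth bump' := smooth_derive1 smooth_bump.
have c0 := comp _ (smooth_continuous smooth_bump).
have c1 := comp _ (smooth_continuous sb').
have c2 := comp _ (smooth_continuous (smooth_derive1 sb')).
rewrite bump0 in c0.
have ccst (z : R) : (z : R) @[n --> \oo] --> z by exact: cvg_cst.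
split.
- rewrite -[gauss1 y]mul1r; exact: cvgM c0 (ccst (gauss1 y)).
- rewrite (_ : gauss1' y = 0 * bump' 0 * gauss1 y + 1 * gauss1' y); last by rewrite !mul0r add0r mul1r.
  rewrite derive1_cutE; exact: cvgD (cvgM (cvgM ci c1) (ccst (gauss1 y))) (cvgM c0 (ccst (gauss1' y))).
- rewrite (_ : gauss1'' y = (0 * (0 * bump'' 0) * gauss1 y + 0 * bump' 0 * gauss1' y) +
    (0 * bump' 0 * gauss1' y + 1 * gauss1'' y)); last by rewrite !mul0r !add0r mul1r.
  rewrite derive1_cut2E.
  exact: cvgD (cvgD (cvgM (cvgM ci (cvgM ci c2)) (ccst (gauss1 y))) (cvgM (cvgM ci c1) (ccst (gauss1' y))))
    (cvgD (cvgM (cvgM ci c1) (ccst (gauss1' y))) (cvgM c0 (ccst (gauss1'' y)))).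
Qed.

End one_dimension.

End cutoff.

Section tensors.
Context {R : realType}.
Local Notation T3 := (R3 (measurableTypeR R)).
Implicit Types (a b c : R -> R) (x y : T3) (phi : T3 -> R).

Definition tens a b c y : R := a y.1.1 * b y.1.2 * c y.2.

Definition lap_tens a b c y : R := tens (derive1 (derive1 a)) b c y +
  tens a (derive1 (derive1 b)) c y + tens a b (derive1 (derive1 c)) y.

Definition div_tens (b1 b2 b3 : T3 -> R) a b c y : R := b1 y * tens (derive1 a) b c y +
  b2 y * tens a (derive1 b) c y + b3 y * tens a b (derive1 c) y.

Definition weak_lap phi (b1 b2 b3 : T3 -> R) := forall a b c,
  [/\ smooth a, smooth b & smooth c] ->
  [/\ compact_supp a, compact_supp b & compact_supp c] ->
  (\int[L3 R]_y (phi y * lap_tens a b c y)%:E = \int[L3 R]_y (div_tens b1 b2 b3 a b c y)%:E)%E.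

Lemma measurable_tens a b c : continuous a -> continuous b -> continuous c ->
  measurable_fun setT (tens a b c : T3 -> R).
Proof.
move=> /continuous_measurable_fun ma /continuous_measurable_fun mb /continuous_measurable_fun mc.
apply: measurable_funM; first apply: measurable_funM.
- exact: measurableT_comp ma measurable_coord1.
- exact: measurableT_comp mb measurable_coord2.
- exact: measurableT_comp mc measurable_coord3.
Qed.

Lemma tens_le a b c (A B C k : R) y :
  (forall z, `|a z| <= A * expR (- k * z ^+ 2)) ->
  (forall z, `|b z| <= B * expR (- k * z ^+ 2)) ->
  (forall z, `|c z| <= C * expR (- k * z ^+ 2)) ->
  `|tens a b c y| <= A * B * C * expR (- k * nrm2 y).
Proof.
move=> ha hb hc; rewrite /tens !normrM.
have -> : A * B * C * expR (- k * nrm2 y) = (A * expR (- k * y.1.1 ^+ 2)) *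
    (B * expR (- k * y.1.2 ^+ 2)) * (C * expR (- k * y.2 ^+ 2)).
  by rewrite /nrm2 !mulrDr !expRD; move: (expR _) (expR _) (expR _) => u v w; ring.
by apply: ler_pM; rewrite ?mulr_ge0//; apply: ler_pM.
Qed.

Lemma tens_cvg (a b c : nat -> R -> R) (a' b' c' : R -> R) y :
  (forall z, a n z @[n --> \oo] --> a' z) ->
  (forall z, b n z @[n --> \oo] --> b' z) ->
  (forall z, c n z @[n --> \oo] --> c' z) ->
  tens (a n) (b n) (c n) y @[n --> \oo] --> tens a' b' c' y.
Proof. by move=> ha hb hc; apply: cvgM; [apply: cvgM; [exact: ha|exact: hb]|exact: hc]. Qed.

Lemma gauss_dct (H : T3 -> R) (F_ : nat -> T3 -> R) (F : T3 -> R) k : gauss_integrable H -> 0 < k ->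
  (forall n, measurable_fun setT (F_ n)) ->
  (forall n y, `|F_ n y| <= H y * expR (- k * nrm2 y)) ->
  (forall y, F_ n y @[n --> \oo] --> F y) ->
  (L3 R).-integrable setT (fun y => (F y)%:E) /\
  ((\int[L3 R]_y (F_ n y)%:E)%E @[n --> \oo] --> (\int[L3 R]_y (F y)%:E)%E).
Proof.
move=> iH k0 mF bF cF.
have mE n : measurable_fun setT (fun y : T3 => (F_ n y)%:E) by apply/measurable_EFinP.
have cE y : (F_ n y)%:E @[n --> \oo] --> (F y)%:E.
  by apply: cvg_EFin; [exact: nearW|exact: cF].
have mFE : measurable_fun setT (fun y : T3 => (F y)%:E).
  by apply: (emeasurable_fun_cvg _ _ mE) => y _; exact: cE.
have [h1 _ h2] := @dominated_convergence _ _ _ (L3 R) setT measurableT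
  (fun n y => (F_ n y)%:E) (fun y => (F y)%:E)
  (fun y => (H y * expR (- k * nrm2 y))%:E) mE mFE
  (aeW _ (fun y _ => cE y)) (iH k k0) (aeW _ (fun y n _ => bF n y)).
by split.
Qed.

End tensors.

Lemma cvg_eq_lim {R : realType} (u v : (\bar R)^nat) (a b : \bar R) :
  (forall n, u n = v n) -> u n @[n --> \oo] --> a -> v n @[n --> \oo] --> b -> a = b.
Proof.
by move=> /funext <- ua ub; exact: (cvg_unique _ ua ub).
Qed.

Section cutoff_removal.
Context {R : realType}.
Local Notation T3 := (R3 (measurableTypeR R)).
Variables (phi b1 b2 b3 : T3 -> R).
Hypotheses (iphi : gauss_integrable phi) (ib1 : gauss_integrable b1)
  (ib2 : gauss_integrable b2) (ib3 : gauss_integrable b3).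
Hypothesis weak : weak_lap phi b1 b2 b3.

Let G s (x : T3) := tens (gauss1 x.1.1 s) (gauss1 x.1.2 s) (gauss1 x.2 s).
Let lapG s (x : T3) y := tens (gauss1'' x.1.1 s) (gauss1 x.1.2 s) (gauss1 x.2 s) y +
  tens (gauss1 x.1.1 s) (gauss1'' x.1.2 s) (gauss1 x.2 s) y +
  tens (gauss1 x.1.1 s) (gauss1 x.1.2 s) (gauss1'' x.2 s) y.
Let divG s (x : T3) y := b1 y * tens (gauss1' x.1.1 s) (gauss1 x.1.2 s) (gauss1 x.2 s) y +
  b2 y * tens (gauss1 x.1.1 s) (gauss1' x.1.2 s) (gauss1 x.2 s) y +
  b3 y * tens (gauss1 x.1.1 s) (gauss1 x.1.2 s) (gauss1' x.2 s) y.
Let K (s : R) : R := s * ((Num.sqrt (2 * pi) * s) ^+ 3)^-1.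

Let heatHG s (x y : T3) : heatH s x y = ((Num.sqrt (2 * pi) * s) ^+ 3)^-1 * G s x y.
Proof.
rewrite /heatH /G /tens /gauss1 -!expRD; congr (_ * expR _).
by rewrite /dist2; ring.
Qed.

Let lapHG s (x y : T3) : 0 < s -> lapH s x y = K s * lapG s x y.
Proof.
move=> s0; have sn0 : s != 0 by rewrite gt_eqF.
rewrite /lapH heatHG /K /lapG /tens /gauss1'' /G /tens /dist2.
move: (gauss1 _ _ _) (gauss1 _ _ _) (gauss1 _ _ _) ((Num.sqrt (2 * pi) * s) ^+ 3)^-1 => g1 g2 g3 k.
by field.
Qed.

Let fluxG s (x y : T3) : 0 < s -> flux b1 b2 b3 s x y = K s * divG s x y.
Proof.
move=> s0; have sn0 : s != 0 by rewrite gt_eqF.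
rewrite /flux heatHG /K /divG /tens /gauss1' /G /tens.
move: (gauss1 _ _ _) (gauss1 _ _ _) (gauss1 _ _ _) ((Num.sqrt (2 * pi) * s) ^+ 3)^-1 => g1 g2 g3 k.
by field.
Qed.

Lemma heat_weak_of_weak_lap : heat_weak phi b1 b2 b3.
Proof.
move=> x s s0.
pose u n := cut x.1.1 s n; pose v n := cut x.1.2 s n; pose w n := cut x.2 s n.
have su n : smooth (u n) by exact: smooth_cut.
have sv n : smooth (v n) by exact: smooth_cut.
have sw n : smooth (w n) by exact: smooth_cut.
have [A [A0 hA]] := cut_bound x.1.1 s0.
have [B [B0 hB]] := cut_bound x.1.2 s0.
have [C [C0 hC]] := cut_bound x.2 s0.
pose k := (8 * s ^+ 2)^-1.
have k0 : 0 < k by rewrite invr_gt0 mulr_gt0// exprn_gt0.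
have mt a b c : smooth a -> smooth b -> smooth c -> measurable_fun setT (tens a b c : T3 -> R).
  by move=> /smooth_continuous sa /smooth_continuous sb /smooth_continuous sc'; exact: measurable_tens.
have mphi := gauss_integrable_measurable iphi.
have mb1 := gauss_integrable_measurable ib1.
have mb2 := gauss_integrable_measurable ib2.
have mb3 := gauss_integrable_measurable ib3.
pose D := A * B * C.
have D0 : 0 <= D by rewrite !mulr_ge0.
have sum3 (p q r e : R) : `|p| <= e -> `|q| <= e -> `|r| <= e -> `|p + q + r| <= 3 * e.
  move=> hp hq hr; apply: (le_trans (ler_normD _ _)).
  apply: (le_trans (lerD (ler_normD _ _) (lexx _))).
  by rewrite (_ : 3 * e = e + e + e); [apply: lerD => //; exact: lerD|ring].
have [i1 c1] : (L3 R).-integrable setT (fun y => (phi y * lapG s x y)%:E) /\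
  ((\int[L3 R]_y (phi y * lap_tens (u n) (v n) (w n) y)%:E)%E @[n --> \oo] -->
   (\int[L3 R]_y (phi y * lapG s x y)%:E)%E).
  apply: (@gauss_dct _ (fun y => (3 * D) * `|phi y|) _ _ k) => //.
  - by apply: gauss_integrableZ; exact: gauss_integrable_norm.
  - move=> n; apply: measurable_funM => //; apply: measurable_funD; first apply: measurable_funD.
    + by apply: mt => //; do 2 apply: smooth_derive1.
    + by apply: mt => //; do 2 apply: smooth_derive1.
    + by apply: mt => //; do 2 apply: smooth_derive1.
  - move=> n y; rewrite normrM mulrAC mulrC; apply: ler_wpM2r => //.
    rewrite -mulrA; apply: sum3; apply: tens_le => z.
    + by have [] := hA n z.
    + by have [] := hB n z.
    + by have [] := hC n z.
    + by have [] := hA n z.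
    + by have [] := hB n z.
    + by have [] := hC n z.
    + by have [] := hA n z.
    + by have [] := hB n z.
    + by have [] := hC n z.
  - move=> y; apply: cvgM; first exact: cvg_cst.
    apply: cvgD; first apply: cvgD; apply: tens_cvg => z.
    + by have [] := cut_cvg x.1.1 s0 z.
    + by have [] := cut_cvg x.1.2 s0 z.
    + by have [] := cut_cvg x.2 s0 z.
    + by have [] := cut_cvg x.1.1 s0 z.
    + by have [] := cut_cvg x.1.2 s0 z.
    + by have [] := cut_cvg x.2 s0 z.
    + by have [] := cut_cvg x.1.1 s0 z.
    + by have [] := cut_cvg x.1.2 s0 z.
    + by have [] := cut_cvg x.2 s0 z.
have [i2 c2] : (L3 R).-integrable setT (fun y => (divG s x y)%:E) /\
  ((\int[L3 R]_y (div_tens b1 b2 b3 (u n) (v n) (w n) y)%:E)%E @[n --> \oo] -->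
   (\int[L3 R]_y (divG s x y)%:E)%E).
  apply: (@gauss_dct _ (fun y => D * (`|b1 y| + `|b2 y| + `|b3 y|)) _ _ k) => //.
  - apply: gauss_integrableZ; apply: gauss_integrableD; first apply: gauss_integrableD;
      exact: gauss_integrable_norm.
  - move=> n; apply: measurable_funD; first apply: measurable_funD; apply: measurable_funM => //.
    + by apply: mt => //; exact: smooth_derive1.
    + by apply: mt => //; exact: smooth_derive1.
    + by apply: mt => //; exact: smooth_derive1.
  - move=> n y; rewrite mulrAC [leRHS]mulrC !mulrDl.
    apply: (le_trans (ler_normD _ _)); apply: lerD; last first.
      rewrite normrM; apply: ler_wpM2l => //; apply: tens_le => z.
      + by have [] := hA n z.
      + by have [] := hB n z.
      + by have [] := hC n z.
    apply: (le_trans (ler_normD _ _)); apply: lerD; rewrite normrM; apply: ler_wpM2l => //;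
      apply: tens_le => z.
    + by have [] := hA n z.
    + by have [] := hB n z.
    + by have [] := hC n z.
    + by have [] := hA n z.
    + by have [] := hB n z.
    + by have [] := hC n z.
  - move=> y; apply: cvgD; first apply: cvgD; apply: cvgM; try exact: cvg_cst; apply: tens_cvg => z.
    + by have [] := cut_cvg x.1.1 s0 z.
    + by have [] := cut_cvg x.1.2 s0 z.
    + by have [] := cut_cvg x.2 s0 z.
    + by have [] := cut_cvg x.1.1 s0 z.
    + by have [] := cut_cvg x.1.2 s0 z.
    + by have [] := cut_cvg x.2 s0 z.
    + by have [] := cut_cvg x.1.1 s0 z.
    + by have [] := cut_cvg x.1.2 s0 z.
    + by have [] := cut_cvg x.2 s0 z.
have e : (\int[L3 R]_y (phi y * lapG s x y)%:E = \int[L3 R]_y (divG s x y)%:E)%E.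
  apply: cvg_eq_lim c1 c2 => n; apply: weak; split=> //; exact: cut_supp.
transitivity ((K s)%:E * \int[L3 R]_y (phi y * lapG s x y)%:E)%E.
  rewrite -(integralZl measurableT i1); apply: eq_integral => y _.
  by rewrite lapHG// mulrCA.
rewrite e -(integralZl measurableT i2); apply: eq_integral => y _.
by rewrite fluxG.
Qed.

End cutoff_removal.

Section tensor_test_functions.
Context {R : realType}.
Implicit Types (a b c : R -> R) (x : R3 R).

Lemma is_derive_line (f : R3 R -> R) x v (l : R) :
  is_derive (0 : R) (1 : R) (fun h : R => f (h *: v + x)) l -> is_derive x v f l.
Proof.
pose F (h : R) := f (h *: v + x).
have e : (fun h : R => h^-1 *: ((f \o shift x) (h *: v) - f x)) =
    (fun h => h^-1 *: ((F \o shift 0) (h *: (1 : R)) - F 0)).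
  by apply/funext => h; rewrite /F /= addr0 scale0r add0r /GRing.scale/= mulr1.
move=> [h1 h2]; split; first by rewrite /derivable e.
by rewrite /derive e.
Qed.

Lemma is_derive_shift (f : R -> R) (z k : R) : smooth f ->
  is_derive (0 : R) 1 (fun h : R => f (h + z) * k) (derive1 f z * k).
Proof.
move=> sf.
have h1 : is_derive (0 : R) 1 (fun h : R => h + z) 1.
  by have := is_derive_add (is_derive_id1 0) (is_derive_cst z (0 : R) (1 : R)); rewrite addr0.
have := @is_derive1_comp R f (fun h => h + z) 0 _ _ (smooth_is_derive (0 + z) sf) h1.
rewrite add0r mulr1 => h2.
have := is_derive_mulc k h2; rewrite [k * derive1 _ _]mulrC.
by under eq_fun do rewrite mulrC.
Qed.

Definition tens_d (j : 'I_3) a b c : R3 R -> R :=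
  tens (if j == 0 then derive1 a else a) (if j == 1 then derive1 b else b)
    (if j == 2 then derive1 c else c).

Lemma is_derive_tens (j : 'I_3) a b c x : [/\ smooth a, smooth b & smooth c] ->
  is_derive x (basis3 j) (tens a b c) (tens_d j a b c x).
Proof.
move=> [sa sb sc]; apply: is_derive_line.
case: j => [[|[|[|//]]] j3]; rewrite /tens /tens_d /tens /basis3 (tnth_nth 0) /=.
- rewrite -[_ * c _]mulrA (_ : (fun h : R => _) = fun h => a (h + x.1.1) * (b x.1.2 * c x.2)).
    exact: is_derive_shift.
  by apply/funext => h; rewrite -mulrA /GRing.scale/= mulr1 !mulr0 !add0r.
- rewrite [a _ * _]mulrC -[_ * c _]mulrA (_ : (fun h : R => _) = fun h => b (h + x.1.2) * (a x.1.1 * c x.2)).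
    exact: is_derive_shift.
  by apply/funext => h; rewrite [a _ * _]mulrC -mulrA /GRing.scale/= mulr1 !mulr0 !add0r.
- rewrite [X in is_derive _ _ _ X]mulrC (_ : (fun h : R => _) = fun h => c (h + x.2) * (a x.1.1 * b x.1.2)).
    exact: is_derive_shift.
  by apply/funext => h; rewrite [_ * c _]mulrC /GRing.scale/= mulr1 !mulr0 !add0r.
Qed.

Lemma partial_tens (j : 'I_3) a b c : [/\ smooth a, smooth b & smooth c] ->
  partial j (tens a b c) = tens_d j a b c.
Proof. by move=> s; apply/funext => x; apply: derive_val; exact: is_derive_tens. Qed.

Lemma continuous_tens a b c : continuous a -> continuous b -> continuous c ->
  continuous (tens a b c : R3 R -> R).
Proof.
move=> ca cb cc x.
have c1 : {for x, continuous (fun y : R3 R => y.1.1)} by apply: (@continuous_comp _ _ _ fst fst); exact: cvg_fst.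
have c2 : {for x, continuous (fun y : R3 R => y.1.2)}.
  by apply: (@continuous_comp _ _ _ fst snd); [exact: cvg_fst|exact: cvg_snd].
have c3 : {for x, continuous (fun y : R3 R => y.2)} by exact: cvg_snd.
apply: cvgM; first apply: cvgM.
- exact: (@continuous_comp _ _ _ (fun y : R3 R => y.1.1) a _ c1 (ca _)).
- exact: (@continuous_comp _ _ _ (fun y : R3 R => y.1.2) b _ c2 (cb _)).
- exact: (@continuous_comp _ _ _ (fun y : R3 R => y.2) c _ c3 (cc _)).
Qed.

Lemma Ck_tens k a b c : [/\ smooth a, smooth b & smooth c] -> Ck k (tens a b c).
Proof.
elim: k a b c => [|k IH] a b c [sa sb sc].
  by apply: continuous_tens; exact: smooth_continuous.
split.
- by apply: continuous_tens; exact: smooth_continuous.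
- by move=> j x; have [] : is_derive x (basis3 j) (tens a b c) (tens_d j a b c x) by exact: is_derive_tens.
- move=> j; rewrite partial_tens//; apply: IH.
  by split; case: ifP => // _; exact: smooth_derive1.
Qed.

Lemma test_fun_tens a b c : [/\ smooth a, smooth b & smooth c] ->
  [/\ compact_supp a, compact_supp b & compact_supp c] -> test_fun setT (tens a b c).
Proof.
move=> s [[r1 h1] [r2 h2] [r3 h3]]; split=> //; first by move=> k; exact: Ck_tens.
have cB : compact (`[- r1, r1] `*` `[- r2, r2] `*` `[- r3, r3]).
  by do 2 (apply: compact_setX; last exact: segment_compact); exact: segment_compact.
have clB := compact_closed (@norm_hausdorff _ (R3 R)) cB.
apply: (subclosed_compact (@closed_closure _ _) cB).
rewrite [Z in _ `<=` Z]((closure_id _).1 clB); apply: closureS => x /=; rewrite /tens.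
have hh (f : R -> R) (r z : R) : (forall y, r < `|y| -> f y = 0) -> f z != 0 -> z \in `[- r, r].
  by move=> h fz; rewrite in_itv/= -ler_norml leNgt; apply: contra fz => rz; rewrite h.
by rewrite !mulf_eq0 !negb_or => /andP[/andP[n1 n2] n3]; split; [split|]; apply: hh; eassumption.
Qed.

Lemma compact_supp_derive1 a : compact_supp a -> compact_supp (derive1 a).
Proof. by move=> [r h]; exists r; exact: derive1_out. Qed.

End tensor_test_functions.

(** * From the Dirac equation to Laplace's equation *)

Section clifford.
Context {R : realType}.
Local Notation C := R[i].
Local Notation D := (@dirac_mx R).

Let mx22 (a b c d : C) : 'M[C]_(1 + 1) := block_mx a%:M b%:M c%:M d%:M.

Let mx22M a b c d a' b' c' d' : mx22 a b c d *m mx22 a' b' c' d' =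
  mx22 (a * a' + b * c') (a * b' + b * d') (c * a' + d * c') (c * b' + d * d').
Proof. by rewrite /mx22 mulmx_block -!scalar_mxM -!raddfD. Qed.

Let anticommutator a b c d a' b' c' d' :
  mx22 a b c d *m mx22 a' b' c' d' + mx22 a' b' c' d' *m mx22 a b c d =
  mx22 (a * a' + b * c' + (a' * a + b' * c)) (a * b' + b * d' + (a' * b + b' * d))
    (c * a' + d * c' + (c' * a + d' * c)) (c * b' + d * d' + (c' * b + d' * d)).
Proof. by rewrite !mx22M /mx22 add_block_mx -!raddfD. Qed.

Let pauliE (j : 'I_3) : @pauli R j = tnth [tuple mx22 0 1 1 0; mx22 0 (- 'i%C) 'i%C 0; mx22 1 0 0 (-1)] j.
Proof.
have e0 : 0 = (0%:M : 'M[C]_1) by rewrite raddf0.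
by case: j => [[|[|[|//]]] j3]; rewrite /pauli !(tnth_nth 0) /= /mx22 -?e0.
Qed.

Lemma pauli_anticommute (j k : 'I_3) :
  pauli j *m pauli k + pauli k *m pauli j = (2 * (j == k)%:R)%:M :> 'M[R[i]]_2.
Proof.
have i2 : 'i%C * 'i%C = -1 :> R[i] by rewrite -expr2 sqr_i.
have e0 : 0 = (0%:M : 'M[C]_1) by rewrite raddf0.
have sc (a : C) : a%:M = mx22 a 0 0 a by rewrite /mx22 -e0 -scalar_mx_block.
case: j k => [[|[|[|//]]] j3] [[|[|[|//]]] k3];
  rewrite !pauliE !(tnth_nth 0) /=; apply: etrans (esym (sc _));
  apply: (etrans (anticommutator _ _ _ _ _ _ _ _));
  congr mx22; rewrite ?mulr0 ?mul0r ?mulr1 ?mul1r ?addr0 ?add0r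
    ?mulrN ?mulNr ?i2 ?opprK ?mulr1 ?mul1r ?subrr ?addNr ?oppr0 //.
Qed.

Lemma dirac_anticommute (j k : 'I_3) : D j *m D k + D k *m D j = (2 * (j == k)%:R)%:M.
Proof.
have h (l m : 'I_3) : D l *m D m = block_mx (pauli l *m pauli m) 0 0 (pauli l *m pauli m) :> 'M[C]_(2 + 2).
  apply: (etrans (@mulmx_block C 2 2 2 2 2 2 0 (pauli l) (pauli l) 0 0 (pauli m) (pauli m) 0)).
  by rewrite !mul0mx !mulmx0 !addr0 !add0r.
apply: (etrans (congr2 (fun x y => x + y) (h j k) (h k j))).
apply: (etrans (@add_block_mx C 2 2 2 2 _ _ _ _ _ _ _ _)).
by rewrite !addr0 pauli_anticommute; exact: esym (@scalar_mx_block C 2 2 _).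
Qed.

Lemma clifford_trace (W : 'I_3 -> 'I_3 -> 'cV[C]_4) : (forall j k, W j k = W k j) ->
  \sum_k (D k *m \sum_j (D j *m W j k)) = \sum_k W k k.
Proof.
move=> symW; pose S := \sum_k \sum_j (D k *m D j *m W j k).
have -> : \sum_k (D k *m \sum_j (D j *m W j k)) = S.
  by apply: eq_bigr => k _; rewrite mulmx_sumr; apply: eq_bigr => j _; rewrite mulmxA.
have SS : S + S = \sum_k \sum_j ((D k *m D j + D j *m D k) *m W j k).
  rewrite {2}/S exchange_big/= -big_split/=; apply: eq_bigr => k _.
  rewrite -big_split/=; apply: eq_bigr => j _.
  by rewrite mulmxDl (symW k j).
have n2 : (2 : C) != 0 by rewrite pnatr_eq0.
apply: (scalerI n2); rewrite [LHS]scaler_nat mulr2n SS scaler_sumr.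
apply: eq_bigr => k _; rewrite (bigD1 k)//= big1 ?addr0 => [|j jk].
  by rewrite dirac_anticommute eqxx mulr1 mul_scalar_mx.
by rewrite dirac_anticommute eq_sym (negPf jk) mulr0 raddf0 mul0mx.
Qed.

End clifford.

Section complex_integral.
Context {R : realType}.
Local Notation T3 := (R3 (measurableTypeR R)).
Local Notation C := R[i].
Local Notation Re := complex.Re.
Local Notation Im := complex.Im.
Implicit Types (h : T3 -> C) (z : C).

Definition part (b : bool) z : R := if b then Re z else Im z.

Lemma complex_parts z z' : (forall b, part b z = part b z') -> z = z'.
Proof. by move=> e; case: z z' e => [x y] [x' y'] e; have /= -> := e true; have /= -> := e false. Qed.

Lemma partD b z z' : part b (z + z') = part b z + part b z'.
Proof. by case: b z z' => [] [x y] [x' y']. Qed.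

Lemma part0 b : part b 0 = 0. Proof. by case: b. Qed.

Lemma part_sum b I (r : seq I) (P : pred I) (F : I -> C) :
  part b (\sum_(i <- r | P i) F i) = \sum_(i <- r | P i) part b (F i).
Proof. exact: (big_morph _ (partD b) (part0 b)). Qed.

Lemma partM b z z' : part b (z * z') =
  if b then Re z * Re z' - Im z * Im z' else Re z * Im z' + Im z * Re z'.
Proof. by case: b z z' => [] [x y] [x' y'] //=; rewrite [y * x']mulrC. Qed.

Lemma part_realM b (r : R) z : part b (r%:C%C * z) = r * part b z.
Proof. by rewrite partM; case: b => /=; rewrite mul0r ?subr0 ?addr0. Qed.

Definition cgauss h := forall b, gauss_integrable (fun y => part b (h y)).

Lemma cgaussD h h' : cgauss h -> cgauss h' -> cgauss (fun y => h y + h' y).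
Proof. by move=> hi hi' b; under eq_fun do rewrite partD; exact: gauss_integrableD. Qed.

Lemma cgaussZ z h : cgauss h -> cgauss (fun y => z * h y).
Proof.
move=> hi [].
- under eq_fun do rewrite (partM true) -mulNr; apply: gauss_integrableD; apply: gauss_integrableZ.
    exact: (hi true).
  exact: (hi false).
- under eq_fun do rewrite (partM false); apply: gauss_integrableD; apply: gauss_integrableZ.
    exact: (hi false).
  exact: (hi true).
Qed.

Lemma gauss_integrable0 : gauss_integrable (fun _ : T3 => 0 : R).
Proof. by move=> c c0; under eq_fun do rewrite mul0r; exact: integrable0. Qed.

Lemma cgauss_sum (I : Type) (r : seq I) (F : I -> T3 -> C) :
  (forall i, cgauss (F i)) -> cgauss (fun y => \sum_(i <- r) F i y).
Proof.
move=> hF; elim: r => [|i r IH].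
  by move=> b; under eq_fun do rewrite big_nil part0; exact: gauss_integrable0.
by under eq_fun do rewrite big_cons; exact: cgaussD.
Qed.

Definition cintegrable h := forall b, (L3 R).-integrable setT (fun y => (part b (h y))%:E).

Definition cint h : C := Complex (\int[L3 R]_y Re (h y)) (\int[L3 R]_y Im (h y)).

Lemma part_cint b h : part b (cint h) = \int[L3 R]_y part b (h y).
Proof. by case: b. Qed.

Lemma cintD h h' : cintegrable h -> cintegrable h' ->
  cint (fun y => h y + h' y) = cint h + cint h'.
Proof.
move=> hi hi'; apply: complex_parts => b; rewrite partD !part_cint.
rewrite -(@RintegralD _ _ _ (L3 R) setT (fun y => part b (h y))
  (fun y => part b (h' y)) measurableT (hi b) (hi' b)).
by apply: eq_Rintegral => y _; rewrite partD.
Qed.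

Lemma cintegrableD h h' : cintegrable h -> cintegrable h' -> cintegrable (fun y => h y + h' y).
Proof.
by move=> hi hi' b; under eq_fun do rewrite partD EFinD; exact: integrableD.
Qed.

Lemma cintegrableZ z h : cintegrable h -> cintegrable (fun y => z * h y).
Proof.
move=> hi [].
- under eq_fun do rewrite (partM true) -mulNr EFinD !EFinM.
  by apply: integrableD => //; apply: integrableZl => //; [exact: (hi true)|exact: (hi false)].
- under eq_fun do rewrite (partM false) EFinD !EFinM.
  by apply: integrableD => //; apply: integrableZl => //; [exact: (hi false)|exact: (hi true)].
Qed.

Lemma cintZ z h : cintegrable h -> cint (fun y => z * h y) = z * cint h.
Proof.
move=> hi; have iZ (r : R) b : (L3 R).-integrable setT (fun y => (r * part b (h y))%:E).
  by under eq_fun do rewrite EFinM; apply: integrableZl => //; exact: hi.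
have zl (r : R) b : \int[L3 R]_y (r * part b (h y)) = r * \int[L3 R]_y part b (h y).
  exact: (@RintegralZl _ _ _ (L3 R) setT (fun y => part b (h y)) r measurableT (hi b)).
apply: complex_parts => -[]; rewrite part_cint [RHS]partM.
- rewrite -(zl _ true) -(zl _ false).
  rewrite -(@RintegralB _ _ _ (L3 R) setT (fun y => Re z * Re (h y))
    (fun y => Im z * Im (h y)) measurableT (iZ _ true) (iZ _ false)).
  by apply: eq_Rintegral => y _; rewrite partM.
- rewrite -(zl _ true) -(zl _ false).
  rewrite -(@RintegralD _ _ _ (L3 R) setT (fun y => Re z * Im (h y))
    (fun y => Im z * Re (h y)) measurableT (iZ _ false) (iZ _ true)).
  by apply: eq_Rintegral => y _; rewrite partM.
Qed.

Lemma cint_sum (I : Type) (r : seq I) (F : I -> T3 -> C) : (forall i, cintegrable (F i)) ->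
  cint (fun y => \sum_(i <- r) F i y) = \sum_(i <- r) cint (F i) /\
  cintegrable (fun y => \sum_(i <- r) F i y).
Proof.
move=> hF; elim: r => [|i r [IH1 IH2]].
  rewrite big_nil; split; last by move=> b; under eq_fun do rewrite big_nil part0; exact: integrable0.
  apply: complex_parts => b; rewrite part_cint part0 /Rintegral integral0_eq// => y _.
  by rewrite big_nil part0.
have -> : (fun y => \sum_(j <- i :: r) F j y) = fun y => F i y + \sum_(j <- r) F j y.
  by apply/funext => y; rewrite big_cons.
by rewrite big_cons -IH1 -cintD//; split=> //; exact: cintegrableD.
Qed.

End complex_integral.

Section dirac_to_laplace.
Context {R : realType}.
Local Notation T3 := (R3 (measurableTypeR R)).
Local Notation C := R[i].
Local Notation D := (@dirac_mx R).
Implicit Types (f g : T3 -> C4 R).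

Lemma compact_gauss (a : R -> R) : continuous a -> compact_supp a ->
  exists A : R, forall z, `|a z| <= A * expR (- 1 * z ^+ 2).
Proof.
move=> ca [r ha].
have ce : continuous (fun z => a z * expR (z ^+ 2)).
  move=> z; apply: cvgM; first exact: ca.
  by apply: continuous_comp; [exact: exprn_continuous|exact: continuous_expR].
have [A _ hA] := @continuous_out_bounded _ (fun z => a z * expR (z ^+ 2)) r ce
  (fun z rz => etrans (congr1 (fun t => t * expR (z ^+ 2)) (ha z rz)) (mul0r _)).
exists A => z; have := hA z; rewrite normrM (ger0_norm (expR_ge0 _)).
by rewrite mulN1r expRN ler_pdivlMr ?expR_gt0.
Qed.

Lemma integrable_tens (u : T3 -> R) (a b c : R -> R) : gauss_integrable u ->
  [/\ smooth a, smooth b & smooth c] ->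
  [/\ compact_supp a, compact_supp b & compact_supp c] ->
  (L3 R).-integrable setT (fun y => (tens a b c y * u y)%:E).
Proof.
move=> iu [/smooth_continuous sa /smooth_continuous sb /smooth_continuous sc] [ka kb kc].
have [A hA] := compact_gauss sa ka; have [B hB] := compact_gauss sb kb.
have [E hE] := compact_gauss sc kc.
under eq_fun do rewrite mulrC.
apply: (@gauss_integrable_dom _ _ _ 1 (A * B * E)) => //; first exact: measurable_tens.
by move=> y; exact: tens_le.
Qed.

Definition test_int (p : R3 R -> R) (h : T3 -> C4 R) : C4 R :=
  integral4 (fun x => (p x)%:C%C *: h x).

Lemma test_intE p h i : test_int p h i 0 = cint (fun y => (p y)%:C%C * h y i 0).
Proof.
rewrite [LHS]mxE.
by apply: (congr2 (@Complex R)); apply: eq_Rintegral => y _; [congr complex.Re|congr complex.Im]; exact: mxE.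
Qed.

Variables (f g : T3 -> C4 R).
Hypothesis if_ : forall i, cgauss (fun y => f y i 0).
Hypothesis ig : forall i, cgauss (fun y => g y i 0).
Hypothesis dirac : forall psi, test_fun setT psi ->
  test_int psi g = - 'i%C *: \sum_(j < 3) D j *m (- test_int (partial j psi) f).

(* [Lap f = - div (- i alpha g)]: the source of the scalar equation for one real component of [f]. *)
Definition source (i : 'I_4) b k (y : T3) : R := part b (\sum_l (- 'i%C * D k i l) * g y l 0).

Lemma source_gauss i b k : gauss_integrable (source i b k).
Proof. by apply: cgauss_sum => l; apply: cgaussZ; exact: ig. Qed.

Let slot (k m : 'I_3) (a : R -> R) := if k == m then derive1 a else a.

Let smooth_slot k m a : smooth a -> smooth (slot k m a).
Proof. by rewrite /slot; case: ifP => // _; exact: smooth_derive1. Qed.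

Let supp_slot k m a : compact_supp a -> compact_supp (slot k m a).
Proof. by rewrite /slot; case: ifP => // _; exact: compact_supp_derive1. Qed.

Section test.
Variables a b c : R -> R.
Hypothesis sm : [/\ smooth a, smooth b & smooth c].
Hypothesis cs : [/\ compact_supp a, compact_supp b & compact_supp c].

Let d1 k : R3 R -> R := tens (slot k 0 a) (slot k 1 b) (slot k 2 c).
Let d2 j k : R3 R -> R := tens (slot j 0 (slot k 0 a)) (slot j 1 (slot k 1 b)) (slot j 2 (slot k 2 c)).

Let d2C j k : d2 j k = d2 k j.
Proof. by rewrite /d2 /slot; case: j k => [[|[|[|//]]] j3] [[|[|[|//]]] k3]. Qed.

Let test_identity : \sum_k test_int (d2 k k) f = \sum_k (- 'i%C) *: (D k *m test_int (d1 k) g).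
Proof.
have [sa sb sc] := sm; have [ca cb cc] := cs.
have dE k : test_int (d1 k) g = 'i%C *: \sum_j D j *m test_int (d2 j k) f.
  rewrite dirac; last by apply: test_fun_tens; split;
    [exact: smooth_slot..|exact: supp_slot|exact: supp_slot|exact: supp_slot].
  rewrite scaleNr -scalerN; congr (_ *: _); rewrite -sumrN; apply: eq_bigr => j _.
  by rewrite mulmxN opprK partial_tens//; split; exact: smooth_slot.
rewrite -(clifford_trace (W := fun j k => test_int (d2 j k) f)); last by move=> j k; rewrite d2C.
apply: eq_bigr => k _; rewrite dE -scalemxAr scalerA mulNr -expr2 sqr_i opprK.
by rewrite scale1r.
Qed.

Let cint_d2 i k : cintegrable (fun y => (d2 k k y)%:C%C * f y i 0).
Proof.
have [sa sb sc] := sm; have [ca cb cc] := cs.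
move=> e; under eq_fun do rewrite part_realM.
by apply: integrable_tens; [exact: if_|split; do 2 apply: smooth_slot|split; do 2 apply: supp_slot].
Qed.

Let cint_d1 l k : cintegrable (fun y => (d1 k y)%:C%C * g y l 0).
Proof.
have [sa sb sc] := sm; have [ca cb cc] := cs.
move=> e; under eq_fun do rewrite part_realM.
by apply: integrable_tens; [exact: ig|split; apply: smooth_slot|split; apply: supp_slot].
Qed.

Let scalar_identity i :
  cint (fun y => \sum_k (d2 k k y)%:C%C * f y i 0) =
  cint (fun y => \sum_k \sum_l (- 'i%C * D k i l) * ((d1 k y)%:C%C * g y l 0)) /\
  cintegrable (fun y => \sum_k \sum_l (- 'i%C * D k i l) * ((d1 k y)%:C%C * g y l 0)).
Proof.
have hl k l : cintegrable (fun y => (- 'i%C * D k i l) * ((d1 k y)%:C%C * g y l 0)).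
  by apply: cintegrableZ; exact: cint_d1.
have hk k := cint_sum (index_enum 'I_4) (hl k).
have hh := cint_sum (index_enum 'I_3) (fun k => (hk k).2).
split; last exact: hh.2.
rewrite hh.1 (cint_sum (index_enum 'I_3) (cint_d2 i)).1.
under eq_bigr do rewrite -test_intE.
have := congr1 (fun v : C4 R => v i 0) test_identity; rewrite /= !summxE => ->.
apply: eq_bigr => k _; rewrite (hk k).1 !mxE big_distrr/=; apply: eq_bigr => l _.
by rewrite mulrA test_intE -cintZ//; exact: cint_d1.
Qed.

Let lap_tensE y : lap_tens a b c y = \sum_k d2 k k y.
Proof. by rewrite !big_ord_recl big_ord0 addr0 addrA. Qed.

Let div_tensE i e y : div_tens (source i e 0) (source i e 1) (source i e 2) a b c y =
  part e (\sum_k \sum_l (- 'i%C * D k i l) * ((d1 k y)%:C%C * g y l 0)).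
Proof.
transitivity (\sum_k source i e k y * d1 k y).
  by rewrite !big_ord_recl big_ord0 addr0 addrA.
rewrite part_sum; apply: eq_bigr => k _; rewrite mulrC -part_realM big_distrr/=.
by congr part; apply: eq_bigr => l _; rewrite mulrCA.
Qed.

Lemma weak_identity i e :
  (\int[L3 R]_y (part e (f y i 0) * lap_tens a b c y)%:E =
   \int[L3 R]_y (div_tens (source i e 0) (source i e 1) (source i e 2) a b c y)%:E)%E.
Proof.
have [h i1] := scalar_identity i.
have h2 := (cint_sum (index_enum 'I_3) (cint_d2 i)).2.
have := congr1 (fun z => (part e z)%:E) h; rewrite !part_cint /Rintegral !fineK;
  [|exact: integrable_fin_num (i1 e)|exact: integrable_fin_num (h2 e)].
move=> hE; apply: etrans (etrans hE _); apply: eq_integral => y _; last by rewrite div_tensE.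
by rewrite lap_tensE mulrC big_distrl part_sum; congr EFin; apply: eq_bigr => k _; rewrite part_realM.
Qed.

End test.

Lemma weak_lap_of_dirac i e :
  weak_lap (fun y => part e (f y i 0)) (source i e 0) (source i e 1) (source i e 2).
Proof. by move=> a b c sm cs; exact: weak_identity. Qed.

End dirac_to_laplace.

(** * The weak-type estimate *)

Section components.
Context {R : realType}.
Local Notation T3 := (R3 (measurableTypeR R)).
Local Notation C := R[i].
Implicit Types (f g : T3 -> C4 R) (z : C4 R).

Lemma enormE z : enorm z = Num.sqrt (\sum_i (part true (z i 0) ^+ 2 + part false (z i 0) ^+ 2)).
Proof. by []. Qed.

Lemma enorm0 : enorm (0 : C4 R) = 0.
Proof.
by rewrite /enorm big1 ?sqrtr0// => i _; rewrite mxE /= expr0n /= addr0.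
Qed.

Lemma part_le_enorm e i z : `|part e (z i 0)| <= enorm z.
Proof.
rewrite enormE -sqrtr_sqr ler_wsqrtr// (bigD1 i)//=.
have h : 0 <= \sum_(j | j != i) (part true (z j 0) ^+ 2 + part false (z j 0) ^+ 2).
  by apply: sumr_ge0 => j _; rewrite addr_ge0 ?sqr_ge0.
by case: e; [rewrite -addrA lerDl|rewrite addrAC lerDr]; rewrite addr_ge0 ?sqr_ge0.
Qed.

Lemma enorm_part_ge (u : R) z : 0 < u -> u <= enorm z ->
  exists i e, u / 3 <= `|part e (z i 0)|.
Proof.
move=> u0 uz; apply: contrapT => H.
have small i e : part e (z i 0) ^+ 2 <= u ^+ 2 / 9.
  have : `|part e (z i 0)| <= u / 3.
    by rewrite leNgt; apply/negP => h; apply: H; exists i, e; exact: ltW.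
  move=> h; rewrite -[X in X <= _]real_normK ?num_real//.
  rewrite (_ : u ^+ 2 / 9 = (u / 3) ^+ 2); last by field.
  by rewrite ler_pXn2r// nnegrE divr_ge0// ltW.
pose S := \sum_(i < 4) (part true (z i 0) ^+ 2 + part false (z i 0) ^+ 2).
have S0 : 0 <= S by apply: sumr_ge0 => i _; rewrite addr_ge0 ?sqr_ge0.
have uS : u ^+ 2 <= S by rewrite -(sqr_sqrtr S0) -enormE ler_pXn2r// nnegrE ?(ltW u0)// sqrtr_ge0.
have : S <= \sum_(i < 4) (u ^+ 2 / 9 + u ^+ 2 / 9) by apply: ler_sum => i _; apply: lerD; exact: small.
rewrite sumr_const card_ord -mulr_natr => /(le_trans uS).
have : 0 < u ^+ 2 by rewrite exprn_gt0.
move: (u ^+ 2) => v; lra.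
Qed.

Lemma measurable_part_enorm f : (forall i e, measurable_fun setT (fun y => part e (f y i 0))) ->
  measurable_fun setT (fun y : T3 => enorm (f y)).
Proof.
move=> mf.
have -> : (fun y : T3 => enorm (f y)) =
    fun y => (\sum_i (part true (f y i 0) ^+ 2 + part false (f y i 0) ^+ 2)) `^ 2^-1.
  apply/funext => y; rewrite enormE powR12_sqrt//.
  by apply: sumr_ge0 => i _; rewrite addr_ge0 ?sqr_ge0.
apply: (measurableT_comp (f := fun r : R => r `^ 2^-1)); first exact: measurable_powR.
apply: measurable_sum => i; apply: measurable_funD; apply: measurable_funX; exact: mf.
Qed.

Definition cube (n : nat) : set T3 :=
  `[- n%:R, n%:R]%classic `*` `[- n%:R, n%:R]%classic `*` `[- n%:R, n%:R]%classic.

Lemma compact_cube n : compact (cube n : set (R3 R)).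
Proof. by do 2 (apply: compact_setX; last exact: segment_compact); exact: segment_compact. Qed.

Lemma measurable_cube n : measurable (cube n).
Proof. by do 2 apply: measurableX => //. Qed.

Lemma bigcup_cube : \bigcup_n cube n = setT.
Proof.
apply/seteqP; split=> // x _.
have h (r : R) n : (Num.truncn `|r| < n)%N -> r \in `[- n%:R, n%:R].
  move=> rn; rewrite in_itv/= -ler_norml.
  have := Num.Theory.truncnS_gt `|r|; move=> /ltW /le_trans; apply; by rewrite ler_nat.
exists (maxn (maxn (Num.truncn `|x.1.1|) (Num.truncn `|x.1.2|)) (Num.truncn `|x.2|)).+1 => //.
split; [split|]; apply: h; rewrite ltnS !leq_max leqnn ?orbT//.
Qed.

Lemma loc_integrable_part f i e : loc_integrable4 f -> measurable_fun setT (fun y => part e (f y i 0)).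
Proof.
move=> lf; rewrite -bigcup_cube; apply/measurable_fun_bigcup; first exact: measurable_cube.
move=> n; have [h1 h2] := lf _ (@compact_cube n) i.
by case: e; apply/measurable_EFinP; [case/integrableP : h1|case/integrableP : h2].
Qed.

Lemma gauss_integrable1 : gauss_integrable (fun _ : T3 => 1 : R).
Proof.
move=> c c0; pose s := Num.sqrt (2 * c)^-1.
have s2 : s ^+ 2 = (2 * c)^-1 by rewrite sqr_sqrtr// ltW// invr_gt0 mulr_gt0.
have s0 : 0 < s by rewrite sqrtr_gt0 invr_gt0 mulr_gt0.
pose K := ((Num.sqrt (2 * pi) * s) ^+ 3)^-1.
have K0 : 0 < K by exact: heatH_const_gt0.
have e (y : T3) : (1 * expR (- c * nrm2 y))%:E = (K^-1%:E * (heatH s (0, 0, 0) y)%:E)%E.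
  rewrite -EFinM /heatH -/K mulKf ?gt_eqF// mul1r; congr (expR _)%:E.
  rewrite s2 /dist2 /nrm2 /= !sub0r !sqrrN; field; by rewrite gt_eqF.
under eq_fun do rewrite e; apply: integrableZl => //.
apply/integrableP; split; first by apply/measurable_EFinP; exact: measurable_heatHr.
under eq_integral do rewrite abse_EFin (ger0_norm (heatH_ge0 _ _ (ltW s0))).
by rewrite integral_heatH// ltry.
Qed.

Lemma gauss_integrable_powR (u : T3 -> R) p : measurable_fun setT u -> (forall y, 0 <= u y) ->
  1 <= p -> (\int[L3 R]_y (u y `^ p)%:E < +oo)%E -> gauss_integrable u.
Proof.
move=> mu u0 p1 up c c0.
have iu : (L3 R).-integrable setT (fun y => (u y `^ p)%:E).
  apply/integrableP; split.
    by apply/measurable_EFinP; exact: measurableT_comp (measurable_powR _) mu.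
  rewrite (eq_integral (fun y => (u y `^ p)%:E))// => y _.
  by rewrite abse_EFin ger0_norm ?powR_ge0.
apply: (@le_integrable _ _ _ _ _ measurableT _
  (fun y : T3 => ((1 * expR (- c * nrm2 y)) + (u y `^ p))%:E)) => //.
- by apply/measurable_EFinP; apply: measurable_funM => //; exact: measurable_gauss.
- move=> y _; rewrite lee_fin normrM ger0_norm// ger0_norm ?expR_ge0//.
  rewrite (le_trans _ (ler_norm _))// mul1r.
  have e1 : expR (- c * nrm2 y) <= 1 by rewrite -expR0 ler_expR mulNr oppr_le0 mulr_ge0 ?nrm2_ge0// ltW.
  have [u1|u1] := leP (u y) 1.
    by rewrite (@le_trans _ _ (expR (- c * nrm2 y)))// ?lerDl ?powR_ge0// ler_piMl ?expR_ge0.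
  rewrite (@le_trans _ _ (u y))// ?ler_piMr//.
  by rewrite (@le_trans _ _ (u y `^ p))// ?lerDr ?expR_ge0// le1r_powR// ltW.
- by under eq_fun do rewrite EFinD; apply: integrableD => //; exact: gauss_integrable1.
Qed.

Lemma source_le g i e k y :
  `|source g i e k y| <=
    (\sum_l (`|complex.Re (- 'i%C * dirac_mx k i l)| + `|complex.Im (- 'i%C * dirac_mx k i l)|)) *
    (2 * enorm (g y)).
Proof.
rewrite /source part_sum big_distrl; apply: (le_trans (ler_norm_sum _ _ _)); apply: ler_sum => l _.
have h (x z : C) : `|part e (x * z)| <= (`|complex.Re x| + `|complex.Im x|) * (`|part true z| + `|part false z|).
  rewrite partM; set a := complex.Re x; set b := complex.Im x.
  rewrite /part; set r := complex.Re z; set s := complex.Im z.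
  rewrite mulrDl !mulrDr -!normrM.
  have := (normr_ge0 (a * r), normr_ge0 (a * s), normr_ge0 (b * r), normr_ge0 (b * s)).
  by case: e => -[[[h1 h2] h3] h4]; [have := ler_normB (a * r) (b * s)|have := ler_normD (a * s) (b * r)]; lra.
apply: (le_trans (h _ _)); apply: ler_wpM2l; first by rewrite addr_ge0.
by rewrite mulr_natl mulr2n; apply: lerD; exact: part_le_enorm.
Qed.

End components.

Section level_sets.
Context {R : realType}.
Local Notation T3 := (R3 (measurableTypeR R)).
Local Notation C := R[i].
Implicit Types (f g : T3 -> C4 R).

Lemma dist2_ub (x y : R3 R) : dist2 x y <= 2 * nrm2 x + 2 * nrm2 y.
Proof.
rewrite /nrm2 /dist2.
have h (a b : R) : (a - b) ^+ 2 <= 2 * a ^+ 2 + 2 * b ^+ 2.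
  by have := sqr_ge0 (a + b); rewrite !expr2; nra.
have := (h x.1.1 y.1.1, h x.1.2 y.1.2, h x.2 y.2) => -[[h1 h2] h3]; lra.
Qed.

Lemma heat_integrable_gauss f (x0 : R3 R) i :
  (forall e, measurable_fun setT (fun y => part e (f y i 0))) ->
  (forall t : R, 0 < t -> integrable4 setT (fun y => (heat_kernel t x0 y)%:C%C *: f y)) ->
  cgauss (fun y => f y i 0).
Proof.
move=> mf hf e c c0; pose t := (2 * c)^-1.
have t0 : 0 < t by rewrite invr_gt0 mulr_gt0.
have hi : (L3 R).-integrable setT (fun y => (heat_kernel t x0 y * part e (f y i 0))%:E).
  have [h1 h2] := hf t t0 i.
  case: e; [move: h1|move: h2]; apply: eq_integrable => // y _; congr EFin;
    rewrite mxE; [exact: (part_realM true)|exact: (part_realM false)].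
pose K := (4 * pi * t) `^ (3 / 2).
have K0 : 0 < K by rewrite powR_gt0// !mulr_gt0// pi_gt0.
apply: (@le_integrable _ _ _ _ _ measurableT _
  (fun y : T3 => ((K * expR (c * nrm2 x0))%:E * (heat_kernel t x0 y * part e (f y i 0))%:E)%E)) => //.
- by apply/measurable_EFinP; apply: measurable_funM => //; exact: measurable_gauss.
- move=> y _; rewrite lee_fin !normrM mulrC mulrA; apply: ler_wpM2r => //.
  rewrite /heat_kernel -/K !(gtr0_norm (expR_gt0 _)) !gtr0_norm ?invr_gt0// ?mulr_gt0 ?invr_gt0 ?expR_gt0//.
  have -> : K * expR (c * nrm2 x0) * (K^-1 * expR (- dist2 x0 y / (4 * t))) =
      expR (c * nrm2 x0 + - dist2 x0 y / (4 * t)).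
    by rewrite expRD; move: (expR _) (expR _) => E1 E2; field; rewrite gt_eqF.
  rewrite ler_expR (_ : - dist2 x0 y / (4 * t) = - (c / 2 * dist2 x0 y)).
    have := ler_wpM2l (divr_ge0 (ltW c0) (ler0n R 2)) (dist2_ub x0 y); lra.
  by rewrite /t; field; rewrite gt_eqF.
- by apply: integrableZl.
Qed.

Lemma heat_part f (s : R) x i e : 0 < s ->
  part e (heat (s ^+ 2 / 2) f x i 0) = fine (\int[L3 R]_y (part e (f y i 0) * heatH s x y)%:E)%E.
Proof.
move=> s0; rewrite [heat _ _ _ _ _]mxE.
transitivity (\int[L3 R]_y (part e (f y i 0) * heatH s x y)) => //.
case: e => /=; apply: eq_Rintegral => y _; rewrite mxE heat_kernelE// [RHS]mulrC.
  exact: (part_realM true).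
exact: (part_realM false).
Qed.

Definition source_const : R := \sum_(i < 4) \sum_(k < 3) \sum_(l < 4)
  (`|complex.Re (- 'i%C * @dirac_mx R k i l)| + `|complex.Im (- 'i%C * @dirac_mx R k i l)|).

Lemma source_const_le g i e k y : `|source g i e k y| <= source_const * (2 * enorm (g y)).
Proof.
apply: (le_trans (source_le g i e k y)); apply: ler_wpM2r.
  by rewrite mulr_ge0// sqrtr_ge0.
have h0 j m : 0 <= \sum_(l < 4) (`|complex.Re (- 'i%C * @dirac_mx R m j l)| +
    `|complex.Im (- 'i%C * @dirac_mx R m j l)|).
  by apply: sumr_ge0 => l _; rewrite addr_ge0.
rewrite /source_const [leRHS](bigD1 i)//= [X in _ <= X + _](bigD1 k)//= -addrA lerDl addr_ge0//.
  by apply: sumr_ge0 => m _; exact: h0.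
by apply: sumr_ge0 => j _; apply: sumr_ge0 => m _; exact: h0.
Qed.

Lemma source_const_ge0 : 0 <= source_const.
Proof. by do 3 (apply: sumr_ge0 => ? _); rewrite addr_ge0. Qed.

Lemma ae_le_measure d (T : measurableType d) (m : {measure set T -> \bar R}) (A B : set T) :
  measurable A -> measurable B -> {ae m, forall x, A x -> B x} -> (m A <= m B)%E.
Proof.
move=> mA mB AB.
have mAB : measurable (A `\` B) by exact: measurableD.
have n0 : m (A `\` B) = 0%E.
  apply: measure_negligible => //; apply: negligibleS AB => x /= [Ax nBx] h; exact/nBx/h.
rewrite -(measureU0 mB mAB n0); apply: le_measure; rewrite ?inE//; first exact: measurableU.
by move=> x Ax; have [Bx|nBx] := pselect (B x); [left|right].
Qed.

Lemma abse_sub_ge (I : \bar R) (a b v : R) : I \is a fin_num -> `|fine I| <= b -> v + b <= `|a| ->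
  (v%:E <= `|I - a%:E|)%E.
Proof.
case: I => [r| |]//= _ rb vb; rewrite lee_fin distrC (le_trans _ (lerB_dist _ _))//.
by rewrite lerBrDr (le_trans _ vb)// lerD2l.
Qed.

Variables (f g : T3 -> C4 R) (p : R).
Hypothesis p1 : 1 <= p.
Hypothesis if_ : forall i, cgauss (fun y => f y i 0).
Hypothesis mg : forall i e, measurable_fun setT (fun y => part e (g y i 0)).
Hypothesis gp : (\int[L3 R]_y (enorm (g y) `^ p)%:E < +oo)%E.
Hypothesis dirac : forall psi, test_fun setT psi ->
  test_int psi g = - 'i%C *: \sum_(j < 3) dirac_mx j *m (- test_int (partial j psi) f).

Let K : R := 144 * source_const.

Let K0 : 0 <= K. Proof. by rewrite mulr_ge0// source_const_ge0. Qed.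

Let menorm : measurable_fun setT (fun y : T3 => enorm (g y)).
Proof. exact: measurable_part_enorm. Qed.

Let ienorm : gauss_integrable (fun y : T3 => enorm (g y)).
Proof. by apply: (gauss_integrable_powR menorm _ p1 gp) => y; exact: sqrtr_ge0. Qed.

Let ig i : cgauss (fun y => g y i 0).
Proof.
move=> e; apply: (gauss_integrable_le ienorm); first exact: mg.
by move=> y; rewrite [leRHS]ger0_norm ?sqrtr_ge0//; exact: part_le_enorm.
Qed.

Let W (y : T3) : R := K * enorm (g y).

Let WpE : (\int[L3 R]_y (W y `^ p)%:E = (K `^ p)%:E * \int[L3 R]_y (enorm (g y) `^ p)%:E)%E.
Proof.
rewrite -ge0_integralZl_EFin ?powR_ge0//.
- by apply: eq_integral => y _; rewrite /W powRM// sqrtr_ge0.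
- by move=> y _; rewrite lee_fin powR_ge0.
- by apply/measurable_EFinP; exact: measurableT_comp (measurable_powR _) menorm.
Qed.

Let representation i e s : 0 < s ->
  {ae L3 R, forall x, (`|\int[L3 R]_y (part e (f y i 0) * heatH s x y)%:E - (part e (f x i 0))%:E| <=
    heat_pot s W x)%E}.
Proof.
move=> s0; apply: (@heat_representation _ _ (source g i e 0) (source g i e 1) (source g i e 2) W p s).
- exact: if_.
- by apply: gauss_integrable_measurable; exact: source_gauss.
- by apply: gauss_integrable_measurable; exact: source_gauss.
- by apply: gauss_integrable_measurable; exact: source_gauss.
- exact: gauss_integrableZ.
- by move=> y; rewrite mulr_ge0// sqrtr_ge0.
- move=> y.
  have := (source_const_le g i e 0 y, source_const_le g i e 1 y, source_const_le g i e 2 y) => -[[h1 h2] h3].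
  have -> : W y = 24 * (source_const * (2 * enorm (g y)) + source_const * (2 * enorm (g y)) +
      source_const * (2 * enorm (g y))) by rewrite /W /K; ring.
  apply: ler_wpM2l; first exact: ler0n.
  exact: lerD (lerD h1 h2) h3.
- apply: heat_weak_of_weak_lap; [exact: if_|exact: source_gauss..|exact: weak_lap_of_dirac].
- exact: p1.
- exact: s0.
- by rewrite WpE lte_mul_pinfty// lee_fin powR_ge0.
Qed.

Lemma level_set_le (s u : R) : 0 < s -> 0 < u ->
  (forall x, u <= enorm (f x) -> enorm (heat (s ^+ 2 / 2) f x) <= u / 6) ->
  (L3 R [set x | (u <= enorm (f x))%R] <=
   ((12 * s / u * (144 * source_const)) `^ p)%:E * \int[L3 R]_y (enorm (g y) `^ p)%:E)%E.
Proof.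
move=> s0 u0 hs.
have mW : measurable_fun setT W by exact: measurable_funM.
have W0 y : 0 <= W y by rewrite mulr_ge0// sqrtr_ge0.
have mf i e := gauss_integrable_measurable (if_ i e).
have u60 : 0 < u / 6 by rewrite divr_gt0.
have key : {ae L3 R, forall x, [set x | (u <= enorm (f x))%R] x -> [set x | (u / 6)%:E <= heat_pot s W x]%E x}.
  have : {ae L3 R, forall x, forall i : 'I_4, forall e : bool,
      (`|\int[L3 R]_y (part e (f y i 0) * heatH s x y)%:E - (part e (f x i 0))%:E| <= heat_pot s W x)%E}.
    apply: filter_forall => i; apply: filter_forall => e; exact: representation.
  move=> H; apply: (@filterS _ _ (ae_filter_ringOfSetsType (L3 R)) _ _ _ H) => x hx /= ux.
  have [i [e hie]] := enorm_part_ge u0 ux.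
  apply: le_trans (hx i e).
  have fin := integrable_fin_num measurableT (integrable_heat x (if_ i e) s0).
  have hh := le_trans (part_le_enorm e i _) (hs x ux).
  rewrite heat_part// in hh.
  by apply: (abse_sub_ge fin hh); lra.
have mA : measurable ([set x | (u <= enorm (f x))%R] : set T3).
  have := measurable_part_enorm mf measurableT (measurable_itv `[u, +oo[).
  rewrite setTI (_ : _ @^-1` _ = [set x | (u <= enorm (f x))%R])//.
  by apply/seteqP; split => x /=; rewrite in_itv/= andbT.
have mB : measurable [set x | ((u / 6)%:E <= heat_pot s W x)%E].
  by rewrite -[X in measurable X]setTI; apply: emeasurable_fun_c_infty => //; exact: measurable_heat_pot.
apply: (le_trans (ae_le_measure mA mB key)).
apply: (le_trans (heat_pot_weak_type s0 u60 p1 mW W0)).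
rewrite WpE muleA -EFinM -powRM//; last by rewrite !divr_ge0// ?mulr_ge0// ltW.
rewrite (_ : 2 * s / (u / 6) = 12 * s / u)//; field; by rewrite gt_eqF.
Qed.

End level_sets.

Section weak_estimate.
Context {R : realType}.
Local Notation T3 := (R3 (measurableTypeR R)).
Implicit Types (Omega : set (R3 R)) (f g : R3 R -> C4 R).

Lemma besov_norm_ub Omega a f (B t : R) x : (besov_norm Omega a f <= B%:E)%E -> 0 < t -> Omega x ->
  t `^ (- a / 2) * enorm (heat t (zero_ext Omega f) x) <= B.
Proof.
move=> hB t0 Ox; rewrite -lee_fin (le_trans _ hB)// EFinM.
apply: (le_trans _ (ereal_sup_ubound (ex_intro2 _ _ t t0 erefl))).
apply: lee_wpmul2l; first by rewrite lee_fin powR_ge0.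
by apply: ereal_sup_ubound; exists x.
Qed.

Lemma level_set_zero_ext Omega f (u : R) : 0 < u ->
  Omega `&` [set x | u <= enorm (f x)] = [set x | u <= enorm (zero_ext Omega f x)].
Proof.
move=> u0; apply/seteqP; split=> x /=; rewrite /zero_ext /patch.
  by move=> [Ox ux]; rewrite mem_set.
by case: ifPn => [/set_mem Ox ux//|_]; rewrite enorm0 leNgt u0.
Qed.

Lemma lp_norm_zero_ext Omega g (p : R) : p != 0 ->
  lp_norm Omega p g = ((\int[L3 R]_y (enorm (zero_ext Omega g y) `^ p)%:E) `^ p^-1)%E.
Proof.
move=> p0; rewrite /lp_norm integral_mkcond.
have -> : (fun x => (enorm (g x) `^ p)%:E) \_ Omega = fun y => (enorm (zero_ext Omega g y) `^ p)%:E.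
  apply/funext => y; rewrite patchE /zero_ext /patch; case: ifP => // _.
  by rewrite enorm0 powR0.
by [].
Qed.

Lemma besov_exponent (p q : R) : 0 < p -> p < q ->
  p / q / (p / q - 1) != 0 /\ (p / q / (p / q - 1))^-1 * p = p - q.
Proof.
move=> p0 pq; have pn : p != 0 by rewrite gt_eqF.
have qn : q != 0 by rewrite gt_eqF// (lt_trans p0).
have pqn : p - q != 0 by rewrite subr_eq0 lt_eqF.
have -> : p / q / (p / q - 1) = p / (p - q).
  by rewrite (_ : p / q - 1 = (p - q) / q); field; rewrite ?pn ?qn ?pqn.
by split; [rewrite mulf_neq0// invr_eq0|rewrite invf_div; field].
Qed.

Lemma level_exponents (L u b p q k : R) : 0 <= L -> 0 < u -> 0 < b -> k * p = p - q ->
  u `^ q * (L * ((u / b) `^ k / u)) `^ p = L `^ p * b `^ (q - p).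
Proof.
move=> L0 u0 b0 kp; have u0' := ltW u0; have b0' := ltW b0.
have un : u != 0 by rewrite gt_eqF.
rewrite -(powR_inv1 u0') -(powR_inv1 b0').
rewrite powRM ?mulr_ge0 ?powR_ge0// powRM ?powR_ge0// -!powRrM kp powRM ?powR_ge0// -!powRrM.
rewrite mulrCA; congr (_ * _).
rewrite [X in _ * X]mulrAC mulrA mulrA -!powRD ?un ?implybT//.
rewrite (_ : q + (p - q) + -1 * p = 0); last by ring.
by rewrite powRr0 mul1r; congr (_ `^ _); ring.
Qed.

Lemma weak_norm_le Omega f g (p q B : R) : 1 <= p -> p < q -> 0 < B ->
  dirac_distr (zero_ext Omega f) (zero_ext Omega g) ->
  (\int[L3 R]_y (enorm (zero_ext Omega g y) `^ p)%:E < +oo)%E ->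
  Omega !=set0 ->
  (forall t x, 0 < t -> Omega x ->
    integrable4 setT (fun y => (heat_kernel t x y)%:C%C *: zero_ext Omega f y)) ->
  (besov_norm Omega (p / q / (p / q - 1)) f <= B%:E)%E ->
  (weak_norm Omega q f <= ((12 * Num.sqrt 2 * (144 * source_const)) `^ (p / q) * (6 * B) `^ (1 - p / q))%:E *
    (\int[L3 R]_y (enorm (zero_ext Omega g y) `^ p)%:E) `^ q^-1)%E.
Proof.
move=> p1 pq B0 [lf lg dirac] gp [x0 Ox0] hf hB.
have p0 : 0 < p by rewrite (lt_le_trans ltr01).
have q0 : 0 < q by rewrite (lt_trans p0).
set a := _ / _ in hB.
have [an pa] : a != 0 /\ a^-1 * p = p - q := besov_exponent p0 pq.
set I := (\int[L3 R]_y _)%E.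
set L := 12 * Num.sqrt 2 * (144 * source_const).
have L0 : 0 <= L by rewrite !mulr_ge0// ?sqrtr_ge0// source_const_ge0.
have I0 : (0 <= I)%E by apply: integral_ge0 => y _; rewrite lee_fin powR_ge0.
pose f0 := zero_ext Omega f; pose g0 := zero_ext Omega g.
have cf i : cgauss (fun y => f0 y i 0).
  apply: (@heat_integrable_gauss _ f0 x0) => [e|t t0]; first exact: loc_integrable_part.
  exact: hf.
have mg i e : measurable_fun setT (fun y => part e (g0 y i 0)) by exact: loc_integrable_part.
have level u : 0 < u -> ((u `^ q)%:E * L3 R [set x | (u <= enorm (f0 x))%R] <=
    (L `^ p * (6 * B) `^ (q - p))%:E * I)%E.
  move=> u0; pose r := (u / (6 * B)) `^ a^-1.
  have w0 : 0 < u / (6 * B) by rewrite divr_gt0// mulr_gt0.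
  have r0 : 0 < r by rewrite powR_gt0.
  have s0 : 0 < Num.sqrt 2 * r by rewrite mulr_gt0// sqrtr_gt0.
  have s2 : (Num.sqrt 2 * r) ^+ 2 / 2 = r ^+ 2.
    by rewrite exprMn sqr_sqrtr// mulrAC divff// mul1r.
  have hs x : u <= enorm (f0 x) -> enorm (heat ((Num.sqrt 2 * r) ^+ 2 / 2) f0 x) <= u / 6.
    move=> ux; have Ox : Omega x.
      by have : [set y | u <= enorm (f0 y)] x := ux; rewrite -level_set_zero_ext// => -[].
    have := besov_norm_ub hB (exprn_gt0 2 r0) Ox; rewrite s2.
    rewrite -powR_mulrn ?(ltW r0)// -powRrM (_ : 2 * (- a / 2) = - a); last by field.
    rewrite powRN -powRrM mulVf// powRr1 ?(ltW w0)// invf_div mulrAC ler_pdivrMr//.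
    by rewrite [6 * B]mulrC -mulrA [6 * _]mulrC ler_pM2l// ler_pdivlMr.
  have := level_set_le p1 cf mg gp dirac s0 u0 hs.
  rewrite -/I => h; apply: (le_trans (lee_wpmul2l _ h)); first by rewrite lee_fin powR_ge0.
  rewrite muleA -EFinM; apply: lee_wpmul2r => //; rewrite lee_fin le_eqVlt; apply/orP; left; apply/eqP.
  have -> : 12 * (Num.sqrt 2 * r) / u * (144 * source_const) = L * (r / u) by rewrite /L; ring.
  exact: level_exponents L0 u0 (mulr_gt0 (ltr0Sn _ 5) B0) pa.
rewrite /weak_norm.
apply: (@le_trans _ _ (((L `^ p * (6 * B) `^ (q - p))%:E * I) `^ q^-1)%E); last first.
  rewrite poweRM// ?lee_fin ?mulr_ge0 ?powR_ge0//.
  rewrite poweR_EFin powRM ?powR_ge0// -!powRrM.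
  by rewrite (_ : (q - p) / q = 1 - p / q)// mulrBl divff// gt_eqF.
apply: gt0_ler_poweR; first by rewrite invr_ge0 ltW.
- rewrite in_itv/= leey andbT; apply: le_trans (ereal_sup_ubound (ex_intro2 _ _ 1 ltr01 erefl)).
  by rewrite mule_ge0// lee_fin powR_ge0.
- by rewrite in_itv/= leey andbT mule_ge0// lee_fin mulr_ge0// powR_ge0.
apply: ub_ereal_sup => _ [u /= u0 <-]; rewrite level_set_zero_ext//; exact: level.
Qed.

Lemma weak_norm0 f (q : R) : 0 < q -> weak_norm set0 q f = 0%E.
Proof.
move=> q0; rewrite /weak_norm (_ : [set _ | u in _] = [set 0%E]).
  by rewrite ereal_sup1 poweR0r// invr_eq0 gt_eqF.
apply/seteqP; split=> [_ [u _ <-]|_ ->]; first by rewrite set0I measure0 mule0.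
by exists 1; [exact: ltr01|rewrite set0I measure0 mule0].
Qed.

Lemma besov_norm_ge0 Omega a f : Omega !=set0 -> (0 <= besov_norm Omega a f)%E.
Proof.
move=> [x Ox]; apply: le_trans (ereal_sup_ubound (ex_intro2 _ _ 1 ltr01 erefl)).
apply: mule_ge0; first by rewrite lee_fin powR_ge0.
apply: le_trans (ereal_sup_ubound (ex_intro2 _ _ x Ox erefl)).
by rewrite lee_fin sqrtr_ge0.
Qed.

Lemma le_powR_inf (w : \bar R) (c b k : R) : 0 <= c -> 0 <= b -> 0 < k ->
  (forall B, 0 < B -> b <= B -> (w <= (c * B `^ k)%:E)%E) -> (w <= (c * b `^ k)%:E)%E.
Proof.
move=> c0 b0 k0 h; move: b0; rewrite le_eqVlt => /predU1P[b0|b0]; last exact: h.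
subst b; rewrite powR0 ?gt_eqF// mulr0; apply/lee_addgt0Pr => e e0; rewrite add0e.
have c1 : 0 < c + 1 by rewrite ltr_wpDl.
have d0 : 0 < e / (c + 1) by rewrite divr_gt0.
have B0 : 0 < (e / (c + 1)) `^ k^-1 by rewrite powR_gt0.
apply: (le_trans (h _ B0 (ltW B0))); rewrite -powRrM mulVf ?gt_eqF// powRr1 ?(ltW d0)//.
by rewrite lee_fin mulrA ler_pdivrMr// mulrC ler_pM2l// lerDl.
Qed.

End weak_estimate.

Theorem theorem2 (R : realType) (Omega : set (R3 R)) (hOmega : open Omega)
    (p q : R) (hp : 1 <= p) (hpq : p < q) :
  let theta := p / q in
  let a := theta / (theta - 1) in
  exists2 C : R, 0 < C &
  forall f g : R3 R -> C4 R,
    dirac_distr (zero_ext Omega f) (zero_ext Omega g) ->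
    (lp_norm Omega p g < +oo)%E ->
    besov_space Omega a f ->
    (weak_norm Omega q f <=
     C%:E * (lp_norm Omega p g) `^ theta * (besov_norm Omega a f) `^ (1 - theta))%E.
Proof.
move=> theta a.
have p0 : 0 < p by rewrite (lt_le_trans ltr01).
have q0 : 0 < q by rewrite (lt_trans p0).
have k0 : 0 < 1 - theta by rewrite subr_gt0 /theta ltr_pdivrMr// mul1r.
pose L : R := 12 * Num.sqrt 2 * (144 * source_const).
pose C := L `^ theta * 6 `^ (1 - theta).
have C0 : 0 <= C by rewrite mulr_ge0// powR_ge0.
exists (C + 1); first by rewrite ltr_wpDl.
move=> f g dirac gp [hf bfin _].
have [->|/set0P O0] := eqVneq Omega set0.
  by rewrite weak_norm0// !mule_ge0 ?poweR_ge0// lee_fin addr_ge0.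
have [b bE b0] : exists2 b : R, besov_norm Omega a f = b%:E & 0 <= b.
  have := besov_norm_ge0 a f O0; move: bfin; case: (besov_norm _ _ _) => [r _ r0| |]//.
  by exists r.
rewrite bE lp_norm_zero_ext ?gt_eqF//; rewrite lp_norm_zero_ext ?gt_eqF// in gp.
set I := (\int[L3 R]_y _)%E in gp *.
have I0 : (0 <= I)%E by apply: integral_ge0 => y _; rewrite lee_fin powR_ge0.
have Ioo : (I < +oo)%E.
  by rewrite ltey; apply/eqP => Iy; move: gp; rewrite Iy poweRyr// invr_eq0 gt_eqF.
have [r rE r0] : exists2 r : R, I = r%:E & 0 <= r.
  by move: I0 Ioo; case: I {gp} => [r r0 _| |]//; exists r.
have h B : 0 < B -> b <= B -> (weak_norm Omega q f <= ((C * r `^ q^-1) * B `^ (1 - theta))%:E)%E.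
  move=> B0 bB.
  have := @weak_norm_le R Omega f g p q B hp hpq B0 dirac Ioo O0 hf.
  rewrite -/theta -/a bE lee_fin => /(_ bB); rewrite -/I rE poweR_EFin -EFinM powRM// ?(ltW B0)//.
  by rewrite -/L (_ : C * _ * _ = L `^ theta * (6 `^ (1 - theta) * B `^ (1 - theta)) * r `^ q^-1)// /C; ring.
apply: (le_trans (le_powR_inf (mulr_ge0 C0 (powR_ge0 _ _)) b0 k0 h)).
rewrite rE !poweR_EFin -!EFinM lee_fin -powRrM (_ : p^-1 * theta = q^-1).
  by rewrite ler_wpM2r ?powR_ge0// ler_wpM2r ?powR_ge0// lerDl.
by rewrite /theta mulrA mulVf ?mul1r// gt_eqF.
Qed.
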